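(* Let $Y\subset\mathbb{C}^n$ and $x\in\mathbb{C}^n$. Then the following conditions are equivalent: (i) $Y$ is non-thin at $x$; (ii) for every $\epsilon>0$, every neighbourhood $V$ of $x$ and every open set $U\subset\mathbb{C}^n$ containing $Y\setminus\{x\}$ there exists $f\in\mathcal{O}(\overline{\mathbb{D}},V)$ such that $f(0)=x$ and $$\sigma\bigl(\mathbb{T}\cap f^{-1}(V\cap U)\bigr)>1-\epsilon.$$
   Context: $\mathbb{D}$ is the open unit disc in $\mathbb{C}$, $\mathbb{T}$ the unit circle, and $\sigma$ the arc length measure on $\mathbb{T}$ normalized so that $\sigma(\mathbb{T})=1$. $\mathcal{O}(\overline{\mathbb{D}},V)$ is the set of maps $f$ holomorphic on a neighbourhood of $\overline{\mathbb{D}}$ with $f(\overline{\mathbb{D}})\subset V$. A set $Y\subset\mathbb{C}^n$ is non-thin at $x\in\mathbb{C}^n$ if $x\in\overline{Y\setminus\{x\}}$ and, for every plurisubharmonic function $u$ defined on a neighbourhood of $x$, $$\limsup_{z\to x,\ z\in Y\setminus\{x\}}u(z)=u(x),$$ where $\limsup_{z\to x,\ z\in E}u(z)=\inf_{r>0}\sup\{u(z): z\in\overline{B}(x,r)\cap E\}$. The constant function $-\infty$ is considered plurisubharmonic. *)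

(* Defs.v *)
From HB Require Import structures.
From mathcomp Require Export all_boot all_order all_algebra.
From mathcomp Require Export complex.
From mathcomp Require Export all_classical all_reals all_analysis.

Set Implicit Arguments.
Unset Strict Implicit.
Unset Printing Implicit Defensive.

Export Order.TTheory GRing.Theory Num.Theory.
Export numFieldNormedType.Exports.

Local Open Scope classical_set_scope.
Local Open Scope ring_scope.
Local Open Scope complex_scope.

(* The norm topology of R[i], declared on the type complex R itself so that
   nbhs, open, derivable and so on are found for R[i] and 'rV[R[i]]_n. *)
HB.instance Definition _ (R : rcfType) := NormedModule.copy R[i] R[i]^o.

Definition unit_circle (R : realType) : set R[i] := [set z | `|z| = 1].

Definition closed_disc (R : realType) (a : R[i]) (r : R) : set R[i] :=
  [set z | `|z - a| <= r%:C].

Definition expi (R : realType) (t : R) : R[i] := cos t +i* sin t.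

(* t |-> expi t has unit speed on [0, 2 pi[, so the arc length of a subset of
   the unit circle is the Lebesgue measure of its set of arguments. *)
Definition arc_measure (R : realType) (A : set R[i]) : \bar R :=
  (((2 * pi)^-1)%R%:E *
     lebesgue_measure (`[0%R, (2 * pi)%R[ `&` [set t : R | A (expi t)]))%E.

Definition circle_mean (R : realType) (v : R[i] -> \bar R) (a : R[i]) (r : R) :
    \bar R :=
  (((2 * pi)^-1)%R%:E *
     \int[lebesgue_measure]_(t in `[0%R, (2 * pi)%R[) v (a + r%:C * expi t)%R)%E.

(* Upper semicontinuous with values in [-oo, +oo[ on D; v is irrelevant
   outside D. *)
Definition usc_on (R : realType) (X : topologicalType) (D : set X)
    (v : X -> \bar R) :=
  forall x, D x -> (v x < +oo)%E /\
    forall c : R, (v x < c%:E)%E ->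
      \forall y \near within D (nbhs x), (v y < c%:E)%E.

(* Functions equal to -oo on a component of D (or on all of D) are allowed.
   The integral in circle_mean is meaningful: v is bounded above on circles, so
   only the negative part can have an infinite integral. *)
Definition subharmonic (R : realType) (D : set R[i]) (v : R[i] -> \bar R) :=
  usc_on D v /\
  forall (a : R[i]) (r : R), 0 < r -> closed_disc a r `<=` D ->
    (v a <= circle_mean v a r)%E.

Definition plurisubharmonic (R : realType) (n : nat) (W : set 'rV[R[i]]_n)
    (u : 'rV[R[i]]_n -> \bar R) :=
  usc_on W u /\
  forall a b : 'rV[R[i]]_n,
    subharmonic [set l : R[i] | W (a + l *: b)] (fun l => u (a + l *: b)).

(* Euclidean ball; the library norm on row vectors is the sup norm, which
   induces the same topology. *)
Definition euclidean_closed_ball (R : realType) (n : nat) (x : 'rV[R[i]]_n)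
    (r : R) : set 'rV[R[i]]_n :=
  [set z | \sum_(i < n) `|z 0 i - x 0 i| ^+ 2 <= (r ^+ 2)%:C].

Definition limsup_along (R : realType) (n : nat) (u : 'rV[R[i]]_n -> \bar R)
    (E : set 'rV[R[i]]_n) (x : 'rV[R[i]]_n) : \bar R :=
  ereal_inf [set ereal_sup (u @` (euclidean_closed_ball x r `&` E)) |
    r in [set r : R | 0 < r]].

(* A function u defined on the open neighbourhood W of x is represented by a
   total function, whence the restriction of the limsup to W. *)
Definition non_thin (R : realType) (n : nat) (Y : set 'rV[R[i]]_n)
    (x : 'rV[R[i]]_n) :=
  closure (Y `\ x) x /\
  forall (W : set 'rV[R[i]]_n) (u : 'rV[R[i]]_n -> \bar R),
    open W -> W x -> plurisubharmonic W u ->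
    limsup_along u (W `&` (Y `\ x)) x = u x.

(* derivable is taken over the scalar field R[i], hence is complex
   differentiability. *)
Definition holomorphic_disc (R : realType) (n : nat) (V : set 'rV[R[i]]_n)
    (f : R[i] -> 'rV[R[i]]_n) :=
  (exists W : set R[i], [/\ open W, closed_disc 0 1 `<=` W &
     forall z, W z -> derivable f z 1]) /\
  f @` closed_disc 0 1 `<=` V.

(* Main.v *)
Require Import Defs.
From mathcomp Require Import ring lra zify measurable_realfun.

(** Discs and plurisubharmonic functions are dual to each other: such a
    function satisfies a mean value inequality along every analytic disc, and
    the extremal problem for discs that have to visit a given open set is
    solved, up to sign, by a plurisubharmonic function.

    From discs to non-thinness.  Upper semicontinuity gives one inequality
    between the limsup and u(x).  If the limsup were smaller than some
    c < u(x), then u < c on an open set containing the part of Y other than x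
    in a small polydisc around x, and u < u(x) + 1 on the polydisc.  A disc
    centred at x that spends nearly the whole circle in the open set would
    give u(x) < u(x), by the two-constants estimate [psh_two_constants]
    ([non_thin_of_discs]).  The estimate follows from [psh_disc_majorant]: if
    u o f is below Re P on the circle, with P holomorphic, it is below Re P at
    the centre.  Plurisubharmonicity controls u on complex lines only, so this
    is proved by a maximum principle in which f is replaced by its tangent
    line at an interior maximum and the error is absorbed by an auxiliary
    translation.  It rests on the mean value property of the real part of a
    holomorphic function ([mean_value_Re]), which is Goursat's theorem in polar
    coordinates ([goursat_rectangle]).  The indicator of an open part of the
    circle is approximated by the real part of a polynomial, with the help of
    an explicit kernel ([harmonic_minorant]).

    From non-thinness to discs.  Let U be open and contain all points of Y
    other than x.  To a point z of a polydisc around x attach the supremum s(z)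
    of the lengths of the parts of the circle that polynomial discs centred at
    z map into U.  Then -s is plurisubharmonic: this is Poletsky's theorem
    ([envelope_plurisubharmonic]).  Semicontinuity holds because discs can be
    translated.  For the mean value inequality on a circle in a complex line,
    nearly optimal discs centred at finitely many points of that circle are
    glued to a single disc centred at its centre ([glue_discs]): one averages
    the discs P_j(z^K), for a large K, with weights given by the same kernel.
    At the points of Y other than x, constant discs show that s = 2 pi, so
    non-thinness gives s(x) = 2 pi, and this provides the required discs
    ([discs_of_non_thin]).  The maximum principle for polynomials keeps them
    in the polydisc. *)

Set Implicit Arguments.
Unset Strict Implicit.
Unset Printing Implicit Defensive.
Import ComplexField.Normc.
Local Open Scope classical_set_scope.
Local Open Scope ring_scope.
Local Open Scope complex_scope.

(** * Modulus and unit circle *)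

Section Modulus.
Variable R : realType.
Implicit Types (z w : R[i]) (r : R).

Lemma normrc z : `|z| = (normc z)%:C. Proof. by []. Qed.

Lemma normc_ge0 z : 0 <= normc z.
Proof. by case: z => a b; exact: sqrtr_ge0. Qed.

Lemma normcD z w : normc (z + w) <= normc z + normc w.
Proof. exact: le_normcD. Qed.

Lemma normc_opp z : normc (- z) = normc z.
Proof. exact: normcN. Qed.

Lemma normc_distC z w : normc (z - w) = normc (w - z).
Proof. by rewrite -normc_opp opprB. Qed.

Lemma normc_distD y z w : normc (z - w) <= normc (z - y) + normc (y - w).
Proof. by rewrite -[z - w](subrKA y) normcD. Qed.

Lemma normcX z n : normc (z ^+ n) = normc z ^+ n.
Proof. by elim: n => [|n IH]; rewrite ?expr0 ?normc1// !exprS normcM IH. Qed.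

Lemma normc_real r : normc r%:C = `|r|.
Proof. by rewrite /= expr0n/= addr0 sqrtr_sqr. Qed.

Lemma normc_sum (I : Type) (s : seq I) (P : pred I) (F : I -> R[i]) :
  normc (\sum_(i <- s | P i) F i) <= \sum_(i <- s | P i) normc (F i).
Proof.
elim/big_rec2 : _ => [|i y x _ le_xy]; first by rewrite normc0.
by rewrite (le_trans (normcD _ _))// lerD2l.
Qed.

Lemma normc2 z : normc z ^+ 2 = complex.Re z ^+ 2 + complex.Im z ^+ 2.
Proof. by case: z => a b /=; rewrite sqr_sqrtr// addr_ge0// sqr_ge0. Qed.

Lemma normRe_le z : `|complex.Re z| <= normc z.
Proof.
rewrite -(@ler_pXn2r _ 2)// ?nnegrE ?normc_ge0//.
by rewrite normc2 real_normK ?num_real// lerDl sqr_ge0.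
Qed.

Lemma normIm_le z : `|complex.Im z| <= normc z.
Proof.
rewrite -(@ler_pXn2r _ 2)// ?nnegrE ?normc_ge0//.
by rewrite normc2 real_normK ?num_real// lerDr sqr_ge0.
Qed.

Lemma normc_le_ReIm z : normc z <= `|complex.Re z| + `|complex.Im z|.
Proof.
rewrite -(@ler_pXn2r _ 2)// ?nnegrE ?normc_ge0 ?addr_ge0//.
rewrite normc2 sqrrD !real_normK ?num_real// addrAC lerDl.
by rewrite mulrn_wge0// mulr_ge0.
Qed.

Lemma normc_eq0 z : (normc z == 0) = (z == 0).
Proof.
by apply/eqP/eqP => [|->]; [exact: eq0_normc | rewrite normc0].
Qed.

Lemma normc_conj z : normc z^*%C = normc z.
Proof. by case: z => a b /=; rewrite sqrrN. Qed.

Lemma ReD z w : complex.Re (z + w) = complex.Re z + complex.Re w.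
Proof. by case: z w => a b []. Qed.

Lemma ReN z : complex.Re (- z) = - complex.Re z.
Proof. by case: z. Qed.

Lemma ReB z w : complex.Re (z - w) = complex.Re z - complex.Re w.
Proof. by rewrite ReD ReN. Qed.

Lemma ReM_real r z : complex.Re (r%:C * z) = r * complex.Re z.
Proof. by case: z => a b /=; rewrite mul0r subr0. Qed.

Lemma ImD z w : complex.Im (z + w) = complex.Im z + complex.Im w.
Proof. by case: z w => a b []. Qed.

Lemma ImN z : complex.Im (- z) = - complex.Im z.
Proof. by case: z. Qed.

Lemma Re_sum (I : Type) (s : seq I) (P : pred I) (F : I -> R[i]) :
  complex.Re (\sum_(i <- s | P i) F i)
  = \sum_(i <- s | P i) complex.Re (F i).
Proof. by elim/big_rec2 : _ => // i y x _ <-; rewrite ReD. Qed.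

Lemma normc2_conj z : (normc z ^+ 2)%:C = z * z^*%C.
Proof. by rewrite -sqr_normc normrc rmorphXn. Qed.

Lemma closed_discE (a : R[i]) r z : closed_disc a r z <-> normc (z - a) <= r.
Proof. by rewrite /closed_disc /= lecR. Qed.

Lemma unit_circleE z : unit_circle z <-> normc z = 1.
Proof.
rewrite /unit_circle /= normrc; split => [[]//|->//].
Qed.

End Modulus.

Section Circle.
Variable R : realType.
Implicit Types (s t : R) (z : R[i]).

Lemma expi0 : expi (0 : R) = 1.
Proof. by rewrite /expi cos0 sin0. Qed.

Lemma expiD s t : expi (s + t) = expi s * expi t.
Proof.
by rewrite /expi cosD sinD; simpc; congr (_ +i* _); rewrite addrC mulrC.
Qed.

Lemma normc_expi t : normc (expi t) = 1.
Proof. by rewrite /= cos2Dsin2 sqrtr1. Qed.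

Lemma expi_natmul t n : expi (n%:R * t) = expi t ^+ n.
Proof.
elim: n => [|n IH]; first by rewrite mul0r expi0 expr0.
by rewrite -natr1 mulrDl mul1r expiD IH exprSr.
Qed.

Lemma expi_2pi n : expi (n%:R * (2 * pi)) = 1 :> R[i].
Proof.
rewrite expi_natmul; suff -> : expi (2 * pi) = 1 :> R[i] by rewrite expr1n.
by rewrite /expi mulr_natl cos2pi mulr2n sinDpi sinpi oppr0.
Qed.

Lemma expi_periodic t n : expi (t + n%:R * (2 * pi)) = expi t.
Proof. by rewrite expiD expi_2pi mulr1. Qed.

Lemma normc_expiB2 s t :
  normc (expi s - expi t) ^+ 2 = 2 - 2 * cos (s - t).
Proof.
rewrite normc2 /= cosB.
have := cos2Dsin2 s; have := cos2Dsin2 t; lra.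
Qed.

Lemma normr_sin_le t : `|sin t| <= `|t|.
Proof.
have pos (u : R) : 0 < u -> `|sin u| <= u.
  move=> u0.
  have dsin (v : R) : v \in `]0, u[ -> is_derive v 1 sin (cos v) by move=> _; exact: is_derive_sin.
  have csin : {within `[0, u], continuous (@sin R)}.
    by apply: continuous_subspaceT => v; exact: continuous_sin.
  have [c _] := MVT u0 dsin csin.
  rewrite sin0 !subr0 => ->; rewrite normrM (gtr0_norm u0) ler_piMl//; first exact: ltW.
  exact: cos_max.
have [t0|t0|->] := ltgtP t 0; last by rewrite sin0.
- rewrite -normrN -sinN -[leRHS]normrN (gtr0_norm (_ : 0 < - t)) ?oppr_gt0//.
  by apply: pos; rewrite oppr_gt0.
- by rewrite [leRHS]gtr0_norm// pos.
Qed.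

Lemma expi_lipschitz s t : normc (expi s - expi t) <= `|s - t|.
Proof.
rewrite -(@ler_pXn2r _ 2)// ?nnegrE ?normc_ge0// normc_expiB2.
rewrite real_normK ?num_real//; set x := s - t.
have -> : x = (x / 2) *+ 2 by rewrite mulr2n -splitr.
rewrite cos_mulr2n; have := cos2Dsin2 (x / 2).
have : sin (x / 2) ^+ 2 <= (x / 2) ^+ 2.
  rewrite -[leLHS]real_normK ?num_real// -[leRHS]real_normK ?num_real//.
  by rewrite ler_pXn2r ?nnegrE// normr_sin_le.
rewrite !mulr2n; by set a := sin _; set b := cos _; set c := x / 2; nra.
Qed.

Lemma continuous_cos_sin_lipschitz s t :
  (`|cos s - cos t| <= `|s - t|) /\ (`|sin s - sin t| <= `|s - t|).
Proof.
split; apply: le_trans (expi_lipschitz s t).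
  exact: (normRe_le (expi s - expi t)).
exact: (normIm_le (expi s - expi t)).
Qed.

(** The hypotheses say that d is at most the distance from u to the multiples
    of 2 pi, and the cosine decreases with that distance. *)
Lemma cos_le_of_dist (d u : R) : 0 <= d -> d <= u -> u <= 2 * pi - d ->
  cos u <= cos d.
Proof.
move=> d0 du u2; have half (v : R) : d <= v -> v <= pi -> cos v <= cos d.
  rewrite le_eqVlt => /orP[/eqP<-//|dv vpi].
  by rewrite ltW// ltr_cos// in_itv/=; lra.
have [up|pu] := leP u pi; first exact: half.
have -> : cos u = cos (2 * pi - u).
  rewrite -[LHS]cosN -[LHS]cosD2pi mulr_natl.
  by congr cos; ring.
by apply: half; lra.
Qed.

End Circle.

(** * A positive kernel on the grid of roots of unity *)

Section Expansion.
Variable K : comNzRingType.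

Lemma mul_expr1D (x y z : K) (N : nat) :
  x * (1 + y * z) ^+ N = \sum_(a < N.+1) z ^+ a *+ 'C(N, a) * (x * y ^+ a).
Proof.
rewrite exprDn mulr_sumr; apply: eq_bigr => a _.
by rewrite expr1n mul1r exprMn !mulrnAl mulrnAr; congr (_ *+ _); ring.
Qed.

(** After expanding the power, every monomial except z^N carries a
    non-trivial power of g or of its inverse c, and these sum to zero. *)
Lemma sum_binomial_roots (L N : nat) (g c : nat -> K) (z : K) : (N < L)%N ->
  (forall k, g k * c k = 1) ->
  (forall a, (0 < a < L)%N -> \sum_(k < L) g k ^+ a = 0) ->
  (forall a, (0 < a < L)%N -> \sum_(k < L) c k ^+ a = 0) ->
  \sum_(k < L) g k ^+ N * (1 + c k * z) ^+ (N + N)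
  = (L * 'C(N + N, N))%:R * z ^+ N.
Proof.
move=> NL gc g0 c0; under eq_bigr do rewrite mul_expr1D.
rewrite exchange_big/=.
have Nlt : (N < (N + N).+1)%N by lia.
rewrite (bigD1 (Ordinal Nlt))//= -mulr_sumr.
rewrite (eq_bigr (fun=> 1)) => [|k _]; last by rewrite -exprMn gc expr1n.
rewrite sumr_const card_ord big1 ?addr0 => [|a aN].
  by rewrite -[_ *+ 'C(_, _)]mulr_natr natrM -mulrA mulrC [_ * L%:R]mulrC.
rewrite -mulr_sumr.
have neq : nat_of_ord a <> N by move=> e; move/eqP: aN; apply; exact: val_inj.
suff -> : \sum_(k < L) g k ^+ N * c k ^+ a = 0 by rewrite mulr0.
have [aN'|Na] := ltnP a N.
  have gNa : \sum_(k < L) g k ^+ (N - a) = 0 by apply: g0; lia.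
  rewrite -[RHS]gNa; apply: eq_bigr => k _; rewrite -{1}(subnK (ltnW aN')) exprD -mulrA.
  by rewrite -exprMn gc expr1n mulr1.
have caN : \sum_(k < L) c k ^+ (a - N) = 0.
  by apply: c0; have := ltn_ord a; lia.
rewrite -[RHS]caN; apply: eq_bigr => k _; rewrite -{1}(subnKC Na) exprD mulrA.
by rewrite -exprMn gc expr1n mul1r.
Qed.

(** Pairing the terms of index N - a and N + a makes the expansion symmetric
    in u and its inverse.  For u on the circle the two are conjugate, so the
    bracket is the real part of a polynomial in u. *)
Lemma exp_one_plus_sym (u v : K) (N : nat) : u * v = 1 ->
  (1 + u) ^+ (N + N) = u ^+ N *
    ('C(N + N, N)%:R
     + \sum_(a < N) 'C(N + N, N + a.+1)%:R * (u ^+ a.+1 + v ^+ a.+1)).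
Proof.
move=> uv; rewrite exprDn (eq_bigr (fun a : 'I__ => 'C(N + N, a)%:R * u ^+ a));
  last by move=> a _; rewrite expr1n mul1r mulr_natl.
have -> : (N + N).+1 = (N + (1 + N))%N by lia.
rewrite (@big_split_ord _ _ _ N (1 + N)) big_split_ord /= big_ord1/= addn0.
rewrite mulrDr addrCA; congr (_ + _); first by rewrite mulrC.
rewrite mulr_sumr; under [RHS]eq_bigr do rewrite mulrDr mulrDr.
rewrite big_split/= addrC; congr (_ + _).
  by apply: eq_bigr => a _; rewrite add1n exprD mulrCA.
rewrite (reindex_inj rev_ord_inj)/=; apply: eq_bigr => a _.
have aN := ltn_ord a.
rewrite -(@bin_sub (N + N) (N + a.+1)); last by lia.
have -> : (N + N - (N + a.+1))%N = (N - a.+1)%N by lia.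
rewrite mulrCA; congr (_ * _).
rewrite -[X in _ = u ^+ X * _](subnK aN) exprD -mulrA -exprMn uv expr1n.
by rewrite mulr1.
Qed.

End Expansion.

Section Kernel.
Variable R : realType.
Implicit Types (z w : R[i]).

Definition grid (L k : nat) : R[i] := expi (k%:R * (2 * pi / L%:R)).

Lemma normc_grid L k : normc (grid L k) = 1.
Proof. exact: normc_expi. Qed.

Lemma gridX L k a : grid L k ^+ a = grid L a ^+ k.
Proof. by rewrite /grid -!expi_natmul mulrCA. Qed.

Lemma grid_conjM L k : grid L k * (grid L k)^*%C = 1.
Proof. by rewrite -normc2_conj normc_grid expr1n. Qed.

Lemma grid_neq1 L a : (0 < a < L)%N -> grid L a != 1.
Proof.
move=> /andP[a0 aL]; apply/eqP => eq1.
have L0 : 0 < L%:R :> R by rewrite ltr0n; lia.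
have aL' : a%:R / L%:R < 1 :> R by rewrite ltr_pdivrMr// mul1r ltr_nat.
have a0' : 0 < a%:R / L%:R :> R by rewrite divr_gt0// ltr0n.
have pi0 := pi_gt0 R.
pose d : R := a%:R * (2 * pi / L%:R).
have dE : d = a%:R / L%:R * (2 * pi) by rewrite /d; field; rewrite gt_eqF.
have d_gt0 : 0 < d by rewrite dE mulr_gt0// mulr_gt0.
have d_lt : d < 2 * pi by rewrite dE gtr_pMl// mulr_gt0.
pose m := Num.min d (2 * pi - d); pose e := m / 2.
have m0 : 0 < m by rewrite lt_min d_gt0 subr_gt0.
have md : m <= d by rewrite ge_min lexx.
have m2 : m <= 2 * pi - d by rewrite ge_min lexx orbT.
have e0 : 0 < e by rewrite divr_gt0.
have eE : e * 2 = m by rewrite /e divfK.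
have : cos d <= cos e by apply: cos_le_of_dist; [exact: ltW|lra|lra].
have : cos e < 1.
  by rewrite -(@cos0 R) ltr_cos// in_itv/= ?lexx ?pi_ge0// (ltW e0)/=; lra.
have -> : cos d = 1 by move: eq1; rewrite /grid /expi -/d => -[].
by move=> /lt_geF ->.
Qed.

Lemma sum_gridX L a : (0 < a < L)%N -> \sum_(k < L) grid L k ^+ a = 0.
Proof.
move=> aL; have aN1 := grid_neq1 aL.
under eq_bigr do rewrite gridX.
have : (grid L a - 1) * \sum_(i < L) grid L a ^+ i = 0.
  rewrite -subrX1 -gridX /grid -expi_natmul.
  have L0 : L%:R != 0 :> R by rewrite pnatr_eq0; lia.
  have -> : a%:R * (L%:R * (2 * pi / L%:R)) = a%:R * (2 * pi) :> R by field.
  by rewrite expi_2pi subrr.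
by move/eqP; rewrite mulf_eq0 subr_eq0 (negbTE aN1) => /eqP.
Qed.

Lemma sum_gridX_conj L a : (0 < a < L)%N ->
  \sum_(k < L) (grid L k)^*%C ^+ a = 0.
Proof.
move=> /sum_gridX /(congr1 (@conjc R)); rewrite rmorph_sum conjc0 => S.
by rewrite -[RHS]S; apply: eq_bigr => k _; rewrite rmorphXn.
Qed.

Lemma sum_kernel L N z : (N < L)%N ->
  \sum_(k < L) grid L k ^+ N * (1 + (grid L k)^*%C * z) ^+ (N + N)
  = (L * 'C(N + N, N))%:R * z ^+ N.
Proof.
move=> NL; apply: (@sum_binomial_roots _ L N (grid L) (fun k => (grid L k)^*%C)) => //.
- by move=> k; exact: grid_conjM.
- exact: sum_gridX.
- exact: sum_gridX_conj.
Qed.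

(** On the circle w (1 + conj w z)^2 = z |1 + conj w z|^2. *)
Lemma kernel_circle N w z : normc w = 1 -> normc z = 1 ->
  w ^+ N * (1 + w^*%C * z) ^+ (N + N)
  = z ^+ N * (normc (1 + w^*%C * z) ^+ (N + N))%:C.
Proof.
move=> w1 z1; rewrite !exprD -!exprMn -expr2 rmorphXn /= normc2_conj -exprMn.
congr (_ ^+ _).
have ww : w * w^*%C = 1 by rewrite -normc2_conj w1 expr1n.
have zz : z * z^*%C = 1 by rewrite -normc2_conj z1 expr1n.
rewrite rmorphD rmorphM rmorph1 /= conjcK.
move: (w^*%C) (z^*%C) ww zz => w' z' ww zz.
transitivity (w + 2 * (w * w') * z + (w * w') * w' * z ^+ 2); first by ring.
transitivity (z + (z * z') * w + w' * z ^+ 2 + (w * w') * (z * z') * z).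
  by rewrite ww zz; ring.
by ring.
Qed.

(** Parallelogram law for z + w and z - w. *)
Lemma normc_kernel w z : normc w = 1 -> normc z = 1 ->
  normc (1 + w^*%C * z) ^+ 2 = 4 - normc (z - w) ^+ 2.
Proof.
move=> w1 z1; apply: (@complexI R); rewrite rmorphB /= !normc2_conj.
have ww : w * w^*%C = 1 by rewrite -normc2_conj w1 expr1n.
have zz : z * z^*%C = 1 by rewrite -normc2_conj z1 expr1n.
rewrite rmorphD rmorphB rmorphM rmorph1 /= conjcK rmorph_nat.
move: (w^*%C) (z^*%C) ww zz => w' z' ww zz.
transitivity (1 + w * z' + w' * z + (w * w') * (z * z')); first by ring.
transitivity (4 - (z * z' + w * w' - z * w' - z' * w)); last by ring.
by rewrite ww zz; ring.
Qed.

(** This bounds the normalizing constant of the weights below; the factor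
    2 N + 1 is harmless against the geometric decay of the kernel. *)
Lemma central_binomial N : (4 ^ N <= (N + N).+1 * 'C(N + N, N))%N.
Proof.
elim: N => [//|N IH].
have h1 := mul_bin_diag (N + N).+2 N; have h2 := mul_bin_down (N + N).+1 N.
rewrite addnS addSn expnS /= in h1 h2 *.
move: h1 h2 IH; have -> : ((N + N).+1 - N = N.+1)%N by lia.
by set a := 'C(_, _); set b := 'C(_, _); set c := 'C(_, _); set e := (4 ^ N)%N; nia.
Qed.

(** For z on the circle these are the masses of a probability on the grid that
    concentrates near z as N grows. *)
Definition weight (L N k : nat) z : R :=
  normc (1 + (grid L k)^*%C * z) ^+ (N + N) / (L * 'C(N + N, N))%:R.

Lemma weight_ge0 L N k z : 0 <= weight L N k z.
Proof. by rewrite divr_ge0// exprn_ge0// normc_ge0. Qed.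

Lemma kernel_norm_gt0 L N : (N < L)%N -> (0 < L * 'C(N + N, N))%N.
Proof. by move=> NL; rewrite muln_gt0 bin_gt0 leq_addr andbT; lia. Qed.

(** Up to the factor z^N the weight is a polynomial in z: this is why weighted
    averages of holomorphic data can be made holomorphic. *)
Lemma weightE L N k z : (N < L)%N -> normc z = 1 ->
  z ^+ N * (weight L N k z)%:C =
  (L * 'C(N + N, N))%:R^-1 * (grid L k ^+ N * (1 + (grid L k)^*%C * z) ^+ (N + N)).
Proof.
move=> NL z1; rewrite kernel_circle ?normc_grid// /weight rmorphM fmorphV /=.
by rewrite rmorph_nat; ring.
Qed.

Lemma sum_weight L N z : (N < L)%N -> normc z = 1 ->
  \sum_(k < L) weight L N k z = 1.
Proof.
move=> NL z1; apply: (@complexI R); rewrite rmorph_sum /=.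
have zN : z ^+ N != 0 by rewrite expf_neq0// -normc_eq0 z1 oner_eq0.
apply: (mulfI zN); rewrite mulr_sumr.
under eq_bigr do rewrite weightE//.
rewrite -mulr_sumr sum_kernel// mulrA mulVf ?mul1r ?mulr1//.
by rewrite pnatr_eq0 -lt0n kernel_norm_gt0.
Qed.

(** At distance d the kernel has lost the factor (1 - d^2 / 4)^N against its
    maximum 4^N, which is at most 2 N + 1 times the normalizing binomial. *)
Lemma sum_weight_far L N (d : R) z : (N < L)%N -> normc z = 1 -> 0 <= d <= 2 ->
  \sum_(k < L | d <= normc (z - grid L k)) weight L N k z
  <= (N + N).+1%:R * (1 - d ^+ 2 / 4) ^+ N.
Proof.
move=> NL z1 /andP[d0 d2].
have L0 : 0 < L%:R :> R by rewrite ltr0n; lia.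
have C0 : 0 < 'C(N + N, N)%:R :> R by rewrite ltr0n bin_gt0 leq_addr.
have q0 : 0 <= 1 - d ^+ 2 / 4 by nra.
have bound k : d <= normc (z - grid L k) -> weight L N k z <=
    L%:R^-1 * ((N + N).+1%:R * (1 - d ^+ 2 / 4) ^+ N).
  move=> far; rewrite /weight natrM invfM mulrCA ler_pM2l ?invr_gt0//.
  rewrite ler_pdivrMr// exprD -exprMn -expr2.
  rewrite normc_kernel ?normc_grid//.
  have -> : 4 - normc (z - grid L k) ^+ 2 = 4 * (1 - normc (z - grid L k) ^+ 2 / 4) by field.
  have n2 : normc (z - grid L k) <= 2.
    by rewrite (le_trans (normcD _ _))// normc_opp z1 normc_grid.
  rewrite exprMn [leRHS]mulrAC; apply: ler_pM.
  - by rewrite exprn_ge0.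
  - rewrite exprn_ge0//; have := normc_ge0 (z - grid L k); nra.
  - by rewrite -natrX -natrM ler_nat central_binomial.
  - rewrite lerXn2r// ?nnegrE//; have := normc_ge0 (z - grid L k); nra.
apply: (@le_trans _ _ (\sum_(k < L | d <= normc (z - grid L k))
    L%:R^-1 * ((N + N).+1%:R * (1 - d ^+ 2 / 4) ^+ N))).
  by apply: ler_sum => k; exact: bound.
rewrite sumr_const -[_ *+ #|_|]mulr_natr mulrAC ler_piMl//; first by rewrite mulr_ge0// exprn_ge0.
rewrite ler_pdivrMl// mulr1 ler_nat.
by rewrite -[leqRHS]card_ord max_card.
Qed.

(** The weight is a real trigonometric polynomial in z; keeping its mean and
    doubling its positive frequencies gives a polynomial with the same real
    part on the circle. *)
Definition weight_poly (L N k : nat) : {poly R[i]} :=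
  (L * 'C(N + N, N))%:R^-1 *: (('C(N + N, N)%:R)%:P +
    2 *: \sum_(a < N) ('C(N + N, N + a.+1)%:R * (grid L k)^*%C ^+ a.+1) *:
      'X^(a.+1)).

Lemma weight_polyE L N k z : normc z = 1 ->
  complex.Re (weight_poly L N k).[z] = weight L N k z.
Proof.
move=> z1; set u := (grid L k)^*%C * z.
have u1 : normc u = 1 by rewrite normcM normc_conj normc_grid z1 mulr1.
have uu : u * u^*%C = 1 by rewrite -normc2_conj u1 expr1n.
have -> : (weight_poly L N k).[z] = (((L * 'C(N + N, N))%:R : R)^-1)%:C *
    ('C(N + N, N)%:R +
     2 * \sum_(a < N) 'C(N + N, N + a.+1)%:R * u ^+ a.+1).
  rewrite /weight_poly !hornerE horner_sum fmorphV rmorph_nat.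
  congr (_ * (_ + _ * _)); apply: eq_bigr => a _.
  by rewrite !hornerE /u exprMn mulrA.
rewrite ReM_real /weight mulrC; congr (_ / _).
apply: (@complexI R).
have uN : u ^+ N != 0 by rewrite expf_neq0// -normc_eq0 u1 oner_eq0.
have := kernel_circle N (normc1 _) u1.
rewrite conjc1 mul1r expr1n mul1r (exp_one_plus_sym _ uu).
move=> /(mulfI uN) <-.
set S := \sum_(a < N) _ * _; rewrite ReJ_add rmorphD rmorphM !rmorph_nat.
have SE : S + S^*%C = \sum_(a < N) 'C(N + N, N + a.+1)%:R * (u ^+ a.+1 + u^*%C ^+ a.+1).
  rewrite rmorph_sum -big_split; apply: eq_bigr => a _ /=.
  by rewrite rmorphM rmorph_nat rmorphXn mulrDr.
rewrite -SE /=; clear SE; clearbody S.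
by move: (conjc S) ('C(N + N, N)%:R : R[i]) => S' c; field.
Qed.

Lemma weight_poly0 L N k : (N < L)%N -> (weight_poly L N k).[0] = L%:R^-1.
Proof.
move=> NL; rewrite /weight_poly !hornerE horner_sum big1 ?mulr0 ?addr0.
  rewrite natrM invfM mulfVK// pnatr_eq0 -lt0n bin_gt0; lia.
by move=> a _; rewrite !hornerE expr0n mulr0.
Qed.

Lemma polynomial_geometric_small (q e : R) : 0 <= q < 1 -> 0 < e ->
  exists N : nat, (N + N).+1%:R * q ^+ N <= e.
Proof.
move=> /andP[q0 q1] e0; pose p := Num.sqrt q.
have p0 : 0 <= p by exact: sqrtr_ge0.
have p1 : p < 1 by rewrite -sqrtr1 ltr_sqrt.
have qE : q = p * p by rewrite -expr2 sqr_sqrtr.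
have lin N : N%:R * p ^+ N <= (1 - p)^-1.
  rewrite -[leRHS]mul1r ler_pdivlMr ?subr_gt0//.
  have pN0 : 0 <= p ^+ N by rewrite exprn_ge0.
  have : N%:R * p ^+ N <= \sum_(i < N) p ^+ i.
    rewrite mulr_natl -[X in _ *+ X](card_ord N) -sumr_const.
    by apply: ler_sum => i _; rewrite ler_wiXn2l ?(ltW p1)// ltnW.
  by have := subrX1 p N; set S := \sum_(i < N) _; set a := p ^+ N in pN0 *; nra.
pose B := 2 / (1 - p) + 1.
have B0 : 0 < B by rewrite addr_gt0// divr_gt0// subr_gt0.
have /cvgrPdist_le/(_ (e / B)) : (p ^+ n @[n --> \oo] --> 0).
  by apply: cvg_expr; rewrite ger0_norm.
rewrite divr_gt0// => /(_ isT)[N _ /(_ N (leqnn N))].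
rewrite /= sub0r normrN ger0_norm ?exprn_ge0// ler_pdivlMr// => small.
exists N; apply: le_trans small; rewrite mulrC qE exprMn -mulrA.
rewrite ler_wpM2l ?exprn_ge0// mulrC -natr1 natrD mulrDl mul1r /B.
have := lin N; have : p ^+ N <= 1 by rewrite exprn_ile1// ltW.
lra.
Qed.

End Kernel.

(** * Maximum principle for polynomials *)

Section MaximumPrinciple.
Variable R : realType.
Implicit Types (p : {poly R[i]}) (z : R[i]).

Lemma grid_orthogonal L i j : (i < L)%N -> (j < L)%N ->
  \sum_(k < L) grid R L k ^+ i * (grid R L k)^*%C ^+ j = (L * (i == j))%:R.
Proof.
move=> iL jL; have [->|] := eqVneq i j.
  rewrite (eq_bigr (fun=> 1)); last by move=> k _; rewrite -exprMn grid_conjM expr1n.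
  by rewrite sumr_const card_ord muln1.
rewrite neq_ltn muln0 => /orP[ij|ji].
- have S : \sum_(k < L) (grid R L k)^*%C ^+ (j - i) = 0 by apply: sum_gridX_conj; lia.
  rewrite -[RHS]S; apply: eq_bigr => k _.
  by rewrite -{1}(subnKC (ltnW ij)) exprD mulrA -exprMn grid_conjM expr1n mul1r.
- have S : \sum_(k < L) (grid R L k) ^+ (i - j) = 0 by apply: sum_gridX; lia.
  rewrite -[RHS]S; apply: eq_bigr => k _.
  by rewrite -{1}(subnK (ltnW ji)) exprD -mulrA -exprMn grid_conjM expr1n mulr1.
Qed.

(** Fourier inversion on the group of L-th roots of unity. *)
Lemma horner_interpolation p L z : (size p <= L)%N ->
  L%:R * p.[z] = \sum_(k < L) p.[grid R L k] *
    \sum_(j < L) (z * (grid R L k)^*%C) ^+ j.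
Proof.
move=> pL; under eq_bigr do rewrite (horner_coef_wide _ pL) mulr_suml.
rewrite exchange_big (horner_coef_wide _ pL) mulr_sumr; apply: eq_bigr => i _ /=.
transitivity (\sum_(k < L) \sum_(j < L)
  (p`_i * z ^+ j) * (grid R L k ^+ i * (grid R L k)^*%C ^+ j)); last first.
  apply: eq_bigr => k _; rewrite mulr_sumr; apply: eq_bigr => j _.
  by rewrite exprMn; move: (_^*%C ^+ _) => c; rewrite -!mulrA; congr (_ * _); rewrite mulrCA.
rewrite exchange_big /= (bigD1 i)//= -mulr_sumr grid_orthogonal// eqxx muln1.
rewrite big1 ?addr0; first by rewrite mulrC.
move=> j ji; rewrite -mulr_sumr grid_orthogonal// eq_sym (negbTE (_ : _ != _)) ?muln0 ?mulr0//.
Qed.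

Lemma horner_circle_bound p (M : R) z : (forall t, normc p.[expi t] <= M) ->
  normc z <= 1 -> normc p.[z] <= (size p)%:R * M.
Proof.
move=> pM z1; have M0 : 0 <= M by apply: le_trans (pM 0); exact: normc_ge0.
have [->|p0] := eqVneq p 0.
  by rewrite horner0 normc0 size_poly0 mul0r.
have L0 : 0 < (size p)%:R :> R by rewrite ltr0n size_poly_gt0.
rewrite -(ler_pM2l L0) -{1}(ger0_norm (ltW L0)) -normc_real -normcM rmorph_nat.
rewrite (horner_interpolation _ (leqnn _)) (le_trans (normc_sum _ _ _))//.
rewrite mulrCA mulrA -[leRHS]mulrA mulr_natl -[X in _ *+ X]card_ord -sumr_const.
apply: ler_sum => k _; rewrite normcM mulrC; apply: ler_pM; rewrite ?normc_ge0//.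
  rewrite (le_trans (normc_sum _ _ _))// -[X in X%:R]card_ord -sumr_const.
  apply: ler_sum => j _; rewrite normcX exprn_ile1 ?normc_ge0//.
  by rewrite normcM normc_conj normc_grid mulr1.
exact: pM.
Qed.

(** The bound on the disc loses a factor size p; applied to the powers of p
    this loss grows only linearly with the exponent, so it disappears after
    taking roots. *)
Lemma horner_maximum_principle p (M : R) z :
  (forall t, normc p.[expi t] <= M) -> normc z <= 1 -> normc p.[z] <= M.
Proof.
move=> pM z1; have M0 : 0 <= M by apply: le_trans (pM 0); exact: normc_ge0.
rewrite leNgt; apply/negP => Mx.
set x := normc _ in Mx; have x0 : 0 < x by exact: le_lt_trans Mx.
pose d := (size p).-1.
have pow m : x ^+ m <= (d * m).+1%:R * M ^+ m.
  rewrite /x -normcX -horner_exp.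
  apply: le_trans (horner_circle_bound (M := M ^+ m) _ z1) _.
    by move=> t; rewrite horner_exp normcX lerXn2r ?nnegrE ?normc_ge0.
  by rewrite ler_wpM2r ?exprn_ge0// ler_nat size_poly_exp_leq.
have q01 : 0 <= M / x < 1.
  by rewrite divr_ge0 ?(ltW x0)//= ltr_pdivrMr// mul1r.
have e0 : 0 < (d.+1%:R * 2)^-1 :> R by rewrite invr_gt0 mulr_gt0.
have [N] := polynomial_geometric_small q01 e0.
have xN : 0 < x ^+ N by rewrite exprn_gt0.
rewrite expr_div_n mulrA ler_pdivrMr// => small.
have : d.+1%:R * ((N + N).+1%:R * M ^+ N) <= x ^+ N / 2.
  rewrite mulrC -ler_pdivlMr//; apply: le_trans small _.
  by rewrite invfM le_eqVlt; apply/orP; left; apply/eqP; field.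
have : (d * N).+1%:R * M ^+ N <= d.+1%:R * ((N + N).+1%:R * M ^+ N).
  rewrite mulrA ler_wpM2r ?exprn_ge0// -natrM ler_nat; nia.
have := pow N; lra.
Qed.

End MaximumPrinciple.

(** * Polydiscs and complex derivatives *)

Section Topology.
Variables (R : realType) (n : nat).
Implicit Types (x y : 'rV[R[i]]_n) (z w : R[i]).

Definition polydisc x (r : R) : set 'rV[R[i]]_n :=
  [set y | forall i, normc (y 0 i - x 0 i) < r].

Definition closed_polydisc x (r : R) : set 'rV[R[i]]_n :=
  [set y | forall i, normc (y 0 i - x 0 i) <= r].

(** Conditions imposed coordinate by coordinate hold for a common radius,
    because there are finitely many coordinates. *)
Lemma uniform_radius (P : 'I_n -> R -> Prop) :
  (forall i, exists2 r : R, 0 < r & forall s, 0 < s <= r -> P i s) ->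
  exists2 r : R, 0 < r & forall i s, 0 < s <= r -> P i s.
Proof.
move=> /(_ _)/cid2-/all_sig[r /all_and2[r0 rP]].
exists (\big[Num.min/1]_i r i).
  by elim/big_ind : _ => [|u v u0 v0|//]; rewrite ?ltr01// lt_min u0.
move=> i s /andP[s0 sr]; apply: rP; rewrite s0 (le_trans sr)//.
by rewrite (bigD1 i)//= ge_min lexx.
Qed.

Lemma nbhs_complexP z (A : set R[i]) :
  nbhs z A <-> exists2 r : R, 0 < r & forall w, normc (w - z) < r -> A w.
Proof.
split.
  move=> /nbhs_ballP[e /= e0 eA].
  have [er ei] : 0 < complex.Re e /\ complex.Im e = 0.
    by move: e0; rewrite ltcE /= => /andP[/eqP-> ->].
  exists (complex.Re e) => // w wz; apply: eA; rewrite -ball_normE /=.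
  by rewrite distrC normrc ltcE /= ei eqxx.
move=> [r r0 rA]; apply/nbhs_ballP; exists (r%:C); first by rewrite /= ltcR.
by move=> w; rewrite -ball_normE /= distrC normrc ltcR; exact: rA.
Qed.

Lemma nbhs_polydiscP x (A : set 'rV[R[i]]_n) :
  nbhs x A <-> exists2 r : R, 0 < r & polydisc x r `<=` A.
Proof.
split.
  move=> /nbhs_ballP[e /= e0 eA].
  have [er ei] : 0 < complex.Re e /\ complex.Im e = 0.
    by move: e0; rewrite ltcE /= => /andP[/eqP-> ->].
  exists (complex.Re e) => // y yx; apply: eA; split => // i j.
  rewrite -ball_normE /= distrC normrc ltcE /= ei eqxx /=.
  by rewrite ord1; exact: yx.
move=> [r r0 rA]; apply/nbhs_ballP; exists (r%:C); first by rewrite /= ltcR.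
move=> y [_ xy]; apply: rA => i.
by have := xy 0 i; rewrite -ball_normE /= distrC normrc ltcR.
Qed.

Lemma polydisc_center x (r : R) : 0 < r -> polydisc x r x.
Proof. by move=> r0 i; rewrite subrr normc0. Qed.

Lemma open_polydiscP (A : set 'rV[R[i]]_n) :
  open A <-> forall x, A x -> exists2 r : R, 0 < r & polydisc x r `<=` A.
Proof.
rewrite openE; split => [oA x /oA /nbhs_polydiscP//|oA x Ax].
by apply/nbhs_polydiscP; exact: oA.
Qed.

Lemma open_complexP (A : set R[i]) :
  open A <-> forall z, A z ->
    exists2 r : R, 0 < r & forall w, normc (w - z) < r -> A w.
Proof.
rewrite openE; split => [oA x /oA /nbhs_complexP//|oA x Ax].
by apply/nbhs_complexP; exact: oA.
Qed.

Lemma open_polydisc x (r : R) : open (polydisc x r).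
Proof.
apply/open_polydiscP => y xy.
have [|d d0 dP] := @uniform_radius (fun i d => normc (y 0 i - x 0 i) + d <= r).
  move=> i; exists (r - normc (y 0 i - x 0 i)); first by rewrite subr_gt0.
  by move=> s /andP[_]; rewrite lerBrDl.
exists d => // w yw i; rewrite (le_lt_trans (normc_distD (y 0 i) _ _))//.
rewrite addrC; apply: lt_le_trans (dP i d _); first by rewrite ltrD2l.
by rewrite d0 lexx.
Qed.

Lemma closed_closed_polydisc x (r : R) : closed (closed_polydisc x r).
Proof.
rewrite -[X in closed X]setCK; apply: open_closedC; apply/open_polydiscP => y.
move=> /existsNP[i /negP]; rewrite -ltNge => ri.
exists (normc (y 0 i - x 0 i) - r); first by rewrite subr_gt0.
move=> w yw /(_ i); apply/negP; rewrite -ltNge.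
have := yw i; have := normc_distD (w 0 i) (y 0 i) (x 0 i).
rewrite normc_distC [normc (w 0 i - y 0 i)]normc_distC.
by rewrite [normc (x 0 i - y 0 i)]normc_distC; lra.
Qed.

Lemma compact_closed_disc (r : R) : compact [set z : R[i] | normc z <= r].
Proof.
pose f (p : R * R) : R[i] := p.1 +i* p.2.
have cf : continuous f.
  move=> p A /nbhs_complexP[e e0 eA].
  have e20 : 0 < e / 2 by rewrite divr_gt0.
  have : \forall q \near p, `|p.1 - q.1| < e / 2 /\ `|p.2 - q.2| < e / 2.
    exists (ball p.1 (e / 2), ball p.2 (e / 2)).
      by split; apply: nbhsx_ballx.
    by move=> q [/=]; rewrite -!ball_normE.
  apply: filterS => q [q1 q2]; apply: eA.
  apply: le_lt_trans (normc_le_ReIm _) _ => /=.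
  by rewrite distrC [`|q.2 - _|]distrC; lra.
apply: (@subclosed_compact _ _ (f @` (`[- r, r] `*` `[- r, r]))).
- rewrite -[X in closed X]setCK; apply: open_closedC; apply/open_complexP => z.
  move=> /negP; rewrite -ltNge => rz; exists (normc z - r).
    by rewrite subr_gt0.
  move=> w wz; apply/negP; rewrite -ltNge.
  have := normc_distD w z 0; rewrite !subr0 normc_distC; lra.
- apply: continuous_compact; last by apply: compact_setX; exact: segment_compact.
  exact: continuous_subspaceT.
- move=> [a b] zr; exists (a, b) => //; split; rewrite /= in_itv /= -ler_norml.
    by rewrite (le_trans (normRe_le (a +i* b))).
  by rewrite (le_trans (normIm_le (a +i* b))).
Qed.

Lemma compact_closed_polydisc0 (r : R) :
  compact [set y : 'rV[R[i]]_n | forall i, normc (y 0 i) <= r].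
Proof.
apply: (@rV_compact R[i] n (fun=> [set z : R[i] | normc z <= r])) => _.
exact: compact_closed_disc.
Qed.

End Topology.

Section ComplexDerivative.
Variable R : realType.
Implicit Types (z w d : R[i]) (g h : R[i] -> R[i]).

(** Complex differentiability as an estimate between real moduli. *)
Definition cderiv g z d := forall e : R, 0 < e -> exists2 r : R, 0 < r &
  forall w, normc (w - z) < r ->
    normc (g w - g z - d * (w - z)) <= e * normc (w - z).

Lemma cderiv_cst c z : cderiv (fun=> c) z 0.
Proof.
move=> e e0; exists 1 => // w _; rewrite subrr mul0r subr0 normc0.
by rewrite mulr_ge0 ?normc_ge0// ltW.
Qed.

Lemma cderiv_id z : cderiv id z 1.
Proof.
move=> e e0; exists 1 => // w _; rewrite mul1r subrr normc0.
by rewrite mulr_ge0 ?normc_ge0// ltW.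
Qed.

Lemma cderivD g h z d1 d2 : cderiv g z d1 -> cderiv h z d2 ->
  cderiv (fun w => g w + h w) z (d1 + d2).
Proof.
move=> gz hz e e0; have e20 : 0 < e / 2 by rewrite divr_gt0.
have [r r0 rP] := gz _ e20; have [s s0 sP] := hz _ e20.
exists (Num.min r s); first by rewrite lt_min r0.
move=> w; rewrite lt_min => /andP[/rP wr /sP ws].
have -> : g w + h w - (g z + h z) - (d1 + d2) * (w - z) =
  (g w - g z - d1 * (w - z)) + (h w - h z - d2 * (w - z)) by ring.
apply: le_trans (normcD _ _) _; lra.
Qed.

Lemma cderivZ c g z d : cderiv g z d -> cderiv (fun w => c * g w) z (c * d).
Proof.
move=> gz e e0; have c0 : 0 < normc c + 1 by rewrite ltr_wpDl ?normc_ge0.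
have [r r0 rP] := gz (e / (normc c + 1)) (divr_gt0 e0 c0).
exists r => // w /rP wr.
have -> : c * g w - c * g z - c * d * (w - z) = c * (g w - g z - d * (w - z)).
  by ring.
rewrite normcM; have := normc_ge0 c; have := normc_ge0 (g w - g z - d * (w - z)).
have : e / (normc c + 1) * (normc c + 1) = e by rewrite divfK// gt_eqF.
have := normc_ge0 (w - z); move: wr; set q := e / _.
move: (normc (w - z)) (normc (_ - _)) (normc c) => A B C; nra.
Qed.

Lemma cderiv_sum (I : Type) (s : seq I) (F : I -> R[i] -> R[i])
    (D : I -> R[i]) z : (forall i, cderiv (F i) z (D i)) ->
  cderiv (fun w => \sum_(i <- s) F i w) z (\sum_(i <- s) D i).
Proof.
move=> FD; elim: s => [|i s IH].
  rewrite big_nil; under boolp.eq_fun do rewrite big_nil.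
  exact: cderiv_cst.
rewrite big_cons; under boolp.eq_fun do rewrite big_cons.
exact: cderivD.
Qed.

Lemma cderiv_continuous g z d (e : R) : cderiv g z d -> 0 < e ->
  exists2 r : R, 0 < r & forall w, normc (w - z) < r -> normc (g w - g z) < e.
Proof.
move=> /(_ 1 ltr01)[r r0 rP] e0; have d0 : 0 < normc d + 1 + 1.
  by have := normc_ge0 d; lra.
exists (Num.min r (e / (normc d + 1 + 1))).
  by rewrite lt_min r0 divr_gt0.
move=> w; rewrite lt_min ltr_pdivlMr// => /andP[/rP wr we].
have := normcD (g w - g z - d * (w - z)) (d * (w - z)); rewrite subrK normcM.
have := normc_ge0 (w - z); nra.
Qed.

Lemma cderivM g h z d1 d2 : cderiv g z d1 -> cderiv h z d2 ->
  cderiv (fun w => g w * h w) z (d1 * h z + g z * d2).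
Proof.
move=> gz hz e e0; pose K := normc (g z) + normc (h z) + normc d2 + 3.
have K0 : 0 < K.
  by have := normc_ge0 (g z); have := normc_ge0 (h z); have := normc_ge0 d2;
     rewrite /K; lra.
have eK : 0 < e / K by rewrite divr_gt0.
have [r r0 rP] := gz _ eK; have [s s0 sP] := hz _ eK.
have [t t0 tP] := cderiv_continuous hz eK.
have [t' t'0 t'P] := cderiv_continuous gz (@ltr01 R).
have [t'' t''0 t''P] := cderiv_continuous gz eK.
exists (Num.min (Num.min r s) (Num.min t' t'')); first by rewrite !lt_min r0 s0 t'0.
move=> w; rewrite !lt_min => /andP[/andP[/rP wr /sP ws] /andP[/t'P wt' /t''P wt'']].
have -> : g w * h w - g z * h z - (d1 * h z + g z * d2) * (w - z) =
  (g w - g z - d1 * (w - z)) * h z + g w * (h w - h z - d2 * (w - z)) +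
  (g w - g z) * (d2 * (w - z)) by ring.
have gw : normc (g w) <= normc (g z) + 1.
  by have := normc_distD (g z) (g w) 0; rewrite !subr0; lra.
apply: le_trans (normcD _ _) _.
have := normcD ((g w - g z - d1 * (w - z)) * h z) (g w * (h w - h z - d2 * (w - z))).
rewrite !normcM => H.
have eE : e / K * K = e by rewrite divfK// gt_eqF.
move: H wr ws wt'' gw; rewrite /K in eE *.
move: (normc (w - z)) (normc_ge0 (w - z)) => A A0.
set q := e / _ in eE *; have q0 : 0 < q by [].
move: (normc (_ + _)) => S.
move: (normc (g w - g z - _)) (normc_ge0 (g w - g z - d1 * (w - z))) => B B0.
move: (normc (h w - h z - _)) (normc_ge0 (h w - h z - d2 * (w - z))) => C C0.
move: (normc (g w - g z)) (normc_ge0 (g w - g z)) => D D0.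
move: (normc (g w)) (normc_ge0 (g w)) => E E0.
have := normc_ge0 (g z); have := normc_ge0 (h z); have := normc_ge0 d2.
move: eE; move: (normc (g z)) (normc (h z)) (normc d2) => G H' D2 eE D20 H0 G0 HS hB hC hD hE.
have h1 : B * H' <= q * A * H' by rewrite ler_wpM2r.
have h2 : E * C <= (G + 1) * (q * A) by apply: ler_pM => //; rewrite mulr_ge0// ltW.
have h3 : D * (D2 * A) <= q * (D2 * A) by rewrite ler_wpM2r ?mulr_ge0// ltW.
rewrite -eE; nra.
Qed.

Lemma cderiv_horner (p : {poly R[i]}) z : exists d, cderiv (horner p) z d.
Proof.
elim/poly_ind : p => [|p c [d dP]].
  exists 0; rewrite (_ : horner 0 = fun=> 0); first exact: cderiv_cst.
  by apply/funext => w; rewrite horner0.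
have pX := cderivD (cderivM dP (@cderiv_id z)) (@cderiv_cst c z).
eexists; rewrite (_ : horner _ = fun w => p.[w] * id w + c); first exact: pX.
by apply/funext => w; rewrite !hornerE.
Qed.

End ComplexDerivative.

Section DerivableDiscs.
Variables (R : realType) (n : nat).

Lemma derivable_cderiv (f : R[i] -> 'rV[R[i]]_n) z : derivable f z 1 ->
  exists d : 'rV[R[i]]_n, forall i, cderiv (fun w => f w 0 i) z (d 0 i).
Proof.
move=> /cvg_ex[d fd]; exists d => i e e0.
have /fd : nbhs d (polydisc d e).
  by apply/nbhs_polydiscP; exists e.
move=> /nbhs_complexP[r r0 rP]; exists r => // w wz.
have [->|wNz] := eqVneq w z.
  by rewrite !subrr mulr0 subr0 normc0 mulr0.
have /rP : normc (w - z - 0) < r by rewrite subr0.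
move=> /(_ _)/= /(_ _)/(_ i).
rewrite subr_eq0 wNz => /(_ isT).
rewrite !mxE /shift /= [(w - z) *: _]mulr1 subrK => H.
have wz0 : w - z != 0 by rewrite subr_eq0.
have -> : f w 0 i - f z 0 i - d 0 i * (w - z) =
  ((w - z)^-1 * (f w 0 i - f z 0 i) - d 0 i) * (w - z).
  by rewrite mulrBl mulrAC mulVf// mul1r.
by rewrite normcM ler_wpM2r ?normc_ge0// ltW.
Qed.

Lemma cderiv_derivable (f : R[i] -> 'rV[R[i]]_n) z :
  (forall i, exists d, cderiv (fun w => f w 0 i) z d) -> derivable f z 1.
Proof.
move=> /(_ _)/cid-/all_sig[d dP]; apply/cvg_ex; exists (\row_i d i).
move=> A /nbhs_polydiscP[e e0 eA].
have e20 : 0 < e / 2 by rewrite divr_gt0.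
have [|r r0 rP] := @uniform_radius R n (fun i r => forall w,
  normc (w - z) < r ->
  normc (f w 0 i - f z 0 i - d i * (w - z)) <= e / 2 * normc (w - z)).
  move=> i; have [r r0 rP] := dP i _ e20; exists r => // s /andP[_ sr] w ws.
  by apply: rP; exact: lt_le_trans sr.
apply/nbhs_complexP; exists r => // h; rewrite subr0 => hr h0.
apply: eA => i; rewrite !mxE /shift /= [h *: _]mulr1.
have := rP i r _ (h + z); rewrite addrK lexx r0 => /(_ isT hr).
have -> : f (h + z) 0 i - f z 0 i - d i * h =
  (h^-1 * (f (h + z) 0 i - f z 0 i) - d i) * h.
  by rewrite mulrBl mulrAC mulVf// mul1r.
rewrite normcM ler_pM2r; first by lra.
by rewrite lt_neqAle normc_ge0 eq_sym normc_eq0 h0.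
Qed.

End DerivableDiscs.

(** * Goursat for closed forms on a rectangle *)

Section IntervalIntegral.
Variable R : realType.
Notation mu := (@lebesgue_measure R).
Implicit Types (g h : R -> R) (a b c k e : R).

Definition integrable_co g a b := mu.-integrable `[a, b[%classic (EFin \o g).

Definition integral_co g a b : R := \int[mu]_(x in `[a, b[) g x.

Lemma continuous_integrable_co g a b :
  {within `[a, b], continuous g} -> integrable_co g a b.
Proof.
move=> cg; apply: (@integrableS _ _ _ mu `[a, b]%classic) => //.
  by apply: subset_itvl; rewrite bnd_simp.
by apply: continuous_compact_integrable => //; exact: segment_compact.
Qed.

Lemma integrable_co_sub g a b c d : c <= a -> b <= d ->
  integrable_co g c d -> integrable_co g a b.
Proof.
move=> ca bd; apply: integrableS => //.
by apply: subset_itv; rewrite bnd_simp.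
Qed.

Lemma integrable_co_cst k a b : integrable_co (fun=> k) a b.
Proof.
by apply: continuous_integrable_co; apply: continuous_subspaceT => x; exact: cvg_cst.
Qed.

Lemma integral_co_cst k a b : a <= b -> integral_co (fun=> k) a b = k * (b - a).
Proof.
move=> ab; rewrite /integral_co Rintegral_cst//= lebesgue_measure_itv/= lte_fin.
by case: ltgtP ab => // -> _; rewrite subrr.
Qed.

Lemma integral_co_split g a b c : a <= b -> b <= c -> integrable_co g a c ->
  integral_co g a c = integral_co g a b + integral_co g b c.
Proof.
move=> ab bc ig; rewrite /integral_co -Rintegral_setU//.
- congr Rintegral; rewrite -itv_bndbnd_setU ?bnd_simp//.
- by rewrite -itv_bndbnd_setU ?bnd_simp.
- apply/disj_setPS => x [/=]; rewrite !in_itv/= => /andP[_ xb] /andP[bx _].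
  by move: xb; rewrite ltNge bx.
Qed.

Lemma integral_co_close g h a b k e : a <= b ->
  integrable_co g a b -> integrable_co h a b ->
  (forall x, a <= x <= b -> `|g x - h x - k| <= e) ->
  `|integral_co g a b - integral_co h a b - k * (b - a)| <= e * (b - a).
Proof.
move=> ab ig ih close.
have igh : mu.-integrable `[a, b[%classic (EFin \o (fun x => g x - h x)).
  rewrite [X in integrable _ _ X](_ : _ = ((EFin \o g) \- (EFin \o h))%E)//.
  exact: integrableB.
rewrite /integral_co -RintegralB//.
have bd x : a <= x < b -> k - e <= g x - h x <= k + e.
  move=> /andP[ax xb]; have := close x; rewrite ax ltW// => /(_ isT).
  by rewrite ler_norml => /andP[? ?]; apply/andP; split; lra.
have lo : integral_co (fun=> k - e) a b <= \int[mu]_(x in `[a, b[) (g x - h x).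
  apply: le_Rintegral => //; first exact: integrable_co_cst.
  by move=> x /=; rewrite in_itv/= => /bd/andP[].
have hi : \int[mu]_(x in `[a, b[) (g x - h x) <= integral_co (fun=> k + e) a b.
  apply: le_Rintegral => //; first exact: integrable_co_cst.
  by move=> x /=; rewrite in_itv/= => /bd/andP[].
rewrite !integral_co_cst// in lo hi.
by rewrite ler_norml; apply/andP; split; nra.
Qed.

End IntervalIntegral.

Lemma quarter_bound (R : realType) (N b1 b2 b3 b4 : R) :
  N <= b1 + b2 + (b3 + b4) ->
  N <= 4 * b1 \/ N <= 4 * b2 \/ N <= 4 * b3 \/ N <= 4 * b4.
Proof.
move=> le; have [?|l1] := leP N (4 * b1); first by left.
have [?|l2] := leP N (4 * b2); first by right; left.
have [?|l3] := leP N (4 * b3); first by right; right; left.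
by right; right; right; lra.
Qed.

(** The affine parts have the same cross coefficient c, that is, they form a
    closed form, and contribute nothing; there remains the error e times the
    length of the boundary. *)
Lemma boundary_integral_affine (R : realType) (A B : R -> R -> R)
    (s t w h p q a a' b b' c e : R) : 0 <= w -> 0 <= h ->
  integrable_co (A ^~ t) s (s + w) -> integrable_co (A ^~ (t + h)) s (s + w) ->
  integrable_co (B s) t (t + h) -> integrable_co (B (s + w)) t (t + h) ->
  (forall x y, s <= x <= s + w -> t <= y <= t + h ->
    `|A x y - (a + a' * (x - p) + c * (y - q))| <= e /\
    `|B x y - (b + c * (x - p) + b' * (y - q))| <= e) ->
  `|integral_co (A ^~ t) s (s + w) - integral_co (A ^~ (t + h)) s (s + w)
    + (integral_co (B (s + w)) t (t + h) - integral_co (B s) t (t + h))|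
  <= 2 * e * (w + h).
Proof.
move=> w0 h0 A1 A2 B1 B2 near.
have EA : `|integral_co (A ^~ t) s (s + w) - integral_co (A ^~ (t + h)) s (s + w)
     - (- c * h) * (s + w - s)| <= 2 * e * (s + w - s).
  apply: integral_co_close => //; first by rewrite lerDl.
  move=> x xs; have [||n1 _] := near x t; rewrite ?lexx ?lerDl//.
  have [||n2 _] := near x (t + h); rewrite ?lexx ?lerDl ?andbT//.
  move: n1 n2; clear; rewrite !ler_norml => /andP[? ?] /andP[? ?].
  by apply/andP; split; lra.
have EB : `|integral_co (B (s + w)) t (t + h) - integral_co (B s) t (t + h)
     - (c * w) * (t + h - t)| <= 2 * e * (t + h - t).
  apply: integral_co_close => //; first by rewrite lerDl.
  move=> y yt; have [||_ n1] := near s y; rewrite ?lexx ?lerDl//.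
  have [||_ n2] := near (s + w) y; rewrite ?lexx ?lerDl ?andbT//.
  move: n1 n2; clear; rewrite !ler_norml => /andP[? ?] /andP[? ?].
  by apply/andP; split; lra.
move: EA EB; clear; rewrite !ler_norml => /andP[? ?] /andP[? ?].
by apply/andP; split; nra.
Qed.

Lemma interval_dist (R : realType) (u v d x : R) :
  u <= x <= u + d -> u <= v <= u + d -> `|x - v| <= d.
Proof. by move=> xu vu; rewrite ler_norml; lra. Qed.

Lemma subinterval (R : realType) (u v d d0 x : R) :
  v <= u -> u + d <= v + d0 -> u <= x <= u + d -> v <= x <= v + d0.
Proof. by lra. Qed.

Section Goursat.
Variable R : realType.
Variables (A B : R -> R -> R) (s0 t0 w0 h0 : R).
Hypotheses (w0_gt0 : 0 < w0) (h0_gt0 : 0 < h0).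
Hypothesis intA : forall t, t0 <= t <= t0 + h0 ->
  integrable_co (A ^~ t) s0 (s0 + w0).
Hypothesis intB : forall s, s0 <= s <= s0 + w0 ->
  integrable_co (B s) t0 (t0 + h0).
Hypothesis closed_form : forall p q,
  s0 <= p <= s0 + w0 -> t0 <= q <= t0 + h0 ->
  exists a a' b b' c : R, forall e, 0 < e -> exists2 r : R, 0 < r &
    forall x y, s0 <= x <= s0 + w0 -> t0 <= y <= t0 + h0 ->
      `|x - p| < r -> `|y - q| < r ->
      `|A x y - (a + a' * (x - p) + c * (y - q))| <= e * (`|x - p| + `|y - q|) /\
      `|B x y - (b + c * (x - p) + b' * (y - q))| <= e * (`|x - p| + `|y - q|).

Let boundary s t w h :=
  integral_co (A ^~ t) s (s + w) - integral_co (A ^~ (t + h)) s (s + w)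
  + (integral_co (B (s + w)) t (t + h) - integral_co (B s) t (t + h)).

Let inside s t w h :=
  [/\ 0 <= w, 0 <= h, s0 <= s, s + w <= s0 + w0 & t0 <= t /\ t + h <= t0 + h0].

Let boundary_split s t w h : inside s t (w + w) (h + h) ->
  boundary s t (w + w) (h + h) =
    boundary s t w h + boundary (s + w) t w h +
    (boundary s (t + h) w h + boundary (s + w) (t + h) w h).
Proof.
move=> [w0' h0' s0s sw [t0t th]]; rewrite /boundary.
rewrite (@integral_co_split _ (A ^~ t) s (s + w) (s + (w + w))); [|lra|lra|]; last first.
  by apply: (integrable_co_sub s0s sw); apply: intA; lra.
rewrite (@integral_co_split _ (A ^~ (t + (h + h))) s (s + w) (s + (w + w))); [|lra|lra|]; last first.
  by apply: (integrable_co_sub s0s sw); apply: intA; lra.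
rewrite (@integral_co_split _ (B (s + (w + w))) t (t + h) (t + (h + h))); [|lra|lra|]; last first.
  by apply: (integrable_co_sub t0t th); apply: intB; lra.
rewrite (@integral_co_split _ (B s) t (t + h) (t + (h + h))); [|lra|lra|]; last first.
  by apply: (integrable_co_sub t0t th); apply: intB; lra.
rewrite !(addrA s) !(addrA t); ring.
Qed.

Let W n := w0 / 2 ^+ n.
Let H n := h0 / 2 ^+ n.

Let halfW n : W n = W n.+1 + W n.+1.
Proof. by rewrite /W exprS; field. Qed.
Let halfH n : H n = H n.+1 + H n.+1.
Proof. by rewrite /H exprS; field. Qed.
Let W_gt0 n : 0 < W n. Proof. by rewrite divr_gt0// exprn_gt0. Qed.
Let H_gt0 n : 0 < H n. Proof. by rewrite divr_gt0// exprn_gt0. Qed.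

Let size_ok n (c : R * R) := inside c.1 c.2 (W n) (H n).

Let next_corner n (c : R * R) : size_ok n c -> exists c' : R * R,
  [/\ c.1 <= c'.1, c'.1 + W n.+1 <= c.1 + W n,
      c.2 <= c'.2, c'.2 + H n.+1 <= c.2 + H n
    & `|boundary c.1 c.2 (W n) (H n)| <= 4 * `|boundary c'.1 c'.2 (W n.+1) (H n.+1)|].
Proof.
rewrite /size_ok; move: c => [s t] /= ok.
have := W_gt0 n.+1; have := H_gt0 n.+1.
rewrite halfW halfH in ok *; move: (W n.+1) (H n.+1) ok => w h ok h_gt0 w_gt0.
rewrite boundary_split//.
set b1 := boundary s t w h; set b2 := boundary (s + w) t w h.
set b3 := boundary s (t + h) w h; set b4 := boundary (s + w) (t + h) w h.
set N := `|_|; have NS : N <= `|b1| + `|b2| + (`|b3| + `|b4|).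
  by apply: (le_trans (ler_normD _ _)); apply: lerD; exact: ler_normD.
have wit i j : 0 <= i <= w -> 0 <= j <= h ->
    N <= 4 * `|boundary (s + i) (t + j) w h| -> exists c' : R * R,
    [/\ s <= c'.1, c'.1 + w <= s + (w + w), t <= c'.2, c'.2 + h <= t + (h + h)
      & N <= 4 * `|boundary c'.1 c'.2 w h|].
  move=> /andP[i0 iw] /andP[j0 jh] le; exists (s + i, t + j).
  by split; rewrite //= ?lerDl// -addrA lerD2l lerD2r.
have w_ge0 := ltW w_gt0; have h_ge0 := ltW h_gt0.
case: (quarter_bound NS) => [l|[l|[l|l]]].
- by apply: (wit 0 0); rewrite ?addr0 ?lexx ?w_ge0 ?h_ge0.
- by apply: (wit w 0); rewrite ?addr0 ?lexx ?w_ge0 ?h_ge0.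
- by apply: (wit 0 h); rewrite ?addr0 ?lexx ?w_ge0 ?h_ge0.
- by apply: (wit w h); rewrite ?lexx ?w_ge0 ?h_ge0.
Qed.

(** Goursat's bisection for the form A ds + B dt, which at every point agrees
    to first order with a closed affine form.  Each bisection keeps at least
    a quarter of the boundary integral in a rectangle of half the size; around the limit
    point the affine approximation bounds the boundary integral by any
    multiple of the square of the size, hence the integral vanishes. *)
Lemma goursat_rectangle :
  integral_co (A ^~ t0) s0 (s0 + w0) - integral_co (A ^~ (t0 + h0)) s0 (s0 + w0)
  + (integral_co (B (s0 + w0)) t0 (t0 + h0) - integral_co (B s0) t0 (t0 + h0)) = 0.
Proof.
have next_ex (nc : nat * (R * R)) : exists c' : R * R, size_ok nc.1 nc.2 ->
  [/\ nc.2.1 <= c'.1, c'.1 + W nc.1.+1 <= nc.2.1 + W nc.1,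
      nc.2.2 <= c'.2, c'.2 + H nc.1.+1 <= nc.2.2 + H nc.1
    & `|boundary nc.2.1 nc.2.2 (W nc.1) (H nc.1)| <=
      4 * `|boundary c'.1 c'.2 (W nc.1.+1) (H nc.1.+1)|].
  have [ok|nok] := pselect (size_ok nc.1 nc.2); last by exists nc.2.
  by have [c' c'P] := next_corner ok; exists c'.
pose next n c := sval (cid (next_ex (n, c))).
have nextP n c : size_ok n c ->
  [/\ c.1 <= (next n c).1, (next n c).1 + W n.+1 <= c.1 + W n,
      c.2 <= (next n c).2, (next n c).2 + H n.+1 <= c.2 + H n
    & `|boundary c.1 c.2 (W n) (H n)| <=
      4 * `|boundary (next n c).1 (next n c).2 (W n.+1) (H n.+1)|].
  exact: svalP (cid (next_ex (n, c))).
(* lower left corners of the nested rectangles *)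
pose corner := fix corner n := if n is m.+1 then next m (corner m) else (s0, t0).
have W0 : W 0 = w0 by rewrite /W expr0 divr1.
have H0 : H 0 = h0 by rewrite /H expr0 divr1.
have ok n : size_ok n (corner n).
  elim: n => [|n IH].
    by rewrite /size_ok /= W0 H0; split => //; rewrite ?ltW//; split.
  have [h1 h2 h3 h4 _] := nextP _ _ IH; case: IH => [_ _ i1 i2 [i3 i4]].
  by split => /=; [exact: ltW|exact: ltW|lra|lra|split; lra].
have mono n m : (corner n).1 <= (corner (n + m)%N).1 /\
    (corner (n + m)%N).1 + W (n + m)%N <= (corner n).1 + W n /\
    (corner n).2 <= (corner (n + m)%N).2 /\
    (corner (n + m)%N).2 + H (n + m)%N <= (corner n).2 + H n.
  elim: m => [|m [i1 [i2 [i3 i4]]]]; first by rewrite addn0.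
  by have [] := nextP _ _ (ok (n + m)%N); rewrite addnS /=; lra.
have cross n m : (corner n).1 <= (corner m).1 + W m /\ (corner n).2 <= (corner m).2 + H m.
  have [nm|mn] := leqP n m.
    have := mono n (m - n)%N; rewrite subnKC// => -[? [? [? ?]]].
    by have := W_gt0 m; have := H_gt0 m; lra.
  have := mono m (n - m)%N; rewrite subnKC ?(ltnW mn)// => -[? [? [? ?]]].
  by have := W_gt0 n; have := H_gt0 n; lra.
pose p := sup (range (fun n => (corner n).1)).
pose q := sup (range (fun n => (corner n).2)).
have pP n : (corner n).1 <= p <= (corner n).1 + W n.
  have ub m : ubound (range (fun n => (corner n).1)) ((corner m).1 + W m).
    by move=> _ [k _ <-]; have [] := cross k m.
  apply/andP; split; last by apply: ge_sup => //; exists (corner 0).1; exists 0%N.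
  by apply: ub_le_sup; [exists ((corner 0).1 + W 0); exact: ub | exists n].
have qP n : (corner n).2 <= q <= (corner n).2 + H n.
  have ub m : ubound (range (fun n => (corner n).2)) ((corner m).2 + H m).
    by move=> _ [k _ <-]; have [] := cross k m.
  apply/andP; split; last by apply: ge_sup => //; exists (corner 0).2; exists 0%N.
  by apply: ub_le_sup; [exists ((corner 0).2 + H 0); exact: ub | exists n].
rewrite -/(boundary s0 t0 w0 h0).
have grow n : `|boundary s0 t0 w0 h0| <=
    4 ^+ n * `|boundary (corner n).1 (corner n).2 (W n) (H n)|.
  elim: n => [|n IH]; first by rewrite expr0 mul1r W0 H0.
  have [_ _ _ _ le4] := nextP _ _ (ok n).
  rewrite (le_trans IH)// exprSr -mulrA ler_pM2l ?exprn_gt0//.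
have [a [a' [b [b' [c local]]]]] : exists a a' b b' c : R, forall e, 0 < e -> exists2 r : R, 0 < r &
    forall x y, s0 <= x <= s0 + w0 -> t0 <= y <= t0 + h0 ->
      `|x - p| < r -> `|y - q| < r ->
      `|A x y - (a + a' * (x - p) + c * (y - q))| <= e * (`|x - p| + `|y - q|) /\
      `|B x y - (b + c * (x - p) + b' * (y - q))| <= e * (`|x - p| + `|y - q|).
  apply: closed_form.
    by have := pP 0%N; rewrite W0.
  by have := qP 0%N; rewrite H0.
apply/eqP; rewrite -normr_eq0 eq_le normr_ge0 andbT; apply/ler_addgt0Pr => e e0.
rewrite add0r; pose e' := e / (2 * (w0 + h0) ^+ 2).
have wh0 : 0 < w0 + h0 by rewrite addr_gt0.
have e'0 : 0 < e' by rewrite divr_gt0// mulr_gt0// exprn_gt0.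
have [r r0 rP] := local _ e'0.
have [n [Wn Hn]] : exists n, W n < r /\ H n < r.
  have /cvgrPdist_lt/(_ (r / (w0 + h0))) : ((2^-1 : R) ^+ n @[n --> \oo] --> 0).
    by apply: cvg_expr; rewrite ger0_norm// invf_lt1// ltr1n.
  rewrite divr_gt0// => /(_ isT)[n _ /(_ n (leqnn n))].
  rewrite /= sub0r normrN ger0_norm ?exprn_ge0// ltr_pdivlMr// exprVn mulrDr => lt.
  exists n; rewrite /W /H ![_ / 2 ^+ n]mulrC.
  have : 0 < (2 ^+ n)^-1 * w0 by rewrite mulr_gt0// invr_gt0 exprn_gt0.
  have : 0 < (2 ^+ n)^-1 * h0 by rewrite mulr_gt0// invr_gt0 exprn_gt0.
  lra.
apply: le_trans (grow n) _.
have [_ _ i1 i2 [i3 i4]] := ok n.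
have := pP n; have := qP n; set s := (corner n).1 in i1 i2 *.
set t := (corner n).2 in i3 i4 *.
move=> tq sp.
have W0' := W_gt0 n; have H0' := H_gt0 n.
have sB : s0 <= s <= s0 + w0 by rewrite i1 (le_trans _ i2)// lerDl ltW.
have swB : s0 <= s + W n <= s0 + w0 by rewrite i2 (le_trans i1)// lerDl ltW.
have tB : t0 <= t <= t0 + h0 by rewrite i3 (le_trans _ i4)// lerDl ltW.
have thB : t0 <= t + H n <= t0 + h0 by rewrite i4 (le_trans i3)// lerDl ltW.
have : `|boundary s t (W n) (H n)| <= 2 * (e' * (W n + H n)) * (W n + H n).
  apply: (@boundary_integral_affine _ _ _ s t (W n) (H n) p q a a' b b' c);
    rewrite ?ltW//.
  - by apply: (integrable_co_sub i1 i2); exact: intA.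
  - by apply: (integrable_co_sub i1 i2); exact: intA.
  - by apply: (integrable_co_sub i3 i4); exact: intB.
  - by apply: (integrable_co_sub i3 i4); exact: intB.
  move=> x y xs yt.
  have xp := interval_dist xs sp; have yq := interval_dist yt tq.
  have [||||H1 H2] := rP x y.
  - exact: subinterval i1 i2 xs.
  - exact: subinterval i3 i4 yt.
  - exact: le_lt_trans Wn.
  - exact: le_lt_trans Hn.
  have le : e' * (`|x - p| + `|y - q|) <= e' * (W n + H n).
    by rewrite ler_pM2l// lerD.
  by split; [exact: le_trans H1 le|exact: le_trans H2 le].
rewrite mulrA -mulrA -expr2.
have -> : 2 * e' * (W n + H n) ^+ 2 = e / 4 ^+ n.
  rewrite /e' /W /H -mulrDl expr_div_n -exprM mulnC exprM (_ : 2 ^+ 2 = 4 :> R); last by ring.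
  by field; rewrite expf_neq0//= gt_eqF.
by rewrite ler_pdivlMr ?exprn_gt0// mulrC.
Qed.

End Goursat.

(** * Mean value property on circles *)

Section PolarCoordinates.
Variable R : realType.
Implicit Types (p q x y s t : R) (a : R[i]).

(** Real differentiability of a complex-valued function of two real variables. *)
Definition fderiv (G : R -> R -> R[i]) p q (g1 g2 : R[i]) :=
  forall e : R, 0 < e -> exists2 r : R, 0 < r & forall x y,
    `|x - p| < r -> `|y - q| < r ->
    normc (G x y - G p q - (g1 * (x - p)%:C + g2 * (y - q)%:C))
      <= e * (`|x - p| + `|y - q|).

Lemma expi_expansion t : normc (expi t - 1 - 'i%C * t%:C) <= 2 * t ^+ 2.
Proof.
apply: le_trans (normc_le_ReIm _) _.
have -> : complex.Re (expi t - 1 - 'i%C * t%:C) = cos t - 1.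
  by rewrite /=; ring.
have -> : complex.Im (expi t - 1 - 'i%C * t%:C) = sin t - t.
  by rewrite /=; ring.
have c1 : `|cos t - 1| <= t ^+ 2.
  have := expi_lipschitz t 0; rewrite subr0 => le.
  have : normc (expi t - expi 0) ^+ 2 <= t ^+ 2.
    rewrite -[leRHS]real_normK ?num_real//.
    by rewrite lerXn2r// nnegrE normc_ge0.
  rewrite normc_expiB2 subr0 => le2; have := cos_le1 t => ?.
  rewrite ler0_norm; nra.
suff : `|sin t - t| <= t ^+ 2 by lra.
have pos (u : R) : 0 < u -> `|sin u - u| <= u ^+ 2.
  move=> u0; pose g (v : R) := sin v - v.
  have dg (v : R) : v \in `]0, u[ -> is_derive v 1 g (cos v - 1).
    by move=> _; apply: is_deriveB.
  have cg : {within `[0, u], continuous g}.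
    apply: continuous_subspaceT => v; apply: cvgB; last exact: cvg_id.
    exact: continuous_sin.
  have [c] := MVT u0 dg cg; rewrite in_itv/= => /andP[c0 cu].
  rewrite /g sin0 !subr0 => ->; rewrite normrM (gtr0_norm u0) expr2.
  rewrite ler_pM2r//; apply: le_trans (ltW cu).
  have [+ _] := continuous_cos_sin_lipschitz c 0.
  by rewrite cos0 subr0 (gtr0_norm c0).
have [t0|t0|->] := ltgtP t 0; last by rewrite sin0 subrr normr0 sqr_ge0.
- have := pos (- t); rewrite oppr_gt0 => /(_ t0).
  by rewrite sinN -opprD normrN sqrrN.
- exact: pos.
Qed.

Lemma polar_fderiv a p q :
  fderiv (fun x y => a + x%:C * expi y) p q (expi q) ('i%C * p%:C * expi q).
Proof.
move=> e e0; pose K := 2 * `|p| + 1.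
have K0 : 0 < K by rewrite ltr_wpDl// mulr_ge0.
exists (e / K); first by rewrite divr_gt0.
move=> x y; rewrite !ltr_pdivlMr// => xp yq.
have -> : a + x%:C * expi y - (a + p%:C * expi q) -
    (expi q * (x - p)%:C + 'i%C * p%:C * expi q * (y - q)%:C) =
    (x - p)%:C * (expi y - expi q) +
    p%:C * expi q * (expi (y - q) - 1 - 'i%C * (y - q)%:C).
  have -> : expi y = expi q * expi (y - q) by rewrite -expiD subrKC.
  rewrite !rmorphB /=.
  by move: (expi q) (expi (y - q)) (x%:C) (p%:C) (y%:C) (q%:C) => A B C D E F; ring.
apply: le_trans (normcD _ _) _; rewrite !normcM !normc_real normc_expi mulr1.
have h1 := expi_lipschitz y q.
have h2 := expi_expansion (y - q).
rewrite -real_normK ?num_real// in h2.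
have Y0 := normr_ge0 (y - q); have X0 := normr_ge0 (x - p); have P0 := normr_ge0 p.
rewrite /K in xp yq *.
move: h1 h2 Y0 X0 P0 xp yq; move: (normc _) (normc _) `|x - p| `|y - q| `|p|.
move=> N2 N1 X Y P h1 h2 Y0 X0 P0 xp yq.
have : X * N1 <= X * Y by rewrite ler_wpM2l.
have : P * N2 <= P * (2 * Y ^+ 2) by rewrite ler_wpM2l.
have : Y * (Y * (2 * P + 1)) <= Y * e by rewrite ler_wpM2l// ltW.
have : X * (Y * (2 * P + 1)) <= X * e by rewrite ler_wpM2l// ltW.
have : 0 <= P * (X * Y) by rewrite !mulr_ge0.
have : 0 <= Y * Y by rewrite mulr_ge0.
by clear; rewrite expr2; lra.
Qed.

Lemma fderiv_comp (H : R[i] -> R[i]) (G : R -> R -> R[i]) p q g1 g2 d :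
  cderiv H (G p q) d -> fderiv G p q g1 g2 ->
  fderiv (fun x y => H (G x y)) p q (d * g1) (d * g2).
Proof.
move=> Hd Gd e e0.
pose K := normc g1 + normc g2 + 1.
have K0 : 0 < K by rewrite ltr_wpDl// addr_ge0// normc_ge0.
have d0 : 0 < normc d + 1 by rewrite ltr_wpDl// normc_ge0.
have e1 : 0 < e / (2 * K) by rewrite divr_gt0// mulr_gt0.
have e2 : 0 < e / (2 * (normc d + 1)) by rewrite divr_gt0// mulr_gt0.
have [r r0 rP] := Hd _ e1.
have [s s0 sP] := Gd _ e2.
have [t t0 tP] := Gd _ (@ltr01 R).
exists (Num.min (Num.min s t) (r / (2 * K))).
  by rewrite !lt_min s0 t0 divr_gt0// mulr_gt0.
move=> x y; rewrite !lt_min => /andP[/andP[xs xt] xr] /andP[/andP[ys yt] yr].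
have h1 := sP x y xs ys; have h2 := tP x y xt yt.
have GB : normc (G x y - G p q) <= K * (`|x - p| + `|y - q|).
  have := normcD (G x y - G p q - (g1 * (x - p)%:C + g2 * (y - q)%:C))
    (g1 * (x - p)%:C + g2 * (y - q)%:C).
  rewrite subrK => /le_trans; apply.
  have := normcD (g1 * (x - p)%:C) (g2 * (y - q)%:C).
  rewrite !normcM !normc_real; move: h2; rewrite /K.
  have Y0 := normr_ge0 (y - q); have X0 := normr_ge0 (x - p).
  have G10 := normc_ge0 g1; have G20 := normc_ge0 g2.
  by rewrite mul1r; nra.
have GBr : normc (G x y - G p q) < r.
  apply: le_lt_trans GB _; move: xr yr; rewrite !ltr_pdivlMr ?mulr_gt0//.
  by move: `|x - p| `|y - q| => X Y; lra.
have h3 := rP _ GBr.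
have -> : H (G x y) - H (G p q) - (d * g1 * (x - p)%:C + d * g2 * (y - q)%:C) =
  (H (G x y) - H (G p q) - d * (G x y - G p q)) +
  d * (G x y - G p q - (g1 * (x - p)%:C + g2 * (y - q)%:C)).
  by move: ((x - p)%:C) ((y - q)%:C) => u v; ring.
apply: le_trans (normcD _ _) _; rewrite normcM.
set S := `|x - p| + `|y - q|.
have S0 : 0 <= S by rewrite addr_ge0.
have b1 : normc (H (G x y) - H (G p q) - d * (G x y - G p q)) <= e / 2 * S.
  apply: le_trans h3 _; apply: le_trans (ler_wpM2l (ltW e1) GB) _.
  by rewrite le_eqVlt; apply/orP; left; apply/eqP; rewrite /S; field; rewrite gt_eqF.
have b2 : normc d * normc (G x y - G p q - (g1 * (x - p)%:C + g2 * (y - q)%:C)) <= e / 2 * S.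
  apply: le_trans (ler_wpM2l (normc_ge0 _) h1) _.
  have -> : e / 2 * S = (normc d + 1) * (e / (2 * (normc d + 1)) * S).
    by field; rewrite gt_eqF.
  by rewrite ler_wpM2r ?lerDl// mulr_ge0// ltW.
by lra.
Qed.

Lemma fderiv_Re (G : R -> R -> R[i]) p q g1 g2 : fderiv G p q g1 g2 ->
  forall e : R, 0 < e -> exists2 r : R, 0 < r & forall x y,
    `|x - p| < r -> `|y - q| < r ->
    `|complex.Re (G x y) - (complex.Re (G p q) + complex.Re g1 * (x - p)
        + complex.Re g2 * (y - q))| <= e * (`|x - p| + `|y - q|).
Proof.
move=> Gd e /Gd[r r0 rP]; exists r => // x y xr yr.
apply: le_trans (rP x y xr yr); apply: le_trans (normRe_le _).
rewrite le_eqVlt; apply/orP; left; apply/eqP; congr `|_|.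
rewrite !ReB ReD !(mulrC _ (_%:C)) !ReM_real; ring.
Qed.

Lemma fderiv_Im (G : R -> R -> R[i]) p q g1 g2 : fderiv G p q g1 g2 ->
  forall e : R, 0 < e -> exists2 r : R, 0 < r & forall x y,
    `|x - p| < r -> `|y - q| < r ->
    `|complex.Im (G x y) - (complex.Im (G p q) + complex.Im g1 * (x - p)
        + complex.Im g2 * (y - q))| <= e * (`|x - p| + `|y - q|).
Proof.
move=> Gd e /Gd[r r0 rP]; exists r => // x y xr yr.
apply: le_trans (rP x y xr yr); apply: le_trans (normIm_le _).
rewrite le_eqVlt; apply/orP; left; apply/eqP; congr `|_|.
have ImM (k : R) (z : R[i]) : complex.Im (z * k%:C) = complex.Im z * k.
  by case: z => u v /=; ring.
rewrite !(ImD, ImN) !ImM; ring.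
Qed.

(** Used for Im H / x: first-order expansions survive division by the radius x
    as long as x stays away from 0. *)
Lemma div_expansion (A : R -> R -> R) p q (a1 a2 s0 : R) : 0 < s0 -> s0 <= p ->
  (forall e : R, 0 < e -> exists2 r : R, 0 < r & forall x y,
    `|x - p| < r -> `|y - q| < r ->
    `|A x y - (A p q + a1 * (x - p) + a2 * (y - q))| <= e * (`|x - p| + `|y - q|)) ->
  exists a' : R, forall e : R, 0 < e -> exists2 r : R, 0 < r & forall x y, s0 <= x ->
    `|x - p| < r -> `|y - q| < r ->
    `|A x y / x - (A p q / p + a' * (x - p) + a2 / p * (y - q))|
      <= e * (`|x - p| + `|y - q|).
Proof.
move=> s0_gt0 sp Ad; have p0 : 0 < p by exact: lt_le_trans sp.
pose a' := (a1 - A p q / p) / p; exists a' => e e0.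
pose c := a2 / p; pose K := `|a'| + `|c| + 1.
have K0 : 0 < K by rewrite ltr_wpDl// addr_ge0.
have e1 : 0 < e * s0 / 2 by rewrite divr_gt0// mulr_gt0.
have [r r0 rP] := Ad _ e1.
exists (Num.min r (e * s0 / (2 * K))).
  by rewrite lt_min r0 divr_gt0 ?mulr_gt0.
move=> x y s0x; rewrite !lt_min => /andP[xr xK] /andP[yr yK].
have h := rP x y xr yr; have x0 : 0 < x by exact: lt_le_trans s0x.
have -> : A x y / x - (A p q / p + a' * (x - p) + c * (y - q)) =
  ((A x y - (A p q + a1 * (x - p) + a2 * (y - q)))
   - (x - p) * (a' * (x - p) + c * (y - q))) / x.
  by rewrite /a' /c; field; rewrite !gt_eqF.
rewrite normrM normfV (gtr0_norm x0) ler_pdivrMr//.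
apply: le_trans (ler_normB _ _) _.
set S := `|x - p| + `|y - q| in h *; have S0 : 0 <= S by rewrite addr_ge0.
have lin : `|a' * (x - p) + c * (y - q)| <= K * S.
  apply: le_trans (ler_normD _ _) _; rewrite (normrM a') (normrM c) /K /S.
  have := normr_ge0 (x - p); have := normr_ge0 (y - q).
  have := normr_ge0 a'; have := normr_ge0 c.
  by move: `|x - p| `|y - q| `|a'| `|c| => *; nra.
have quad : `|(x - p) * (a' * (x - p) + c * (y - q))| <= e * s0 / 2 * S.
  rewrite normrM; apply: le_trans (ler_wpM2l (normr_ge0 _) lin) _.
  rewrite mulrA ler_wpM2r//; move: xK; rewrite ltr_pdivlMr ?mulr_gt0//.
  by move: (`|x - p|) => X; lra.
have : e * s0 * S <= e * S * x.
  by rewrite -!mulrA ler_pM2l// mulrC ler_wpM2l.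
lra.
Qed.

End PolarCoordinates.

Section MeanValue.
Variable R : realType.
Implicit Types (a : R[i]) (rho : R).

(** The set P restricts x to the radii where the expansion holds. *)
Lemma expansion_continuous1 (A : R -> R -> R) (p q a0 a1 a2 : R) (P : R -> Prop) :
  P p -> (forall e : R, 0 < e -> exists2 r : R, 0 < r & forall x y, P x ->
    `|x - p| < r -> `|y - q| < r ->
    `|A x y - (a0 + a1 * (x - p) + a2 * (y - q))| <= e * (`|x - p| + `|y - q|)) ->
  forall e : R, 0 < e -> exists2 r : R, 0 < r & forall x y, P x ->
    `|x - p| < r -> `|y - q| < r -> `|A x y - A p q| < e.
Proof.
move=> Pp Ad e e0; have [r r0 rP] := Ad _ (@ltr01 R).
have K0 : 0 < `|a1| + `|a2| + 2 by rewrite ltr_wpDl// addr_ge0.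
exists (Num.min r (e / (2 * (`|a1| + `|a2| + 2)))).
  by rewrite lt_min r0 divr_gt0// mulr_gt0.
move=> x y Px; rewrite !lt_min !ltr_pdivlMr ?mulr_gt0// => /andP[xr xe] /andP[yr ye].
have h := rP x y Px xr yr.
have := rP p q Pp; rewrite !subrr normr0 r0 => /(_ isT isT).
rewrite !mulr0 !addr0 mulr0 normr_le0 subr_eq0 => /eqP A0.
have -> : A x y - A p q = (A x y - (a0 + a1 * (x - p) + a2 * (y - q))) +
  (a1 * (x - p) + a2 * (y - q)) by rewrite A0; ring.
apply: le_lt_trans (ler_normD _ _) _.
have := ler_normD (a1 * (x - p)) (a2 * (y - q)); rewrite !normrM.
move: h xe ye; move: (normr_ge0 (x - p)) (normr_ge0 (y - q)) (normr_ge0 a1) (normr_ge0 a2).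
move: (`|A _ _ - _|) (`|_ + _|) `|x - p| `|y - q| `|a1| `|a2|; clear.
move=> U V X Y a b X0 Y0 a0 b0; nra.
Qed.

Variables (H : R[i] -> R[i]) (a : R[i]) (rho : R).
Hypothesis rho0 : 0 < rho.
Hypothesis Hd : forall z, normc (z - a) <= rho -> exists d, cderiv H z d.

Let in_disc (x y : R) : 0 <= x <= rho ->
  normc (a + x%:C * expi y - a) <= rho.
Proof.
by move=> /andP[x0 xr]; rewrite addrC addKr normcM normc_expi normc_real mulr1 ger0_norm.
Qed.

Let B x y := complex.Re (H (a + x%:C * expi y)).
Let A x y := complex.Im (H (a + x%:C * expi y)) / x.

(** In polar coordinates the form (Im H / x) dx + Re H dy is closed, by the
    Cauchy-Riemann equation H_y = i x H_x.  Its integrals along the two sides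
    with angles 0 and 2 pi coincide, so Goursat's theorem compares the two
    circles. *)
Let circle_independent s : 0 < s < rho ->
  integral_co (B s) 0 (2 * pi) = integral_co (B rho) 0 (2 * pi).
Proof.
move=> /andP[s0 sr].
have pi20 : 0 < 2 * pi :> R by rewrite mulr_gt0// pi_gt0.
have exp_at p q : s <= p <= rho -> exists a0 a' b0 b' c : R,
  forall e, 0 < e -> exists2 r : R, 0 < r & forall x y, s <= x <= rho ->
      `|x - p| < r -> `|y - q| < r ->
      `|A x y - (a0 + a' * (x - p) + c * (y - q))| <= e * (`|x - p| + `|y - q|) /\
      `|B x y - (b0 + c * (x - p) + b' * (y - q))| <= e * (`|x - p| + `|y - q|).
  move=> /andP[sp pr]; have p0 : 0 < p by exact: lt_le_trans sp.
  have [d dP] : exists d, cderiv H (a + p%:C * expi q) d.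
    by apply: Hd; apply: in_disc; rewrite ltW.
  have fd := fderiv_comp (G := fun x y => a + x%:C * expi y) dP (@polar_fderiv R a p q).
  have [a' a'P] := div_expansion s0 sp (fderiv_Im fd).
  have := fderiv_Re fd.
  have cE : complex.Re (d * expi q) = complex.Im (d * ('i%C * p%:C * expi q)) / p.
    by case: d {dP fd a' a'P} => u v /=; field; rewrite gt_eqF.
  exists (complex.Im (H (a + p%:C * expi q)) / p), a',
    (complex.Re (H (a + p%:C * expi q))),
    (complex.Re (d * ('i%C * p%:C * expi q))), (complex.Re (d * expi q)).
  move=> e e0; have [r1 r10 r1P] := a'P _ e0; have [r2 r20 r2P] := H0 _ e0.
  exists (Num.min r1 r2); first by rewrite lt_min r10.
  move=> x y /andP[sx _]; rewrite !lt_min => /andP[x1 x2] /andP[y1 y2].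
  split; last exact: r2P.
  by rewrite cE; exact: r1P.
have contA q : {within `[s, rho], continuous (A ^~ q)}.
  apply/subspace_continuousP => p; rewrite /= in_itv /= => sp.
  have [a0 [a' [b0 [b' [c AB]]]]] := exp_at p q sp.
  apply/cvgrPdist_lt => e e0.
  have [|r r0 rP] := @expansion_continuous1 A p q a0 a' c (fun x => s <= x <= rho) sp _ e e0.
    by move=> e1 /AB[r r0 rP]; exists r => // x y sx xr yr; have [] := rP x y sx xr yr.
  exists r => // x /= px; rewrite in_itv /= => sx; rewrite distrC.
  by apply: rP => //; [rewrite distrC|rewrite subrr normr0].
have contB p : s <= p <= rho -> {within `[0, 2 * pi], continuous (B p)}.
  move=> sp; apply/subspace_continuousP => q _.
  have [a0 [a' [b0 [b' [c AB]]]]] := exp_at p q sp.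
  apply/cvgrPdist_lt => e e0.
  have [|r r0 rP] := @expansion_continuous1 B p q b0 c b' (fun x => s <= x <= rho) sp _ e e0.
    by move=> e1 /AB[r r0 rP]; exists r => // x y sx xr yr; have [] := rP x y sx xr yr.
  exists r => // y /= qy _; rewrite distrC.
  by apply: rP => //; [rewrite subrr normr0|rewrite distrC].
have w0 : 0 < rho - s by rewrite subr_gt0.
have := @goursat_rectangle R A B s 0 (rho - s) (2 * pi) w0 pi20.
rewrite subrKC add0r => gours.
have per : A ^~ (2 * pi) = A ^~ 0.
  apply/funext => x; rewrite /A; have := expi_periodic (0 : R) 1.
  by rewrite mul1r add0r => ->.
have := gours _ _ _; rewrite per subrr add0r => /(_ _ _ _)/eqP; rewrite subr_eq0.
move=> E; symmetry; apply/eqP; apply: E.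
- by move=> t _; apply: continuous_integrable_co; exact: contA.
- by move=> x sx; apply: continuous_integrable_co; exact: contB.
- move=> p q sp _; have [a0 [a' [b0 [b' [c AB]]]]] := exp_at p q sp.
  exists a0, a', b0, b', c => e /AB[r r0 rP]; exists r => // x y sx _.
  exact: rP.
Qed.

Lemma circle_Re_integrable s : 0 < s <= rho -> integrable_co (B s) 0 (2 * pi).
Proof.
move=> /andP[s0 srho].
apply: continuous_integrable_co; apply: continuous_subspaceT => q.
have [d dP] : exists d, cderiv H (a + s%:C * expi q) d.
  by apply: Hd; apply: in_disc; rewrite srho ltW.
apply/cvgrPdist_lt => e e0.
have [r r0 rP] := cderiv_continuous dP e0.
exists (r / s); first by rewrite /= divr_gt0.
move=> t /= qt; apply: le_lt_trans (rP (a + s%:C * expi t) _).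
  by rewrite distrC -ReB normRe_le.
have -> : a + s%:C * expi t - (a + s%:C * expi q) = s%:C * (expi t - expi q).
  by ring.
rewrite normcM normc_real gtr0_norm// mulrC -ltr_pdivlMr//.
by apply: le_lt_trans (expi_lipschitz _ _) _; rewrite distrC.
Qed.

(** The integral is the same on small circles, where Re H is nearly
    constant. *)
Lemma mean_value_Re :
  integral_co (fun t => complex.Re (H (a + rho%:C * expi t))) 0 (2 * pi)
  = 2 * pi * complex.Re (H a).
Proof.
have pi20 : 0 < 2 * pi :> R by rewrite mulr_gt0// pi_gt0.
apply/eqP; rewrite -subr_eq0 -normr_eq0 eq_le normr_ge0 andbT.
apply/ler_addgt0Pr => e e0; rewrite add0r.
have [d dP] : exists d, cderiv H a d by apply: Hd; rewrite subrr normc0 ltW.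
have e1 : 0 < e / (2 * pi) by rewrite divr_gt0.
have [r r0 rP] := cderiv_continuous dP e1.
pose s := Num.min r rho / 2.
have s0 : 0 < s by rewrite divr_gt0// lt_min r0.
have sr : s < r.
  have : Num.min r rho <= r by rewrite ge_min lexx.
  by rewrite /s; lra.
have srho : s < rho.
  have : Num.min r rho <= rho by rewrite ge_min lexx orbT.
  by have := rho0; rewrite /s; lra.
rewrite -/(integral_co (B rho) 0 (2 * pi)) -(@circle_independent s) ?s0//.
have := @integral_co_close R (B s) (fun=> 0) 0 (2 * pi) (complex.Re (H a)) (e / (2 * pi)).
rewrite (integral_co_cst 0 (ltW pi20)) mul0r !subr0 [_ * (2 * pi)]mulrC divfK ?gt_eqF//.
apply; [exact: ltW| |exact: integrable_co_cst|].
- by apply: circle_Re_integrable; rewrite s0 ltW.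
move=> t _; rewrite subr0 /B -ReB; apply: le_trans (normRe_le _) _; apply: ltW.
by apply: rP; rewrite addrC addKr normcM normc_expi normc_real mulr1 gtr0_norm.
Qed.

End MeanValue.

(** * Semicontinuous functions *)

Section Semicontinuity.
Variable R : realType.

Lemma ereal_between (a b : \bar R) : (a < b)%E ->
  exists c : R, (a < c%:E)%E /\ (c%:E < b)%E.
Proof.
case: a b => [a| |] [b| |]//=; rewrite ?lte_fin.
- by move=> ab; exists ((a + b) / 2); rewrite !lte_fin; split; lra.
- by move=> _; exists (a + 1); rewrite lte_fin ltry; split => //; lra.
- by move=> _; exists (b - 1); rewrite lte_fin ltNyr; split => //; lra.
- by move=> _; exists 0; rewrite ltry ltNyr.
Qed.

(** If the supremum were not attained, each point would have a neighbourhood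
    on which F stays below a constant less than the supremum, and finitely many
    such neighbourhoods cover K. *)
Lemma compact_usc_max (T : topologicalType) (K : set T) (F : T -> \bar R) :
  compact K -> K !=set0 ->
  (forall x, K x -> (F x < +oo)%E /\ forall c : R, (F x < c%:E)%E ->
     \forall y \near x, K y -> (F y < c%:E)%E) ->
  exists2 x, K x & forall y, K y -> (F y <= F x)%E.
Proof.
move=> cK [x0 Kx0] uscF; set s := ereal_sup (F @` K).
have Fs x : K x -> (F x <= s)%E by move=> Kx; apply: ereal_sup_ubound; exists x.
apply: contrapT => nmax.
have lt_s x : K x -> (F x < s)%E.
  move=> Kx; rewrite lt_neqAle Fs// andbT; apply/eqP => Fxs.
  by apply: nmax; exists x => // y Ky; rewrite Fxs Fs.
pose G := filter_from [set c : R | (c%:E < s)%E]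
  (fun c => [set i : R | c <= i /\ (i%:E < s)%E]).
have FG : Filter G.
  apply: filter_from_filter.
    by have [c [_ cs]] := ereal_between (lt_s _ Kx0); exists c.
  move=> i j /= si sj; exists (Num.max i j).
    by rewrite /= /Num.max; case: ifP.
  by move=> k [/=]; rewrite ge_max => /andP[ik jk] ks.
have /near_covering_withinP ncK := iffLR (compact_near_coveringP K) cK.
have [x Kx|c /= cs KP] := ncK R G (fun i x => (F x < i%:E)%E) FG.
  have [c [Fc cs]] := ereal_between (lt_s x Kx).
  have [_ /(_ c Fc) nF] := uscF x Kx.
  exists ([set y | K y -> (F y < c%:E)%E], [set i | c <= i /\ (i%:E < s)%E]).
    by split => //; exists c.
  move=> [y i] [/= yF [ci _]] Ky; apply: lt_le_trans (yF Ky) _.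
  by rewrite lee_fin.
have : (s <= c%:E)%E.
  apply: ge_ereal_sup => _ [y Ky <-]; apply: ltW; apply: (KP c) => //.
by rewrite leNgt cs.
Qed.

(** The integral is a difference of suprema over the simple functions below
    the positive and the negative part, hence monotone on arbitrary functions.
    The function u on a circle is compared with its bounds in this way. *)
Lemma le_integral_any d (T : measurableType d) (mu : {measure set T -> \bar R})
    (D : set T) (f g : T -> \bar R) :
  (forall x, D x -> (f x <= g x)%E) ->
  (\int[mu]_(x in D) f x <= \int[mu]_(x in D) g x)%E.
Proof.
move=> fg.
have fgD x : ((f \_ D) x <= (g \_ D) x)%E.
  by rewrite /patch; case: ifPn => // /set_mem /fg.
have pos x : ((f \_ D)^\+ x <= (g \_ D)^\+ x)%E.
  by apply: (@funepos_le _ _ setT) => //; rewrite inE.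
have neg x : ((g \_ D)^\- x <= (f \_ D)^\- x)%E.
  by apply: (@funeneg_le _ _ setT) => //; rewrite inE.
by rewrite /integral; apply: leeB; apply: ereal_sup_le => _ [h /= hf <-];
  exists h => //= x; apply: le_trans (hf x) _.
Qed.

End Semicontinuity.

Section JointContinuity.
Variables (R : realType) (n : nat).
Implicit Types (phi psi : R[i] -> 'rV[R[i]]_n -> R).

Definition cont_at phi z y := forall e : R, 0 < e -> exists2 r : R, 0 < r &
  forall z' y', normc (z' - z) < r -> polydisc y r y' ->
    `|phi z' y' - phi z y| < e.

Lemma cont_at_cst (c : R) z y : cont_at (fun _ _ => c) z y.
Proof. by move=> e e0; exists 1 => // z' y' _ _; rewrite subrr normr0. Qed.

Lemma cont_atD phi psi z y : cont_at phi z y -> cont_at psi z y ->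
  cont_at (fun z y => phi z y + psi z y) z y.
Proof.
move=> cphi cpsi e e0; have e2 : 0 < e / 2 by rewrite divr_gt0.
have [r r0 rP] := cphi _ e2; have [s s0 sP] := cpsi _ e2.
exists (Num.min r s); first by rewrite lt_min r0.
move=> z' y'; rewrite lt_min => /andP[zr zs] yrs.
have yr : polydisc y r y'.
  by move=> i; apply: lt_le_trans (yrs i) _; rewrite ge_min lexx.
have ys : polydisc y s y'.
  by move=> i; apply: lt_le_trans (yrs i) _; rewrite ge_min lexx orbT.
rewrite opprD addrACA; apply: le_lt_trans (ler_normD _ _) _.
have := rP _ _ zr yr; have := sP _ _ zs ys; lra.
Qed.

Lemma cont_atM phi psi z y : cont_at phi z y -> cont_at psi z y ->
  cont_at (fun z y => phi z y * psi z y) z y.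
Proof.
move=> cphi cpsi e e0; pose K := `|phi z y| + `|psi z y| + 1.
have K0 : 0 < K by rewrite ltr_wpDl// addr_ge0.
have e2 : 0 < Num.min 1 (e / (2 * K)) by rewrite lt_min ltr01 divr_gt0 ?mulr_gt0.
have [r r0 rP] := cphi _ e2; have [s s0 sP] := cpsi _ e2.
exists (Num.min r s); first by rewrite lt_min r0.
move=> z' y'; rewrite lt_min => /andP[zr zs] yrs.
have yr : polydisc y r y'.
  by move=> i; apply: lt_le_trans (yrs i) _; rewrite ge_min lexx.
have ys : polydisc y s y'.
  by move=> i; apply: lt_le_trans (yrs i) _; rewrite ge_min lexx orbT.
have := rP _ _ zr yr; rewrite lt_min ltr_pdivlMr ?mulr_gt0// => /andP[_ h1].
have := sP _ _ zs ys; rewrite lt_min ltr_pdivlMr ?mulr_gt0// => /andP[h2 h3].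
have -> : phi z' y' * psi z' y' - phi z y * psi z y =
  (phi z' y' - phi z y) * psi z y + phi z y * (psi z' y' - psi z y)
  + (phi z' y' - phi z y) * (psi z' y' - psi z y) by ring.
move: h1 h2 h3; set a := phi z' y' - _; set b := psi z' y' - _ => h1 h2 h3.
apply: le_lt_trans (ler_normD _ _) _.
have := ler_normD (a * psi z y) (phi z y * b); rewrite !normrM /K in h1 h3 *.
have : `|a| * `|b| <= `|a| by rewrite ler_piMr// ltW.
have := normr_ge0 a; have := normr_ge0 b.
have := normr_ge0 (phi z y); have := normr_ge0 (psi z y).
move: (`|_ + _|) `|a| `|b| h1 h2 h3 => S A B; nra.
Qed.

Lemma cont_at_sum (I : Type) (s : seq I) (F : I -> R[i] -> 'rV[R[i]]_n -> R) z y :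
  (forall i, cont_at (F i) z y) ->
  cont_at (fun z y => \sum_(i <- s) F i z y) z y.
Proof.
move=> cF; elim: s => [|i s IH].
  by under eq_fun do under eq_fun do rewrite big_nil; exact: cont_at_cst.
by under eq_fun do under eq_fun do rewrite big_cons; exact: cont_atD.
Qed.

Lemma normc_dist_le (a b : R[i]) : `|normc a - normc b| <= normc (a - b).
Proof.
have := normc_distD b a 0; have := normc_distD a b 0.
rewrite !subr0 [normc (b - a)]normc_distC ler_norml => ? ?.
by apply/andP; split; lra.
Qed.

Lemma cont_at_normz z y : cont_at (fun z _ => normc z) z y.
Proof.
move=> e e0; exists e => // z' y' zz _.
exact: le_lt_trans (normc_dist_le _ _) _.
Qed.

Lemma cont_at_normy i z y : cont_at (fun _ y => normc (y 0 i)) z y.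
Proof.
move=> e e0; exists e => // z' y' _ yy.
by apply: le_lt_trans (normc_dist_le _ _) _; exact: yy.
Qed.

Lemma cont_at_Re (H : R[i] -> R[i]) d z y : cderiv H z d ->
  cont_at (fun z _ => complex.Re (H z)) z y.
Proof.
move=> Hd e e0; have [r r0 rP] := cderiv_continuous Hd e0.
exists r => // z' y' /rP lt _; apply: le_lt_trans lt.
by rewrite -ReB normRe_le.
Qed.

End JointContinuity.

(** * Harmonic majorants along analytic discs *)

Section DiscMajorant.
Variables (R : realType) (n : nat).
Variables (W : set 'rV[R[i]]_n) (u : 'rV[R[i]]_n -> \bar R).
Hypothesis psh : plurisubharmonic W u.

(** The mean value inequality for u against the mean value property of
    Re H. *)
Lemma psh_line_majorant (x b : 'rV[R[i]]_n) (rho : R) (H : R[i] -> R[i]) :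
  0 < rho -> (forall l : R[i], normc l <= rho -> W (x + l *: b)) ->
  (forall l : R[i], normc l <= rho -> exists d, cderiv H l d) ->
  (forall l : R[i], normc l = rho -> (u (x + l *: b) <= (complex.Re (H l))%:E)%E) ->
  (u x <= (complex.Re (H 0))%:E)%E.
Proof.
move=> rho0 inW Hd major.
have pi20 : 0 < 2 * pi :> R by rewrite mulr_gt0// pi_gt0.
have [_ /(_ x b)[_ /(_ 0 rho rho0)]] := psh.
have sub : closed_disc 0 rho `<=` [set l : R[i] | W (x + l *: b)].
  by move=> l /closed_discE; rewrite subr0; exact: inW.
move=> /(_ sub); rewrite scale0r addr0 => /le_trans; apply.
have Hd' : forall z, normc (z - 0) <= rho -> exists d, cderiv H z d.
  by move=> z; rewrite subr0; exact: Hd.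
have intH := circle_Re_integrable Hd' (s := rho); rewrite rho0 lexx in intH.
have := mean_value_Re rho0 Hd'.
rewrite /circle_mean /integral_co => mvp.
have le : (\int[lebesgue_measure]_(t in `[0%R, (2 * pi)%R[)
      u (x + (0 + rho%:C * expi t)%R *: b)%R <=
    \int[lebesgue_measure]_(t in `[0%R, (2 * pi)%R[)
      (complex.Re (H (0 + rho%:C * expi t)%R))%:E)%E.
  apply: le_integral_any => t _; rewrite add0r; apply: major.
  by rewrite normcM normc_real normc_expi mulr1 gtr0_norm.
have inv0 : (0 <= ((2 * pi)^-1)%:E :> \bar R)%E.
  by rewrite lee_fin invr_ge0 ltW.
apply: le_trans (lee_wpmul2l inv0 le) _.
rewrite -[X in (_ * X)%E]fineK; last exact: integrable_fin_num (intH isT).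
rewrite -EFinM lee_fin -[fine _]/(Rintegral _ _ _) mvp mulrA mulVf ?mul1r//.
by rewrite gt_eqF.
Qed.

Hypothesis openW : open W.
Variable f : R[i] -> 'rV[R[i]]_n.
Hypothesis fd : forall z, normc z <= 1 ->
  exists d : 'rV[R[i]]_n, forall i, cderiv (fun w => f w 0 i) z (d 0 i).
Hypothesis fW : forall z, normc z <= 1 -> W (f z).

Lemma disc_continuous z (e : R) : normc z <= 1 -> 0 < e ->
  exists2 r : R, 0 < r & forall w, normc (w - z) < r -> polydisc (f z) e (f w).
Proof.
move=> z1 e0; have [d dP] := fd z1.
have [|r r0 rP] := @uniform_radius R n (fun i r => forall w,
    normc (w - z) < r -> normc (f w 0 i - f z 0 i) < e).
  move=> i; have [r r0 rP] := cderiv_continuous (dP i) e0.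
  exists r => // s /andP[_ sr] w ws.
  by apply: rP; exact: lt_le_trans sr.
by exists r => // w wr i; apply: (rP i r) => //; rewrite r0 lexx.
Qed.

(** The translation y is the auxiliary variable of the maximum principle
    below. *)
Lemma usc_near_disc z y (c : R) : normc z <= 1 -> W (f z + y) ->
  (u (f z + y)%R < c%:E)%E ->
  exists2 r : R, 0 < r & forall z' y', normc (z' - z) < r -> polydisc y r y' ->
    W (f z' + y') /\ (u (f z' + y')%R < c%:E)%E.
Proof.
move=> z1 Wfy uc; have [/(_ _ Wfy)[_ /(_ c uc)] nu _] := psh.
have /nbhs_polydiscP[e e0 eP] :
    nbhs (f z + y) [set v | W v /\ (u v < c%:E)%E].
  have nW : nbhs (f z + y) W by apply: open_nbhs_nbhs.
  by apply: filterS2 nW nu => v Wv uv; split => //; exact: uv.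
have e2 : 0 < e / 2 by rewrite divr_gt0.
have [r r0 rP] := disc_continuous z1 e2.
exists (Num.min r (e / 2)); first by rewrite lt_min r0.
move=> z' y'; rewrite lt_min => /andP[zr _] yy; apply: eP => i.
have := rP _ zr i; have := yy i; rewrite lt_min => /andP[_ ye] fe.
have -> : (f z' + y') 0 i - (f z + y) 0 i =
  (f z' 0 i - f z 0 i) + (y' 0 i - y 0 i) by rewrite !mxE; ring.
apply: le_lt_trans (normcD _ _) _; lra.
Qed.

Lemma compact_tube (K : set R[i]) (Q : R[i] -> 'rV[R[i]]_n -> Prop) :
  compact K ->
  (forall z, K z -> exists2 r : R, 0 < r & forall z' y',
     normc (z' - z) < r -> polydisc 0 r y' -> Q z' y') ->
  exists2 r : R, 0 < r & forall z (y : 'rV[R[i]]_n), K z ->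
     (forall i, normc (y 0 i) <= r) -> Q z y.
Proof.
move=> cK loc; have ncK := iffLR (compact_near_coveringP K) cK.
have near : \forall r \near (0 : R)^'+, K `<=` (fun z => forall y : 'rV[R[i]]_n,
    (forall i, normc (y 0 i) <= r) -> Q z y).
  apply: (ncK R _ (fun r z => forall y : 'rV[R[i]]_n, (forall i, normc (y 0 i) <= r) -> Q z y)).
  move=> z Kz; have [r r0 rP] := loc z Kz.
  exists ([set w | normc (w - z) < r], [set s | s < r]).
    split; first by apply/nbhs_complexP; exists r.
    exact: nbhs_right_lt.
  move=> [w s] /= [wr sr] y ys; apply: rP => // i.
  by rewrite mxE subr0 (le_lt_trans (ys i)).
have [r [r0 rP]] := filter_ex (filterI (nbhs_right_gt (0 : R)) near).
by exists r => // z y Kz; exact: rP.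
Qed.

Lemma disc_usc_max (delta : R) (phi : R[i] -> 'rV[R[i]]_n -> R) : 0 < delta ->
  (forall z (y : 'rV[R[i]]_n), normc z <= 1 ->
    (forall i, normc (y 0 i) <= delta) -> W (f z + y)) ->
  (forall z y, normc z <= 1 -> cont_at phi z y) ->
  exists z0 (y0 : 'rV[R[i]]_n), [/\ normc z0 <= 1, forall i, normc (y0 0 i) <= delta &
    forall z (y : 'rV[R[i]]_n), normc z <= 1 ->
     (forall i, normc (y 0 i) <= delta) ->
     (u (f z + y)%R + (phi z y)%:E <= u (f z0 + y0)%R + (phi z0 y0)%:E)%E].
Proof.
move=> delta0 inW cphi.
pose K := [set z : R[i] | normc z <= 1] `*`
          [set y : 'rV[R[i]]_n | forall i, normc (y 0 i) <= delta].
have cK : compact K.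
  by apply: compact_setX; [exact: compact_closed_disc|exact: compact_closed_polydisc0].
have [||[z0 y0] [/= z01 y0d] mx] := @compact_usc_max R _ K
    (fun p => u (f p.1 + p.2)%R + (phi p.1 p.2)%:E)%E cK.
- exists (0, 0); split; first by change (normc (0 : R[i]) <= 1); rewrite normc0.
  by move=> i; rewrite mxE normc0 ltW.
- move=> [z y] [/= z1 yd].
  have [/(_ _ (inW _ _ z1 yd))[uoo _] _] := psh.
  split; first by case: (u _) uoo => [r| |]//= _; rewrite -?EFinD ltry.
  move=> c uphi.
  have [c' [uc' c'c]] : exists c', (u (f z + y)%R < c'%:E)%E /\ (c'%:E < (c - phi z y)%:E)%E.
    by apply: ereal_between; rewrite EFinB lteBrDr.
  have [r r0 rP] := usc_near_disc z1 (inW _ _ z1 yd) uc'.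
  rewrite lte_fin in c'c.
  have e0 : 0 < c - phi z y - c' by rewrite subr_gt0.
  have [s s0 sP] := cphi z y z1 _ e0.
  exists ([set w | normc (w - z) < Num.min r s], polydisc y (Num.min r s)).
    split; first by apply/nbhs_complexP; exists (Num.min r s); rewrite ?lt_min ?r0.
    by apply/nbhs_polydiscP; exists (Num.min r s); rewrite ?lt_min ?r0.
  move=> [z' y'] [/=]; rewrite lt_min => /andP[zr zs] yy _.
  have yr : polydisc y r y'.
    by move=> i; apply: lt_le_trans (yy i) _; rewrite ge_min lexx.
  have ys : polydisc y s y'.
    by move=> i; apply: lt_le_trans (yy i) _; rewrite ge_min lexx orbT.
  have [_ uz] := rP _ _ zr yr; have := sP _ _ zs ys.
  rewrite ltr_norml => /andP[_ ph].
  apply: (@lt_trans _ _ (c' + phi z' y')%:E); first by rewrite EFinD lteD2rE.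
  by rewrite lte_fin; lra.
- exists z0, y0; split => // z y z1 yd.
  by apply: (mx (z, y)); split.
Qed.

Lemma normc2D (a b : R[i]) :
  normc (a + b) ^+ 2 = normc a ^+ 2 + 2 * complex.Re (a^*%C * b) + normc b ^+ 2.
Proof.
by rewrite !normc2; case: a b => a1 a2 [b1 b2] /=; ring.
Qed.

Lemma cderiv_shift (g : R[i] -> R[i]) (z0 l d : R[i]) :
  cderiv g (z0 + l) d -> cderiv (fun l => g (z0 + l)) l d.
Proof.
move=> gd e /gd[r r0 rP]; exists r => // w wl.
have E : w - l = z0 + w - (z0 + l) by ring.
by rewrite E; apply: rP; rewrite -E.
Qed.

Lemma compact_unit_circle : compact [set z : R[i] | normc z = 1].
Proof.
apply: (@subclosed_compact _ _ [set z : R[i] | normc z <= 1]).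
- rewrite -[X in closed X]setCK; apply: open_closedC; apply/open_complexP => z.
  move=> /= /eqP z1; exists `|normc z - 1|; first by rewrite normr_gt0 subr_eq0.
  move=> w wz w1; have := normc_dist_le w z; rewrite w1 distrC; lra.
- exact: compact_closed_disc.
- by move=> z /= ->.
Qed.

(** Suppose that u (f 0) > Re (P 0).  On the compact set |z| <= 1,
    |y_i| <= delta, let Psi (z, y) be
    u (f z + y) - Re (P z) + eta (|z|^2 - 1) - C sum_i |y_i|^2.
    For small eta and large C, Psi is smaller on the boundary than at (0, 0),
    so its maximum is attained at an interior point (z0, y0).  The complex line
    through f z0 + y0 tangent to f is f (z0 + l) + y(l), where y(l) is
    holomorphic in l and y(l) - y0 = o(l).  Maximality of Psi bounds u on the
    circle |l| = rho of that line by the real part of a holomorphic function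
    whose value at l = 0 is less than u (f z0 + y0), because the gain
    eta rho^2 coming from |z|^2 exceeds the cost o(rho^2) of y(l).  This
    contradicts the mean value inequality on the line. *)
Lemma psh_disc_majorant (P : R[i] -> R[i]) :
  (forall z, normc z <= 1 -> exists d, cderiv P z d) ->
  (forall z, normc z = 1 -> (u (f z) < (complex.Re (P z))%:E)%E) ->
  (u (f 0%R) <= (complex.Re (P 0%R))%:E)%E.
Proof.
move=> Pd major; rewrite leNgt; apply/negP => lt0.
have z01 : normc (0 : R[i]) <= 1 by rewrite normc0.
have uoo z (y : 'rV[R[i]]_n) : W (f z + y) -> (u (f z + y)%R < +oo)%E.
  by move=> Wy; have [/(_ _ Wy)[]] := psh.
have [u0 u0E] : exists u0 : R, u (f 0) = u0%:E.
  have := uoo 0 0; rewrite addr0 => /(_ (fW z01)).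
  by case: (u (f 0)) lt0 => [r| |]// _ _; exists r.
rewrite u0E lte_fin in lt0.
(* half of the supposed excess, so that Psi (0, 0) >= eta > 0 *)
pose eta := (u0 - complex.Re (P 0)) / 2.
have eta0 : 0 < eta by rewrite divr_gt0// subr_gt0.
have [d1 d10 inW] : exists2 r : R, 0 < r & forall z (y : 'rV[R[i]]_n), normc z <= 1 ->
     (forall i, normc (y 0 i) <= r) -> W (f z + y).
  apply: (compact_tube (K := [set z | normc z <= 1])); first exact: compact_closed_disc.
  move=> z z1; have Wz : W (f z + 0) by rewrite addr0; exact: fW.
  have [c [uc _]] := ereal_between (uoo _ _ Wz).
  have [r r0 rP] := usc_near_disc z1 Wz uc.
  by exists r => // z' y' zz yy; have [] := rP z' y' zz yy.
have [d2 d20 below] : exists2 r : R, 0 < r & forall z (y : 'rV[R[i]]_n), normc z = 1 ->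
     (forall i, normc (y 0 i) <= r) -> (u (f z + y)%R < (complex.Re (P z))%:E)%E.
  apply: (compact_tube (K := [set z | normc z = 1])); first exact: compact_unit_circle.
  move=> z /= zE; have z1 : normc z <= 1 by rewrite zE.
  have Wz : W (f z + 0) by rewrite addr0; exact: fW.
  have [c [uc cP]] := ereal_between (major z zE).
  rewrite -[f z]addr0 in uc; rewrite lte_fin in cP.
  have [r r0 rP] := usc_near_disc z1 Wz uc.
  have [d dP] := Pd z z1.
  have cP0 : 0 < complex.Re (P z) - c by rewrite subr_gt0.
  have [s s0 sP] := cderiv_continuous dP cP0.
  exists (Num.min r s); first by rewrite lt_min r0.
  move=> z' y'; rewrite lt_min => /andP[zr zs] yy.
  have yr : polydisc 0 r y'.
    by move=> i; apply: lt_le_trans (yy i) _; rewrite ge_min lexx.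
  have [_ uc'] := rP _ _ zr yr; apply: (lt_trans uc'); rewrite lte_fin.
  have := le_lt_trans (normRe_le _) (sP _ zs); rewrite ReB ltr_norml; lra.
pose delta := Num.min d1 d2.
have delta0 : 0 < delta by rewrite lt_min d10.
have inW' z (y : 'rV[R[i]]_n) : normc z <= 1 -> (forall i, normc (y 0 i) <= delta) ->
    W (f z + y).
  move=> z1 yd; apply: inW => // i; apply: le_trans (yd i) _.
  by rewrite ge_min lexx.
have below' z (y : 'rV[R[i]]_n) : normc z = 1 -> (forall i, normc (y 0 i) <= delta) ->
    (u (f z + y)%R < (complex.Re (P z))%:E)%E.
  move=> z1 yd; apply: below => // i; apply: le_trans (yd i) _.
  by rewrite ge_min lexx orbT.
have cP z y : normc z <= 1 ->
    cont_at (fun z (_ : 'rV[R[i]]_n) => -1 * complex.Re (P z)) z y.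
  move=> z1; have [d dP] := Pd z z1.
  apply: cont_atM; [exact: cont_at_cst|exact: cont_at_Re dP].
have [B BP] : exists B : R, forall z (y : 'rV[R[i]]_n), normc z <= 1 ->
    (forall i, normc (y 0 i) <= delta) ->
    (u (f z + y)%R + (-1 * complex.Re (P z))%:E <= B%:E)%E.
  have [z1 [y1 [z11 y1d mx]]] := disc_usc_max delta0 inW' cP.
  exists (fine (u (f z1 + y1) + (-1 * complex.Re (P z1))%:E)%E) => z y zz yd.
  apply: le_trans (mx z y zz yd) _.
  have := uoo _ _ (inW' _ _ z11 y1d).
  by case: (u _) => [r| |]//= _; rewrite ?leNye.
(* makes Psi negative as soon as some |y_i| equals delta *)
pose C := (`|B| + 1) / delta ^+ 2.
have C0 : 0 < C by rewrite divr_gt0 ?ltr_wpDl// exprn_gt0.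
have BC : B < C * delta ^+ 2.
  by rewrite divfK ?gt_eqF ?exprn_gt0//; have := ler_norm B; lra.
pose phi z (y : 'rV[R[i]]_n) := -1 * complex.Re (P z) +
  (eta * (normc z * normc z) + - eta) +
  (- C) * \sum_i normc (y 0 i) * normc (y 0 i).
have cphi z y : normc z <= 1 -> cont_at phi z y.
  move=> z1; apply: cont_atD; first apply: cont_atD; first exact: cP.
    apply: cont_atD; last exact: cont_at_cst.
    apply: cont_atM; first exact: cont_at_cst.
    by apply: cont_atM; exact: cont_at_normz.
  apply: cont_atM; first exact: cont_at_cst.
  by apply: cont_at_sum => i; apply: cont_atM; exact: cont_at_normy.
have [z0 [y0 [z0le y0le mx]]] := disc_usc_max delta0 inW' cphi.
have mx0 := mx 0 0 z01; rewrite addr0 u0E in mx0.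
have phi00 : phi 0 0 = - complex.Re (P 0) - eta.
  rewrite /phi normc0 big1; last by move=> i _; rewrite mxE normc0 mul0r.
  by ring.
have [v vE] : exists v : R, u (f z0 + y0) = v%:E.
  have := uoo _ _ (inW' _ _ z0le y0le).
  have : ((u0 + phi 0 0)%:E <= u (f z0 + y0)%R + (phi z0 y0)%:E)%E.
    by apply: mx0 => i; rewrite mxE normc0 ltW.
  by case: (u (f z0 + y0)) => [r| |]// _ _; exists r.
rewrite vE in mx mx0.
have vpos : eta <= v + phi z0 y0.
  have : ((u0 + phi 0 0)%:E <= (v + phi z0 y0)%:E)%E.
    by apply: mx0 => i; rewrite mxE normc0 ltW.
  by rewrite lee_fin phi00 /eta; lra.
have S0 (y : 'rV[R[i]]_n) : 0 <= \sum_i normc (y 0 i) * normc (y 0 i).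
  by apply: sumr_ge0 => i _; rewrite mulr_ge0 ?normc_ge0.
have z0lt : normc z0 < 1.
  rewrite lt_neqAle z0le andbT; apply/eqP => z0E.
  have := below' z0 y0 z0E y0le; rewrite vE lte_fin.
  move: vpos; rewrite /phi z0E.
  have := mulr_ge0 (ltW C0) (S0 y0); lra.
have y0lt i : normc (y0 0 i) < delta.
  rewrite lt_neqAle y0le andbT; apply/eqP => y0E.
  have : delta ^+ 2 <= \sum_i normc (y0 0 i) * normc (y0 0 i).
    rewrite (bigD1 i)//= y0E -expr2 lerDl.
    by apply: sumr_ge0 => j _; rewrite mulr_ge0 ?normc_ge0.
  rewrite -(ler_pM2l C0) => h.
  have := BP z0 y0 z0le y0le; rewrite vE -EFinD lee_fin => h2.
  have : eta * (normc z0 * normc z0) <= eta.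
    by rewrite ler_piMr ?(ltW eta0)// -expr2 exprn_ile1// normc_ge0.
  move: vpos; rewrite /phi; lra.
have [d dP] := fd z0le.
(* relative size allowed for y(l) - y0, such that C n e^2 < eta *)
pose e := Num.min 1 (eta / (C * n.+1%:R)).
have Cn : 0 < C * n.+1%:R by rewrite mulr_gt0.
have e0 : 0 < e by rewrite lt_min ltr01 divr_gt0.
have eC : C * n%:R * e ^+ 2 < eta.
  have e1 : e <= 1 by rewrite ge_min lexx.
  have e2 : e * (C * n.+1%:R) <= eta.
    by rewrite -ler_pdivlMr// ge_min lexx orbT.
  have : C * n%:R * e ^+ 2 <= C * n%:R * e.
    have ee : e ^+ 2 <= e by rewrite expr2 ler_piMr// (ltW e0).
    by apply: ler_wpM2l ee; rewrite mulr_ge0// (ltW C0).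
  have : 0 < C * e by rewrite mulr_gt0.
  rewrite -natr1 in e2; lra.
have [|r r0 rP] := @uniform_radius R n (fun i r => forall w,
    normc (w - z0) < r ->
    normc (f w 0 i - f z0 0 i - d 0 i * (w - z0)) <= e * normc (w - z0)).
  move=> i; have [r r0 rP] := dP i _ e0; exists r => // s /andP[_ sr] w ws.
  by apply: rP; exact: lt_le_trans sr.
have [|s s0 sP] := @uniform_radius R n (fun i s => normc (y0 0 i) + s <= delta).
  move=> i; exists (delta - normc (y0 0 i)); first by rewrite subr_gt0.
  by move=> s /andP[_ sd]; rewrite -lerBrDl.
pose rho := Num.min (r / 2) (Num.min (1 - normc z0) s).
have rho0 : 0 < rho by rewrite !lt_min divr_gt0// subr_gt0 z0lt.
have rhor : rho < r.
  by apply: (@le_lt_trans _ _ (r / 2)); [rewrite ge_min lexx|lra].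
have rhoz : rho <= 1 - normc z0 by rewrite !ge_min lexx orbT.
have rhos : rho <= s by rewrite !ge_min lexx !orbT.
pose rem l i := f z0 0 i + l * d 0 i - f (z0 + l) 0 i.
have remP l i : normc l <= rho -> normc (rem l i) <= e * normc l.
  move=> lr; have := rP i r _ (z0 + l); rewrite addrC addKr lexx r0.
  move=> /(_ isT (le_lt_trans lr rhor)); rewrite -normc_opp; congr (normc _ <= _).
  by rewrite /rem; ring.
pose yl l : 'rV[R[i]]_n := \row_i (y0 0 i + rem l i).
have lineE l : f z0 + y0 + l *: d = f (z0 + l) + yl l.
  by apply/rowP => i; rewrite !mxE /rem; ring.
have zl1 l : normc l <= rho -> normc (z0 + l) <= 1.
  by move=> lr; apply: le_trans (normcD _ _) _; lra.
have yld l : normc l <= rho -> forall i, normc (yl l 0 i) <= delta.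
  move=> lr i; rewrite mxE; apply: le_trans (normcD _ _) _.
  have e1 : e <= 1 by rewrite ge_min lexx.
  have := remP l i lr; have := sP i s; rewrite s0 lexx => /(_ isT).
  have := normc_ge0 l.
  have : e * normc l <= normc l by rewrite ler_piMl// normc_ge0.
  lra.
(* On |l| = rho, expanding the squares |z0 + l|^2 and |y(l)|^2 leaves
   constants, collected in k, and real parts of holomorphic functions. *)
pose k := v + phi z0 y0 - eta * (normc z0 ^+ 2 + rho ^+ 2 - 1)
  + C * \sum_i (normc (y0 0 i) ^+ 2 + (e * rho) ^+ 2).
pose H l := k%:C + (P (z0 + l) + ((-2 * eta)%:C * z0^*%C * l +
  \sum_i (2 * C)%:C * (y0 0 i)^*%C * rem l i)).
have ReH l : complex.Re (H l) = k + (complex.Re (P (z0 + l))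
    + (-2 * eta * complex.Re (z0^*%C * l) +
    \sum_i 2 * C * complex.Re ((y0 0 i)^*%C * rem l i))).
  rewrite /H !ReD Re_sum -mulrA ReM_real; congr (_ + (_ + (_ + _))).
  by apply: eq_bigr => i _; rewrite -mulrA ReM_real.
have : (u (f z0 + y0)%R <= (complex.Re (H 0))%:E)%E.
  apply: (@psh_line_majorant (f z0 + y0) d rho H rho0).
  - by move=> l lr; rewrite lineE; apply: inW'; [exact: zl1|exact: yld].
  - move=> l lr; have [p pP] := Pd _ (zl1 l lr).
    have [d' d'P] := fd (zl1 l lr).
    eexists; apply: cderivD; first exact: cderiv_cst.
    apply: cderivD; first exact: cderiv_shift pP.
    apply: cderivD; first by apply: cderivZ; exact: cderiv_id.
    apply: cderiv_sum => i; apply: cderivZ.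
    rewrite /rem; have := cderivZ (-1) (cderiv_shift (d'P i)).
    have := cderivD (cderiv_cst (f z0 0 i) l) (cderivZ (d 0 i) (cderiv_id l)).
    move=> h1 h2; have := cderivD h1 h2.
    rewrite (_ : (fun w => f z0 0 i + d 0 i * id w + -1 * f (z0 + w) 0 i) =
      (fun w => f z0 0 i + w * d 0 i - f (z0 + w) 0 i)); first by apply.
    by apply/funext => w; rewrite mulN1r [d 0 i * _]mulrC.
  - move=> l lE; have lr : normc l <= rho by rewrite lE.
    have := mx (z0 + l) (yl l) (zl1 l lr) (yld l lr).
    rewrite -lineE => le; have {le} : (u (f z0 + y0 + l *: d)%R <=
        (v + phi z0 y0 - phi (z0 + l)%R (yl l))%:E)%E.
      rewrite EFinB EFinD leeBrDr//.
    move=> /le_trans; apply; rewrite lee_fin ReH /k [phi (z0 + l) _]/phi.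
    rewrite -[normc (z0 + l) * _]expr2 normc2D lE.
    have yb i : normc (yl l 0 i) * normc (yl l 0 i) <=
       normc (y0 0 i) ^+ 2 + (e * rho) ^+ 2 + 2 * complex.Re ((y0 0 i)^*%C * rem l i).
      rewrite -expr2 mxE normc2D -!addrA lerD2l addrC lerD2r.
      apply: lerXn2r; rewrite ?nnegrE ?normc_ge0//.
        by rewrite mulr_ge0 ?(ltW e0) ?(ltW rho0).
      by rewrite -lE; exact: remP.
    have : C * \sum_i normc (yl l 0 i) * normc (yl l 0 i) <=
        C * (\sum_i (normc (y0 0 i) ^+ 2 + (e * rho) ^+ 2) +
             2 * \sum_i complex.Re ((y0 0 i)^*%C * rem l i)).
      rewrite ler_pM2l// mulr_sumr -big_split /=.
      by apply: ler_sum => i _; exact: yb.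
    rewrite -[X in _ -> _ <= _ + (_ + (_ + X))]mulr_sumr.
    by lra.
rewrite vE lee_fin ReH mulr0 /= mulr0 big1 => [|i _]; last first.
  by rewrite /rem mul0r !addr0 subrr mulr0 /= mulr0.
rewrite !addr0 /k /phi big_split /= sumr_const card_ord.
under [X in - C * X]eq_bigr do rewrite -expr2.
rewrite -mulr_natr exprMn.
have : (C * n%:R * e ^+ 2) * rho ^+ 2 < eta * rho ^+ 2 by rewrite ltr_pM2r ?exprn_gt0.
by lra.
Qed.

End DiscMajorant.

(** * Two-constants estimate *)

Section CircleMeasure.
Variable R : realType.
Notation mu := (@lebesgue_measure R).
Implicit Types (s t : R) (X : set R).

Definition cell (L k : nat) : set R :=
  `[k%:R * (2 * pi / L%:R), k.+1%:R * (2 * pi / L%:R)[%classic.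

Definition turn : set R := `[0, 2 * pi[%classic.

Lemma pi2_gt0 : 0 < 2 * pi :> R.
Proof. by rewrite mulr_gt0// pi_gt0. Qed.

Lemma measurable_turn : measurable turn. Proof. exact: measurable_itv. Qed.
Lemma measurable_cell L k : measurable (cell L k).
Proof. exact: measurable_itv. Qed.

Lemma measure_turn : mu turn = (2 * pi)%:E.
Proof. by rewrite /turn lebesgue_measure_itv /= lte_fin pi2_gt0 oppr0 adde0. Qed.

Lemma measure_cell L k : (0 < L)%N -> mu (cell L k) = (2 * pi / L%:R)%:E.
Proof.
move=> L0; have w0 : 0 < 2 * pi / L%:R :> R by rewrite divr_gt0 ?pi2_gt0 ?ltr0n.
rewrite /cell lebesgue_measure_itv /= lte_fin ltr_pM2r// ltr_nat ltnS leqnn.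
by rewrite -EFinB -mulrBl -natr1 addrAC subrr add0r mul1r.
Qed.

Lemma integral_turn_cells L (g : R -> \bar R) : (0 < L)%N ->
  measurable_fun setT g -> (forall t, (0 <= g t)%E) ->
  (\int[mu]_(t in turn) g t = \sum_(k < L) \int[mu]_(t in cell L k) g t)%E.
Proof.
move=> L0 mg g0; have w0 : 0 < 2 * pi / L%:R :> R by rewrite divr_gt0 ?pi2_gt0 ?ltr0n.
pose J m : set R := `[0, m%:R * (2 * pi / L%:R)[%classic.
have partial m : (\int[mu]_(t in J m) g t =
    \sum_(k < m) \int[mu]_(t in cell L k) g t)%E.
  elim: m => [|m IH]; first by rewrite /J mul0r set_itvco0 integral_set0 big_ord0.
  rewrite big_ord_recr /= -IH -ge0_integral_setU//=.
  - rewrite /J /cell -itv_bndbnd_setU ?bnd_simp//.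
      exact: mulr_ge0 (ler0n _ _) (ltW w0).
    by rewrite ler_pM2r// ler_nat.
  - exact: measurable_itv.
  - exact: (@measurable_cell L m).
  - exact: measurable_funTS.
  - rewrite disj_set2E; apply/eqP/seteqP; split => // t [].
    by rewrite /J /cell /= !in_itv/= => /andP[_ tk] /andP[/le_lt_trans/(_ tk)]; rewrite ltxx.
rewrite -partial /turn /J; congr (integral _ _ _).
by rewrite [L%:R * _]mulrC divfK// pnatr_eq0 -lt0n.
Qed.

Lemma turn_cells L X : (0 < L)%N -> measurable X ->
  mu (turn `&` X) = (\sum_(k < L) mu (cell L k `&` X))%E.
Proof.
move=> L0 mX; rewrite setIC -(integral_indic mu measurable_turn mX).
rewrite (integral_turn_cells L0); last 2 first.
- exact/measurable_EFinP/measurable_indic.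
- by move=> t; rewrite lee_fin.
apply: eq_bigr => k _.
by rewrite (integral_indic mu (@measurable_cell L k) mX) setIC.
Qed.

Lemma cell_close L k t : (0 < L)%N -> cell L k t ->
  normc (expi t - grid R L k) <= 2 * pi / L%:R.
Proof.
move=> L0 /=; rewrite /cell /= in_itv /= => /andP[kt tk].
apply: le_trans (expi_lipschitz _ _) _.
rewrite ger0_norm ?subr_ge0// lerBlDl; apply: ltW; apply: lt_le_trans tk _.
by rewrite -natr1 mulrDl mul1r addrC.
Qed.

Lemma large_denominator (b e : R) : 0 < e -> exists L : nat,
  forall m, (L <= m)%N -> (0 < m)%N -> b / m%:R <= e.
Proof.
move=> e0; have [L] : exists L : nat, `|b| / e < L%:R.
  by exists (Num.bound (`|b| / e)); apply: archi_boundP; rewrite divr_ge0// ltW.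
rewrite ltr_pdivrMr// => bL; exists L => m Lm m0.
rewrite ler_pdivrMr ?ltr0n//; apply: le_trans (ler_norm _) _.
apply: le_trans (ltW bL) _; rewrite mulrC ler_pM2l// ler_nat//.
Qed.

End CircleMeasure.

Section TwoConstants.
Variable R : realType.
Notation mu := (@lebesgue_measure R).

(** As d decreases to 0 these closed sets exhaust the arguments of a relatively
    open set A. *)
Definition deep (A : set R[i]) (d : R) : set R :=
  [set t : R | forall z, normc z = 1 -> normc (z - expi t) < d -> A z].

Lemma closed_deep A d : closed (deep A d).
Proof.
rewrite -[X in closed X]setCK; apply: open_closedC; rewrite openE => t.
move=> /existsNP[z /not_implyP[z1 /not_implyP[zt nA]]].
apply/nbhs_ballP; exists (d - normc (z - expi t)); first by rewrite /= subr_gt0.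
move=> s /=; rewrite -ball_normE /= => ts /(_ z z1); apply/not_implyP; split => //.
apply: le_lt_trans (normc_distD (expi t) _ _) _.
by rewrite -ltrBrDl; apply: le_lt_trans (expi_lipschitz _ _) _.
Qed.

Lemma measure_deep (A : set R[i]) (a : R) :
  (forall z, A z -> exists2 r : R, 0 < r & forall w, normc w = 1 -> normc (w - z) < r -> A w) ->
  (a%:E < mu (@turn R `&` [set t | A (expi t)]))%E ->
  exists2 d : R, 0 < d & (a%:E < mu (@turn R `&` deep A d))%E.
Proof.
move=> openA.
have -> : @turn R `&` [set t | A (expi t)] =
    \bigcup_m (@turn R `&` deep A m.+1%:R^-1).
  apply/seteqP; split => [t [tt At]|t [m _ [tt dt]]]; last first.
    by split => //; apply: dt; rewrite ?normc_expi// subrr normc0 invr_gt0.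
  have [r r0 rP] := openA _ At.
  have [L LP] := large_denominator 1 r0.
  exists L => //; split => // z z1 zt; apply: rP => //.
  by apply: lt_le_trans zt _; rewrite -div1r LP.
have mdeep m : measurable (@turn R `&` deep A m.+1%:R^-1).
  apply: measurableI; first exact: measurable_turn.
  exact: (closed_measurable (@closed_deep _ _)).
move=> lt; have := @nondecreasing_cvg_mu _ _ _ mu (fun m => @turn R `&` deep A m.+1%:R^-1) mdeep.
have mono : {homo (fun m => @turn R `&` deep A m.+1%:R^-1) : n m / (n <= m)%N >-> (n <= m)%O}.
  move=> p q pq; apply/subsetPset; apply: setIS => t tp z z1 zt; apply: tp => //.
  by apply: lt_le_trans zt _; rewrite lef_pV2 ?posrE// ler_nat.
move=> /(_ (bigcup_measurable (fun k _ => mdeep k)) mono).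
move=> /(_ [set x | a%:E < x]%E)[|N _ /(_ N (leqnn N))/= aN].
  apply: open_nbhs_nbhs; split; [exact: open_ereal_gt_ereal|exact: lt].
by exists N.+1%:R^-1; rewrite ?invr_gt0.
Qed.

(** Sum the kernels of the grid points deep inside A.  At the centre every
    kernel has the value 1 / L, so the sum there is at least the normalized
    measure of a slightly smaller set; at a point of the circle outside A all
    these kernels are far. *)
Lemma harmonic_minorant (A : set R[i]) (a e : R) : 0 < e ->
  (forall z, A z -> exists2 r : R, 0 < r & forall w, normc w = 1 -> normc (w - z) < r -> A w) ->
  ((2 * pi * a)%:E < mu (@turn R `&` [set t | A (expi t)]))%E ->
  exists p : {poly R[i]},
    [/\ forall z, normc z = 1 -> complex.Re p.[z] <= 1,
        forall z, normc z = 1 -> ~ A z -> complex.Re p.[z] <= e &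
        a <= complex.Re p.[0]].
Proof.
move=> e0 openA /(measure_deep openA)[d0 d00 dA].
pose d := Num.min 1 (d0 / 2).
have d_gt0 : 0 < d by rewrite lt_min ltr01 divr_gt0.
have d1 : d <= 1 by rewrite ge_min lexx.
have dd0 : d + d <= d0.
  have : d <= d0 / 2 by rewrite ge_min lexx orbT.
  lra.
have q01 : 0 <= 1 - d ^+ 2 / 4 < 1 by apply/andP; split; nra.
have [N Ne] := polynomial_geometric_small q01 e0.
have [L0 L0P] := large_denominator (2 * pi) d_gt0.
pose L := (maxn L0 N).+1.
have NL : (N < L)%N by rewrite ltnS leq_maxr.
have Ld : 2 * pi / L%:R <= d by apply: L0P => //; rewrite leqW// leq_maxl.
pose S := [pred k : 'I_L | `[< forall z, normc z = 1 -> normc (z - grid R L k) < d -> A z >]].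
exists (\sum_(k < L | S k) weight_poly R L N k); split.
- move=> z z1; rewrite horner_sum Re_sum.
  apply: (@le_trans _ _ (\sum_(k < L) weight L N k z)); last by rewrite sum_weight.
  rewrite [leRHS](bigID S) /=.
  under eq_bigr do rewrite weight_polyE//.
  by rewrite lerDl sumr_ge0// => k _; exact: weight_ge0.
- move=> z z1 nA; rewrite horner_sum Re_sum.
  apply: (@le_trans _ _ (\sum_(k < L | d <= normc (z - grid R L k)) weight L N k z)); last first.
    apply: le_trans (sum_weight_far NL z1 _) Ne.
    by rewrite (ltW d_gt0) (le_trans d1)// ler1n.
  rewrite big_mkcond [leRHS]big_mkcond /=; apply: ler_sum => k _.
  case: ifPn => [/asboolP Sk|_]; last by case: ifP => // _; exact: weight_ge0.
  rewrite weight_polyE//; case: (leP d (normc (z - grid R L k))) => [//|near].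
  by case: nA; exact: Sk.
- have L_gt0 : (0 < L)%N by [].
  have mdeep : measurable (deep A d0) by exact: (closed_measurable (@closed_deep _ _)).
  have : (mu (@turn R `&` deep A d0) <= \sum_(k < L) (if S k then 2 * pi / L%:R else 0)%:E)%E.
    rewrite (turn_cells L_gt0 mdeep); apply: lee_sum => k _.
    case: ifPn => [_|nS].
      rewrite -(measure_cell R k L_gt0); apply: le_measure; rewrite ?inE.
      - by apply: measurableI => //; exact: measurable_cell.
      - exact: measurable_cell.
      - exact: subIsetl.
    rewrite (_ : _ `&` _ = set0) ?measure0//.
    apply/seteqP; split => // t [tk td]; case/negP: nS; apply/asboolP => z z1 zk.
    apply: td => //; apply: le_lt_trans (normc_distD (grid R L k) _ _) _.
    have := cell_close L_gt0 tk; rewrite normc_distC; lra.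
  move=> /(lt_le_trans dA); rewrite sumEFin lte_fin -big_mkcond /=.
  rewrite sumr_const horner_sum Re_sum.
  under eq_bigr do rewrite weight_poly0//.
  rewrite sumr_const => lt; apply: ltW; rewrite -(ltr_pM2l (@pi2_gt0 R)).
  apply: lt_le_trans lt _; rewrite -[leLHS]mulr_natr -[X in _ <= _ * X]mulr_natr.
  have -> : complex.Re (L%:R^-1 : R[i]) = L%:R^-1.
    by rewrite -(rmorph_nat (real_complex R)) -fmorphV.
  by rewrite mulrA.
Qed.

End TwoConstants.

Section PshAlongDiscs.
Variables (R : realType) (n : nat).
Notation mu := (@lebesgue_measure R).

Lemma holomorphic_disc_cderiv (V : set 'rV[R[i]]_n) f :
  holomorphic_disc V f -> forall z : R[i], normc z <= 1 ->
  exists d : 'rV[R[i]]_n, forall i, cderiv (fun w => f w 0 i) z (d 0 i).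
Proof.
move=> [[D [_ DW Df]] _] z z1; apply: derivable_cderiv; apply: Df; apply: DW.
by apply/closed_discE; rewrite subr0.
Qed.

Lemma holomorphic_disc_image (V : set 'rV[R[i]]_n) f :
  holomorphic_disc V f -> forall z : R[i], normc z <= 1 -> V (f z).
Proof.
by move=> [_ fV] z z1; apply: fV; exists z => //; apply/closed_discE; rewrite subr0.
Qed.

(** The majorant principle is applied to M + e - (M - c) p, where Re p
    approximates from below, up to a small error, the indicator of the part of
    the circle that f maps into O. *)
Lemma psh_two_constants (W V O : set 'rV[R[i]]_n) (u : 'rV[R[i]]_n -> \bar R)
    (f : R[i] -> 'rV[R[i]]_n) (c M a : R) :
  open W -> plurisubharmonic W u -> V `<=` W -> holomorphic_disc V f -> c < M ->
  open O -> (forall y, V y -> (u y < M%:E)%E) ->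
  (forall y, V y -> O y -> (u y < c%:E)%E) ->
  (a%:E < arc_measure (@unit_circle R `&` f @^-1` O))%E ->
  (u (f 0%R) <= (M - (M - c) * a)%:E)%E.
Proof.
move=> oW psh VW hf cM oO uM uc.
have fd := holomorphic_disc_cderiv hf; have fV := holomorphic_disc_image hf.
have fW z : normc z <= 1 -> W (f z) by move=> z1; apply: VW; exact: fV.
pose A := @unit_circle R `&` f @^-1` O.
rewrite /arc_measure -/(turn) => lt.
have big : ((2 * pi * a)%:E < mu (@turn R `&` [set t | A (expi t)]))%E.
  have p0 : (0 < ((2 * pi)^-1)%:E :> \bar R)%E by rewrite lte_fin invr_gt0 pi2_gt0.
  rewrite -(lte_pmul2l _ p0) ?fin_numE// -EFinM mulrA mulVf ?mul1r//.
  by rewrite gt_eqF// pi2_gt0.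
have openA z : A z -> exists2 r : R, 0 < r &
    forall w, normc w = 1 -> normc (w - z) < r -> A w.
  move=> [/unit_circleE z1 Oz].
  have [e e0 eO] := iffLR (open_polydiscP O) oO _ Oz.
  have z_le1 : normc z <= 1 by rewrite z1.
  have [r r0 rP] := disc_continuous fd z_le1 e0.
  exists r => // w w1 wz; split; first exact/unit_circleE.
  by apply: eO; exact: rP.
apply/lee_addgt0Pr => e e0; have Mc : 0 < M - c by rewrite subr_gt0.
have e' : 0 < e / (M - c) by rewrite divr_gt0.
have [p [p1 pA p0]] := harmonic_minorant e' openA big.
pose Q z := (M + e)%:C + (c - M)%:C * p.[z].
have ReQ z : complex.Re (Q z) = M + e - (M - c) * complex.Re p.[z].
  by rewrite ReD ReM_real /=; ring.
have eE : (M - c) * (e / (M - c)) = e by rewrite mulrC divfK// gt_eqF.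
have -> : ((M - (M - c) * a)%:E + e%:E)%E = (M + e - (M - c) * a)%:E :> \bar R.
  by rewrite -EFinD; congr _%:E; ring.
apply: (@le_trans _ _ (complex.Re (Q 0))%:E); last first.
  rewrite lee_fin ReQ; have : (M - c) * a <= (M - c) * complex.Re p.[0] by rewrite ler_pM2l.
  lra.
apply: (psh_disc_majorant psh oW fd fW).
  move=> z _; have [d dP] := cderiv_horner p z.
  eexists; apply: cderivD; first exact: cderiv_cst.
  exact: cderivZ dP.
move=> z z1; have z_le1 : normc z <= 1 by rewrite z1.
have [Az|nAz] := pselect (A z).
  have [_ Oz] := Az; apply: lt_trans (uc _ (fV _ z_le1) Oz) _.
  rewrite lte_fin ReQ; have : (M - c) * complex.Re p.[z] <= (M - c) * 1.
    by rewrite ler_pM2l// p1.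
  lra.
apply: lt_le_trans (uM _ (fV _ z_le1)) _.
rewrite lee_fin ReQ; have : (M - c) * complex.Re p.[z] <= e.
  by rewrite -eE ler_pM2l// pA.
lra.
Qed.

End PshAlongDiscs.

(** * From discs to non-thinness *)

Section DiscsImplyNonThin.
Variables (R : realType) (n : nat).
Implicit Types (x y : 'rV[R[i]]_n).

Lemma euclidean_closed_ballE x (r : R) y : euclidean_closed_ball x r y <->
  \sum_(i < n) normc (y 0 i - x 0 i) ^+ 2 <= r ^+ 2.
Proof.
rewrite /euclidean_closed_ball /=.
under eq_bigr do rewrite normrc -rmorphXn.
by rewrite -rmorph_sum lecR.
Qed.

Lemma euclidean_ball_sub_polydisc x (r s : R) : 0 <= r -> r < s ->
  euclidean_closed_ball x r `<=` polydisc x s.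
Proof.
move=> r0 rs y /euclidean_closed_ballE yr i; apply: le_lt_trans rs.
rewrite -(@ler_pXn2r _ 2)// ?nnegrE ?normc_ge0//; apply: le_trans yr.
by rewrite (bigD1 i)//= lerDl sumr_ge0// => j _; rewrite exprn_ge0 ?normc_ge0.
Qed.

Lemma polydisc_sub_euclidean_ball x (r : R) : 0 <= r ->
  polydisc x (r / n.+1%:R) `<=` euclidean_closed_ball x r.
Proof.
move=> r0 y xy; apply/euclidean_closed_ballE.
pose q := r / n.+1%:R; have q0 : 0 <= q by rewrite divr_ge0.
apply: (@le_trans _ _ (\sum_(i < n) q ^+ 2)).
  apply: ler_sum => i _; rewrite lerXn2r ?nnegrE ?normc_ge0//.
  exact/ltW/xy.
rewrite sumr_const card_ord -mulr_natl.
have -> : r = n.+1%:R * q by rewrite /q mulrC divfK.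
clearbody q; rewrite exprMn ler_wpM2r ?exprn_ge0// -natrX ler_nat; nia.
Qed.

Lemma limsup_along_le (W E : set 'rV[R[i]]_n) (u : 'rV[R[i]]_n -> \bar R) x :
  usc_on W u -> W x -> (limsup_along u (W `&` E) x <= u x)%E.
Proof.
move=> usc Wx; rewrite leNgt; apply/negP => /ereal_between[c [uc cl]].
have [_ /(_ c uc)/nbhs_polydiscP[s s0 sP]] := usc _ Wx.
move: cl; apply/negP; rewrite -leNgt.
apply: ge_ereal_inf; exists (ereal_sup (u @` (euclidean_closed_ball x (s / 2) `&` (W `&` E)))).
  by exists (s / 2) => //=; rewrite divr_gt0.
apply: ge_ereal_sup => _ [y [yb [Wy _]] <-]; apply/ltW/sP => //.
by apply: euclidean_ball_sub_polydisc yb; lra.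
Qed.

Lemma arc_measure0 : arc_measure set0 = 0%E :> \bar R.
Proof.
rewrite /arc_measure (_ : [set t : R | set0 (expi t)] = set0) ?setI0 ?measure0 ?mule0//.
Qed.

(** Closure: if some polydisc contained no point of Y other than x, the
    complement of a smaller closed polydisc would be an admissible U that no
    disc in the smaller polydisc meets.  Limsup: U consists of the points near
    x where u < c and of the complement of the closure of V; discs in V do not
    reach the latter. *)
Lemma non_thin_of_discs (Y : set 'rV[R[i]]_n) x :
  (forall (e : R) (V U : set 'rV[R[i]]_n),
     0 < e -> nbhs x V -> open U -> Y `\ x `<=` U ->
     exists f : R[i] -> 'rV[R[i]]_n,
       [/\ holomorphic_disc V f, f 0 = x &
           ((1 - e)%:E < arc_measure (@unit_circle R `&` f @^-1` (V `&` U)))%E]) ->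
  non_thin Y x.
Proof.
move=> discs; split.
  apply: contrapT => /existsNP[B /not_implyP[/nbhs_polydiscP[r r0 rB] YB]].
  have r2 : 0 < r / 2 by rewrite divr_gt0.
  have [||| |f [_ _]] := discs 1 (polydisc x (r / 2)) (~` closed_polydisc x (r / 2)) => //.
  - by apply/nbhs_polydiscP; exists (r / 2).
  - exact: closed_openC (@closed_closed_polydisc R n x _).
  - move=> y Yy yr; apply: YB; exists y; split => //; apply: rB => i.
    by apply: le_lt_trans (yr i) _; lra.
  rewrite subrr (_ : polydisc _ _ `&` _ = set0).
    by rewrite preimage_set0 setI0 arc_measure0 ltxx.
  by apply/seteqP; split => // y [yV] []; move=> i; exact/ltW/yV.
move=> W u oW Wx psh; have [usc _] := psh.
apply/eqP; rewrite eq_le limsup_along_le//= leNgt; apply/negP.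
move=> /ereal_between[c [/ereal_inf_lt[_ [r /= r0 <-] supc] cu]].
have [uoo _] := usc _ Wx.
have [u0 u0E] : exists u0 : R, u x = u0%:E.
  by case: (u x) cu uoo => [r1| |]// _ _; exists r1.
rewrite u0E lte_fin in cu; pose M := u0 + 1.
have cM : c < M by rewrite /M; lra.
have [s1 s10 s1P] : exists2 s, 0 < s & forall y, polydisc x s y -> W y /\ (u y < M%:E)%E.
  have [_ /(_ M)] := usc _ Wx; rewrite u0E lte_fin ltrDl ltr01 => /(_ isT) nu.
  have nW : nbhs x W by apply: open_nbhs_nbhs.
  have /nbhs_polydiscP[s s0 sP] : nbhs x [set y | W y /\ (u y < M%:E)%E].
    by apply: filterS2 nW nu => v Wv uv; split => //; exact: uv.
  by exists s.
pose s := Num.min s1 (r / n.+1%:R).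
have s0 : 0 < s by rewrite lt_min s10 divr_gt0.
have ss1 y : polydisc x s y -> polydisc x s1 y.
  by move=> ys i; apply: lt_le_trans (ys i) _; rewrite ge_min lexx.
have sr y : polydisc x s y -> euclidean_closed_ball x r y.
  move=> ys; apply: polydisc_sub_euclidean_ball; first exact: ltW.
  by move=> i; apply: lt_le_trans (ys i) _; rewrite ge_min lexx orbT.
pose V := polydisc x (s / 2).
pose U := (polydisc x s `&` [set y | (u y < c%:E)%E]) `|` ~` closed_polydisc x (s / 2).
have VS y : V y -> polydisc x s y.
  by move=> yV i; apply: lt_trans (yV i) _; lra.
have oU : open U.
  apply: openU; last exact: closed_openC (@closed_closed_polydisc R n x _).
  rewrite openE => y [ys uy].
  have [Wy _] := s1P _ (ss1 _ ys); have [_ /(_ c uy) nu] := usc _ Wy.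
  have nW : nbhs y W by apply: open_nbhs_nbhs.
  have ns : nbhs y (polydisc x s) by apply: open_nbhs_nbhs; split => //; exact: open_polydisc.
  by apply: filterS3 nW ns nu => v Wv vs uv; split => //; exact: uv.
have YU : Y `\ x `<=` U.
  move=> y Yy; have [ys|ys] := pselect (polydisc x s y); [left|right].
    split => //=; apply: le_lt_trans supc; apply: ereal_sup_ubound; exists y => //.
    by split; [exact: sr|split => //; have [] := s1P _ (ss1 _ ys)].
  move=> yc; apply: ys => i; apply: le_lt_trans (yc i) _; lra.
(* so that M - (M - c) (1 - e) is the midpoint of c and u0 *)
pose e := (u0 - c) / (2 * (M - c)).
have Mc : 0 < M - c by rewrite subr_gt0.
have e0 : 0 < e by rewrite divr_gt0 ?subr_gt0// mulr_gt0.
have nV : nbhs x V by apply/nbhs_polydiscP; exists (s / 2) => //; rewrite divr_gt0.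
have [f [hf f0 big]] := discs e V U e0 nV oU YU.
have := @psh_two_constants R n W V (V `&` U) u f c M (1 - e) oW psh.
have VW : V `<=` W by move=> y /VS/ss1/s1P[].
move=> /(_ VW hf cM (openI (@open_polydisc R n x (s / 2)) oU)).
have uM y : V y -> (u y < M%:E)%E by move=> /VS/ss1/s1P[].
have uc y : V y -> (V `&` U) y -> (u y < c%:E)%E.
  move=> Vy [_ [[_ //]|nc]]; exfalso; apply: nc => i; exact/ltW/Vy.
move=> /(_ uM uc big); rewrite f0 u0E lee_fin.
have -> : M - (M - c) * (1 - e) = c + (u0 - c) / 2.
  by rewrite /e; field; rewrite gt_eqF.
lra.
Qed.

End DiscsImplyNonThin.

(** * Polynomial discs and the time they spend in an open set *)

Section AffineChangeOfVariable.
Variable R : realType.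
Notation mu := (@lebesgue_measure R).

(** After rescaling, the image of the Lebesgue measure agrees with it on
    intervals, hence everywhere. *)
Lemma lebesgue_measure_affine (a b : R) (B : set R) : 0 < a -> measurable B ->
  mu [set t | B (a * t - b)] = ((a^-1)%:E * mu B)%E.
Proof.
move=> a0 mB.
pose phi : measurableTypeR R -> measurableTypeR R := fun t => a * t - b.
have cphi : continuous (phi : R -> R).
  by move=> t; apply: cvgB; [apply: cvgM; [exact: cvg_cst|exact: cvg_id]|exact: cvg_cst].
have mphi : measurable_fun setT phi.
  exact: continuous_measurable_fun.
suff -> : mu B = mscale (NngNum (ltW a0)) (pushforward mu phi) B.
  by rewrite /mscale /= muleA -EFinM mulVf ?gt_eqF// mul1e.
move=> mp; apply: lebesgue_measure_unique => //= _ [[c d] _ <-] /=.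
change (mu `]c, d] = a%:E * mu (phi @^-1` `]c, d]))%E.
have -> : phi @^-1` `]c, d] = `](c + b) / a, (d + b) / a]%classic.
  apply/seteqP; split => t; rewrite /phi /= !in_itv/= ltrBrDr lerBlDr;
    by rewrite ltr_pdivrMr// ler_pdivlMr// mulrC.
rewrite !lebesgue_measure_itv/= !lte_fin ltr_pM2r ?invr_gt0// ltrD2r.
case: ifP => _; last by rewrite mule0.
by rewrite -!EFinB -EFinM; congr _%:E; field; rewrite gt_eqF.
Qed.

(** Multiplication by K wraps each of the K cells once around the circle. *)
Lemma measure_cell_wrap (K k : nat) (B : set R) : (0 < K)%N -> measurable B ->
  (forall t m, B (t + m%:R * (2 * pi)) <-> B t) ->
  mu (cell K k `&` [set t | B (K%:R * t)]) = ((K%:R^-1)%:E * mu (@turn R `&` B))%E.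
Proof.
move=> K0 mB per; have KR : 0 < K%:R :> R by rewrite ltr0n.
rewrite -(@lebesgue_measure_affine K%:R (k%:R * (2 * pi)))//; last first.
  by apply: measurableI => //; exact: measurable_turn.
congr (mu _); apply/seteqP; split => t.
  move=> [tk Bt]; split; last by rewrite -(per _ k) subrK.
  move: tk; rewrite /cell /turn /= !in_itv /= !mulrA !ler_pdivrMr// !ltr_pdivlMr//.
  rewrite subr_ge0 ltrBlDr -natr1 => /andP[? ?]; apply/andP; split; lra.
move=> [tk Bt]; split; last by rewrite /= -(subrK (k%:R * (2 * pi)) (_ * t)) per.
move: tk; rewrite /cell /turn /= !in_itv /= !mulrA !ler_pdivrMr// !ltr_pdivlMr//.
rewrite subr_ge0 ltrBlDr -natr1 => /andP[? ?]; apply/andP; split; lra.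
Qed.

End AffineChangeOfVariable.

Section PolynomialDiscs.
Variables (R : realType) (n : nat).
Notation mu := (@lebesgue_measure R).
Notation pdisc := 'rV[{poly R[i]}]_n.
Implicit Types (P : pdisc) (x y z : 'rV[R[i]]_n) (U : set 'rV[R[i]]_n).

Definition eval P (w : R[i]) : 'rV[R[i]]_n := \row_i (P 0 i).[w].

Lemma eval_continuous P w (e : R) : 0 < e -> exists2 r : R, 0 < r &
  forall w', normc (w' - w) < r -> polydisc (eval P w) e (eval P w').
Proof.
move=> e0.
have [|r r0 rP] := @uniform_radius R n (fun i r => forall w',
    normc (w' - w) < r -> normc ((P 0 i).[w'] - (P 0 i).[w]) < e).
  move=> i; have [d dP] := cderiv_horner (P 0 i) w.
  have [r r0 rP] := cderiv_continuous dP e0.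
  exists r => // s /andP[_ sr] w' ws.
  by apply: rP; exact: lt_le_trans sr.
by exists r => // w' wr i; rewrite !mxE; apply: (rP i r) => //; rewrite r0 lexx.
Qed.

Lemma holomorphic_disc_eval P (V : set 'rV[R[i]]_n) :
  (forall w, normc w <= 1 -> V (eval P w)) -> holomorphic_disc V (eval P).
Proof.
move=> PV; split.
  exists setT; split => //; first exact: openT.
  move=> w _; apply: cderiv_derivable => i.
  have [d dP] := cderiv_horner (P 0 i) w; exists d.
  rewrite (_ : (fun w => eval P w 0 i) = horner (P 0 i))//.
  by apply/funext => w'; rewrite mxE.
by move=> _ [w /closed_discE w1 <-]; apply: PV; rewrite -[w]subr0.
Qed.

Lemma eval_maximum_principle P x (r : R) w :
  (forall t, closed_polydisc x r (eval P (expi t))) -> normc w <= 1 ->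
  closed_polydisc x r (eval P w).
Proof.
move=> Pr w1 i; have := @horner_maximum_principle R (P 0 i - (x 0 i)%:P) r w.
rewrite !hornerE mxE; apply => // t.
by have := Pr t i; rewrite !hornerE mxE.
Qed.

(** The margin m makes membership in U stable when a disc is translated or
    glued. *)
Definition robust U (m : R) : set 'rV[R[i]]_n := [set y | polydisc y m `<=` U].

Definition robust_args U m P : set R := [set t | robust U m (eval P (expi t))].

Definition score U m P : \bar R := mu (@turn R `&` robust_args U m P).

Lemma measurable_robust_args U m P : measurable (robust_args U m P).
Proof.
apply: closed_measurable.
rewrite -[X in closed X]setCK; apply: open_closedC; rewrite openE => t.
move=> /existsNP[y /not_implyP[ym nU]].
have [|d d0 dP] := @uniform_radius R n
    (fun i d => normc (y 0 i - eval P (expi t) 0 i) + d <= m).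
  move=> i; exists (m - normc (y 0 i - eval P (expi t) 0 i)).
    by rewrite subr_gt0; exact: ym.
  by move=> s /andP[_]; rewrite lerBrDl.
have [e e0 eP] := eval_continuous P (expi t) d0.
apply/nbhs_ballP; exists e => // s; rewrite -ball_normE /= => ts rob.
apply: nU; apply: rob => i.
have lt_e : normc (expi s - expi t) < e.
  by apply: le_lt_trans (expi_lipschitz _ _) _; rewrite distrC.
have := eP _ lt_e i; have := dP i d; rewrite d0 lexx => /(_ isT).
have := normc_distD (eval P (expi t) 0 i) (y 0 i) (eval P (expi s) 0 i).
rewrite [normc (eval P (expi t) 0 i - eval P (expi s) 0 i)]normc_distC; lra.
Qed.

Lemma robust_args_periodic U m P t k :
  robust_args U m P (t + k%:R * (2 * pi)) <-> robust_args U m P t.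
Proof. by rewrite /robust_args /= expi_periodic. Qed.

Lemma score_ge0 U m P : (0 <= score U m P)%E.
Proof. exact: measure_ge0. Qed.

Lemma score_le U m P : (score U m P <= (2 * pi)%:E)%E.
Proof.
rewrite -(@measure_turn R); apply: le_measure; rewrite ?inE.
- by apply: measurableI; [exact: measurable_turn|exact: measurable_robust_args].
- exact: measurable_turn.
- exact: subIsetl.
Qed.

Lemma score_fin U m P : score U m P \is a fin_num.
Proof.
rewrite ge0_fin_numE ?score_ge0//; apply: le_lt_trans (score_le _ _ _) _.
by rewrite ltry.
Qed.

Lemma score_mono U (m m' : R) P : m' <= m -> (score U m P <= score U m' P)%E.
Proof.
move=> m'm; apply: le_measure; rewrite ?inE.
- by apply: measurableI; [exact: measurable_turn|exact: measurable_robust_args].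
- by apply: measurableI; [exact: measurable_turn|exact: measurable_robust_args].
move=> t [tt rob]; split => // y ym; apply: rob => i.
exact: lt_le_trans (ym i) m'm.
Qed.

Definition translate P (v : 'rV[R[i]]_n) : pdisc := \row_i (P 0 i + (v 0 i)%:P).

Lemma eval_translate P v w : eval (translate P v) w = eval P w + v.
Proof. by apply/rowP => i; rewrite !mxE !hornerE. Qed.

Lemma score_translate U m (k : R) P (v : 'rV[R[i]]_n) : (forall i, normc (v 0 i) <= k) ->
  (score U m P <= score U (m - k) (translate P v))%E.
Proof.
move=> vk; apply: le_measure; rewrite ?inE.
- by apply: measurableI; [exact: measurable_turn|exact: measurable_robust_args].
- by apply: measurableI; [exact: measurable_turn|exact: measurable_robust_args].
move=> t [tt rob]; split => // y ym; apply: rob => i.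
have := ym i; have := vk i; rewrite eval_translate mxE.
have -> : y 0 i - eval P (expi t) 0 i =
  (y 0 i - (eval P (expi t) 0 i + v 0 i)) + v 0 i by ring.
have := normcD (y 0 i - (eval P (expi t) 0 i + v 0 i)) (v 0 i); lra.
Qed.

(** The margin m is kept from the boundary of the ambient polydisc as well. *)
Definition admissible x (r m : R) z P :=
  eval P 0 = z /\ forall t, closed_polydisc x (r - m) (eval P (expi t)).

Lemma admissible_translate x (r m k : R) z P (v : 'rV[R[i]]_n) : (forall i, normc (v 0 i) <= k) ->
  admissible x r m z P -> admissible x r (m - k) (z + v) (translate P v).
Proof.
move=> vk [P0 Pt]; split; first by rewrite eval_translate P0.
move=> t i; rewrite eval_translate mxE; have := Pt t i; have := vk i.
have -> : eval P (expi t) 0 i + v 0 i - x 0 i =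
  (eval P (expi t) 0 i - x 0 i) + v 0 i by ring.
have := normcD (eval P (expi t) 0 i - x 0 i) (v 0 i); lra.
Qed.

Lemma admissible_mono x (r m m' : R) z P : m' <= m -> admissible x r m z P -> admissible x r m' z P.
Proof.
move=> m'm [P0 Px]; split => // t i; apply: le_trans (Px t i) _.
by rewrite lerB.
Qed.

Definition const_disc z : pdisc := \row_i (z 0 i)%:P.

Lemma eval_const z w : eval (const_disc z) w = z.
Proof. by apply/rowP => i; rewrite !mxE hornerC. Qed.

Lemma admissible_const x r m z : closed_polydisc x (r - m) z ->
  admissible x r m z (const_disc z).
Proof. by move=> xz; split => [|t]; rewrite eval_const. Qed.

End PolynomialDiscs.

Section Averages.
Variable R : realType.

(** Since the weights sum to 1, the bound A is lost only on the far indices, of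
    total weight eta, and there by at most B. *)
Lemma weighted_average_close (L : nat) (w : nat -> R) (far : pred nat)
    (v : nat -> R[i]) (a : R[i]) (A B eta : R) :
  (forall k, 0 <= w k) -> \sum_(k < L) w k = 1 ->
  \sum_(k < L | far k) w k <= eta -> 0 <= B ->
  (forall k, (k < L)%N -> ~~ far k -> normc (v k - a) <= A) ->
  (forall k, (k < L)%N -> far k -> normc (v k - a) <= A + B) ->
  normc (\sum_(k < L) (w k)%:C * v k - a) <= A + eta * B.
Proof.
move=> w0 w1 wfar B0 near far'.
have -> : \sum_(k < L) (w k)%:C * v k - a = \sum_(k < L) (w k)%:C * (v k - a).
  under [RHS]eq_bigr do rewrite mulrBr.
  rewrite big_split /= sumrN -mulr_suml -rmorph_sum /= w1.
  by rewrite [1%:C]rmorph1 mul1r.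
apply: le_trans (normc_sum _ _ _) _.
apply: (@le_trans _ _ (\sum_(k < L) (w k * A + (if far k then w k * B else 0)))).
  apply: ler_sum => k _; rewrite normcM normc_real ger0_norm//.
  case: ifPn => fk; last by rewrite addr0 ler_wpM2l// near.
  by rewrite -mulrDr ler_wpM2l// far'.
rewrite big_split /= -mulr_suml w1 mul1r lerD2l -big_mkcond /= -mulr_suml.
by rewrite ler_wpM2r.
Qed.

Lemma sum_blocks (V : nmodType) (M q : nat) (F : nat -> V) :
  \sum_(k < M * q) F k = \sum_(j < M) \sum_(p < q) F (j * q + p)%N.
Proof.
elim: M => [|M IH]; first by rewrite mul0n !big_ord0.
rewrite mulSnr big_split_ord /= big_ord_recr /= -IH; congr (_ + _).
Qed.

Lemma count_ord_lt (q d : nat) : (\sum_(p < q) (p < d : nat) <= d)%N.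
Proof.
suff : (\sum_(p < q) (p < d : nat) <= minn q d)%N.
  by move=> /leq_trans; apply; exact: geq_minr.
elim: q => [|q IH]; first by rewrite big_ord0.
rewrite big_ord_recr /=; move: IH; set S := \sum_(p < q) _; clearbody S.
by rewrite /minn; case: (ltnP q d); case: (ltnP q.+1 d); lia.
Qed.

Lemma count_ord_ge (q d : nat) : (\sum_(p < q) (q - d <= p : nat) <= d)%N.
Proof.
rewrite (reindex_inj rev_ord_inj) /=; apply: leq_trans (count_ord_lt q d).
by apply: leq_sum => p _; have := ltn_ord p; case: leqP; case: ltnP; lia.
Qed.

End Averages.

(** * Gluing discs *)

Section Glueing.
Variable R : realType.
Notation mu := (@lebesgue_measure R).

(** The difference p(z^K) - p(0) is divisible by z^K.  As N < K this absorbs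
    the denominator z^N of the weight and leaves a positive power of z, so the
    sum is a polynomial vanishing at 0. *)
Lemma weighted_polynomial (K N : nat) (p : nat -> {poly R[i]}) : (N < K)%N ->
  exists G : {poly R[i]}, G.[0] = 0 /\ forall z, normc z = 1 ->
    G.[z] = \sum_(k < K) (weight K N k z)%:C * ((p k).[z ^+ K] - (p k).[0]).
Proof.
move=> NK.
have rootp k : root (p k - (p k).[0]%:P) 0 by rewrite /root !hornerE subrr.
have QP k : exists q : {poly R[i]}, p k = (p k).[0]%:P + q * 'X.
  have /factor_theorem[q qE] := rootp k; exists q.
  by rewrite subr0 in qE; rewrite -qE addrC subrK.
pose q k := sval (cid (QP k)).
have qE k : p k = (p k).[0]%:P + q k * 'X by exact: (svalP (cid (QP k))).
exists (\sum_(k < K) (K * 'C(N + N, N))%:R^-1 *: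
   ((grid R K k ^+ N)%:P * (1 + ((grid R K k)^*%C)%:P * 'X) ^+ (N + N) *
    'X^(K - N) * (q k \Po 'X^K))).
split.
  rewrite horner_sum big1// => k _; rewrite hornerZ !hornerM hornerXn expr0n.
  by rewrite subn_eq0 leqNgt NK mulr0 mul0r mulr0.
move=> z z1; rewrite horner_sum; apply: eq_bigr => k _.
rewrite hornerZ !hornerM hornerC horner_exp hornerD hornerM !hornerC hornerX
  horner_comp !hornerXn.
have zN : z ^+ K = z ^+ (K - N) * z ^+ N by rewrite -exprD subnK// ltnW.
have -> : (p k).[z ^+ K] - (p k).[0] = (q k).[z ^+ K] * z ^+ K.
  by rewrite {1}(qE k) hornerD hornerC hornerM hornerX addrC addKr.
rewrite [in X in _ = _ * (_ * X)]zN.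
have /= wE := weightE k NK z1.
transitivity (z ^+ (K - N) * (q k).[z ^+ K] * (z ^+ N * (weight K N k z)%:C)).
  by rewrite wE; ring.
ring.
Qed.

Lemma normc_shift (v o a : R[i]) (A B : R) :
  normc (v - a) <= A -> normc o <= B -> normc (v + o - a) <= A + B.
Proof. by move=> va oB; rewrite addrAC (le_trans (normcD _ _))// lerD. Qed.

Lemma normc_expi_sub1 (d : R) : normc (expi d - 1) ^+ 2 = 2 - 2 * cos d.
Proof. by have := normc_expiB2 d 0; rewrite expi0 subr0. Qed.

Lemma normc_expi_far (s t d : R) : 0 <= d -> d <= `|s - t| -> `|s - t| <= 2 * pi - d ->
  normc (expi d - 1) <= normc (expi s - expi t).
Proof.
move=> d0 dst std; rewrite -(@ler_pXn2r _ 2)// ?nnegrE ?normc_ge0//.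
rewrite normc_expi_sub1 normc_expiB2.
have := cos_le_of_dist d0 dst std; rewrite cos_norm; lra.
Qed.

Lemma angle_far (b s t k l K : R) : 0 < s ->
  l * s <= t -> t < (l + 1) * s -> 0 <= b ->
  (k + b <= l /\ l + 1 + b <= K + k) \/ (l + 1 + b <= k /\ k + b <= K + l) ->
  b * s <= `|t - k * s| /\ `|t - k * s| <= K * s - b * s.
Proof.
move=> s0 lt tl b0 kl.
have bs : 0 <= b * s by rewrite mulr_ge0// ltW.
case: kl => [[h1 h2]|[h1 h2]].
  have e1 : (k + b) * s <= l * s by rewrite ler_pM2r.
  have e2 : (l + 1 + b) * s <= (K + k) * s by rewrite ler_pM2r.
  rewrite !mulrDl mul1r in e1 e2 tl.
  by rewrite ger0_norm; [split; lra|lra].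
have e1 : (l + 1 + b) * s <= k * s by rewrite ler_pM2r.
have e2 : (k + b) * s <= (K + l) * s by rewrite ler_pM2r.
rewrite !mulrDl mul1r in e1 e2 tl.
by rewrite ler0_norm; [split; lra|lra].
Qed.

(** In both cases k is at least d steps away from the cell l on the cyclic grid;
    the first has k < l, the second k > l when d > 0. *)
Lemma grid_far (K k l d : nat) (t : R) : (0 < K)%N -> cell K l t ->
  ((k + d <= l)%N /\ (l.+1 + d <= K + k)%N) \/
    ((l.+1 + d <= k)%N /\ (k + d <= K + l)%N) ->
  normc (expi (d%:R * (2 * pi / K%:R)) - 1) <= normc (expi t - grid R K k).
Proof.
move=> K0 tl kl; have KR : 0 < K%:R :> R by rewrite ltr0n.
have s0 : 0 < 2 * pi / K%:R :> R by rewrite divr_gt0// (@pi2_gt0 R).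
have Ks : K%:R * (2 * pi / K%:R) = 2 * pi :> R by field; rewrite gt_eqF.
have : l%:R * (2 * pi / K%:R) <= t /\ t < (l%:R + 1) * (2 * pi / K%:R).
  have /andP : (l%:R * (2 * pi / K%:R) <= t) && (t < l.+1%:R * (2 * pi / K%:R)) := tl.
  by rewrite natr1.
move=> [lt tl'].
have {kl} kl : (k%:R + d%:R <= l%:R :> R /\ l%:R + 1 + d%:R <= K%:R + k%:R :> R) \/
   (l%:R + 1 + d%:R <= k%:R :> R /\ k%:R + d%:R <= K%:R + l%:R :> R).
  by rewrite natr1 -!natrD !ler_nat.
have [d1 d2] := angle_far s0 lt tl' (ler0n R d) kl.
by rewrite Ks in d2; apply: normc_expi_far => //; rewrite mulr_ge0// ltW.
Qed.

End Glueing.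

Section GluedDisc.
Variables (R : realType) (n : nat).
Notation mu := (@lebesgue_measure R).
Variables (c b x : 'rV[R[i]]_n) (rho r m : R) (U : set 'rV[R[i]]_n).
Variables (M : nat) (tt : nat -> R) (P : nat -> 'rV[{poly R[i]}]_n).
Hypotheses (rho0 : 0 < rho) (m0 : 0 < m) (M0 : (0 < M)%N).
Hypothesis ttM : forall j, (j < M)%N -> cell M j (tt j).
Hypothesis P0 : forall j, (j < M)%N ->
  eval (P j) 0 = c + (rho%:C * expi (tt j)) *: b.
Hypothesis Px : forall j t, (j < M)%N ->
  closed_polydisc x (r - m) (eval (P j) (expi t)).
Hypothesis bM : forall i, rho * normc (b 0 i) * (2 * (2 * pi / M%:R)) <= m / 4.

(** The disc is c + rho z b plus the weighted corrections P_j(z^K) - P_j(0),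
    which vanish at 0.  Here K = M q, and the grid point k belongs to the block
    j = k / q.  Since the weights sum to 1, on the circle this is an average of
    the P_j(z^K) with an offset that is small when k is near z. *)
Lemma glued_disc (q N : nat) : (0 < q)%N -> (N < M * q)%N ->
  exists2 F : 'rV[{poly R[i]}]_n, eval F 0 = c &
  forall z i, normc z = 1 -> eval F z 0 i =
    \sum_(k < M * q) (weight (M * q) N k z)%:C *
      (eval (P (k %/ q)) (z ^+ (M * q)) 0 i +
       rho%:C * (z - expi (tt (k %/ q))) * b 0 i).
Proof.
move=> q0 NK.
have [G GP] := choice (fun i =>
  weighted_polynomial (fun k => P (k %/ q)%N 0 i) NK).
exists (\row_i ((c 0 i)%:P + (rho%:C * b 0 i) *: 'X + G i)).
  apply/rowP => i; rewrite !mxE !hornerE; have [-> _] := GP i.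
  by rewrite !addr0.
move=> z i z1; rewrite !mxE !hornerE; have [_ GE] := GP i; rewrite GE//.
have -> : c 0 i + rho%:C * b 0 i * z = \sum_(k < M * q)
    (weight (M * q) N k z)%:C * (c 0 i + rho%:C * b 0 i * z).
  by rewrite -mulr_suml -rmorph_sum /= sum_weight// [1%:C]rmorph1 mul1r.
rewrite -big_split /=; apply: eq_bigr => k _; rewrite -mulrDr; congr (_ * _).
have kM : (k %/ q < M)%N by rewrite ltn_divLR.
have -> : (P (k %/ q)%N 0 i).[0] = c 0 i + rho%:C * expi (tt (k %/ q)) * b 0 i.
  by have := P0 kM => /(congr1 (fun v : 'rV_n => v 0 i)); rewrite !mxE.
rewrite mxE; ring.
Qed.

(** A grid point of block j and the argument tt j lie in the same cell of
    length 2 pi / M. *)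
Lemma block_offset (z : R[i]) (q k : nat) (i : 'I_n) : (0 < q)%N -> (k < M * q)%N ->
  normc z = 1 ->
  normc (rho%:C * (z - expi (tt (k %/ q))) * b 0 i) <= 2 * rho * normc (b 0 i) /\
  (normc (z - grid R (M * q) k) <= 2 * pi / M%:R ->
   normc (rho%:C * (z - expi (tt (k %/ q))) * b 0 i) <= m / 4).
Proof.
move=> q0 kMq z1; have kM : (k %/ q < M)%N by rewrite ltn_divLR.
rewrite !normcM normc_real gtr0_norm//.
have rb : 0 <= rho * normc (b 0 i) by rewrite mulr_ge0 ?normc_ge0// ltW.
have [MR qR] : 0 < M%:R :> R /\ 0 < q%:R :> R by rewrite !ltr0n.
split.
  have := normcD z (- expi (tt (k %/ q)%N)); rewrite normc_opp z1 normc_expi => h.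
  have := ler_wpM2l rb h; lra.
move=> zg; apply: le_trans (bM i).
rewrite mulrAC ler_wpM2l//.
apply: le_trans (normc_distD (grid R (M * q) k) _ _) _.
suff : normc (grid R (M * q) k - expi (tt (k %/ q)%N)) <= 2 * pi / M%:R by lra.
apply: le_trans (expi_lipschitz _ _) _.
have /andP[] : ((k %/ q)%:R * (2 * pi / M%:R) <= tt (k %/ q)) &&
  (tt (k %/ q)%N < (k %/ q).+1%:R * (2 * pi / M%:R)) := ttM kM.
have s0 : 0 < 2 * pi / M%:R :> R by rewrite divr_gt0// (@pi2_gt0 R).
have -> : k%:R * (2 * pi / (M * q)%:R) = k%:R / q%:R * (2 * pi / M%:R) :> R.
  by rewrite natrM; field; rewrite !gt_eqF.
have h1 : (k %/ q)%:R <= k%:R / q%:R :> R.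
  by rewrite ler_pdivlMr// -natrM ler_nat leq_trunc_div.
have h2 : k%:R / q%:R <= (k %/ q).+1%:R :> R.
  by rewrite ler_pdivrMr// -natrM ler_nat ltnW// ltn_ceil.
have := ler_wpM2r (ltW s0) h1; have := ler_wpM2r (ltW s0) h2.
rewrite -[(k %/ q).+1%:R]natr1 !(mulrDl _ _ (2 * pi / _)) mul1r.
move: ((k %/ q)%:R * _) (k%:R / _ * _) => A B.
move=> ? ? ? ?; rewrite ler_norml; apply/andP; split; lra.
Qed.

Variables (q d N : nat) (F : 'rV[{poly R[i]}]_n) (eta : R).
Hypotheses (q0 : (0 < q)%N) (dq : (d <= q)%N) (NK : (N < M * q)%N).
Hypothesis FE : forall z i, normc z = 1 -> eval F z 0 i =
    \sum_(k < M * q) (weight (M * q) N k z)%:C *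
      (eval (P (k %/ q)) (z ^+ (M * q)) 0 i +
       rho%:C * (z - expi (tt (k %/ q))) * b 0 i).
(** The chord of d grid steps. *)
Let width : R := normc (expi (d%:R * (2 * pi / (M * q)%:R)) - 1).
Hypothesis etaN : (N + N).+1%:R * (1 - width ^+ 2 / 4) ^+ N <= eta.
Hypothesis eta_m : forall i, eta * (2 * `|r| + 2 * rho * normc (b 0 i)) <= m / 4.

Let far (z : R[i]) : pred nat := fun k => width <= normc (z - grid R (M * q) k).

Lemma width_bounds : 0 <= width /\ width <= 2 /\ width <= 2 * pi / M%:R.
Proof.
have [MR qR] : 0 < M%:R :> R /\ 0 < q%:R :> R by rewrite !ltr0n.
split; first exact: normc_ge0.
split.
  rewrite /width -expi0; apply: le_trans (normcD _ _) _.
  by rewrite normc_opp !normc_expi.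
rewrite /width -expi0; apply: le_trans (expi_lipschitz _ _) _.
have p0 : 0 <= 2 * pi / M%:R :> R by rewrite divr_ge0// ltW// (@pi2_gt0 R).
have -> : d%:R * (2 * pi / (M * q)%:R) - 0 = d%:R / q%:R * (2 * pi / M%:R) :> R.
  by rewrite natrM subr0; field; rewrite !gt_eqF.
rewrite ger0_norm; last by rewrite mulr_ge0// divr_ge0.
by rewrite -[leRHS]mul1r ler_wpM2r// ler_pdivrMr// mul1r ler_nat.
Qed.

Lemma sum_far (z : R[i]) : normc z = 1 ->
  \sum_(k < M * q | far z k) weight (M * q) N k z <= eta.
Proof.
move=> z1; apply: le_trans etaN; apply: sum_weight_far => //.
by have [-> [-> _]] := width_bounds.
Qed.

Lemma near_offset z k i : (k < M * q)%N -> normc z = 1 -> ~~ far z k ->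
  normc (rho%:C * (z - expi (tt (k %/ q))) * b 0 i) <= m / 4.
Proof.
move=> kM z1; rewrite -ltNge => zk.
have [_] := block_offset i q0 kM z1; apply.
by have [_ [_]] := width_bounds; apply: le_trans; exact: ltW.
Qed.

Lemma far_offset z k i : (k < M * q)%N -> normc z = 1 ->
  normc (rho%:C * (z - expi (tt (k %/ q))) * b 0 i) <= 2 * rho * normc (b 0 i).
Proof. by move=> kM z1; have [] := block_offset i q0 kM z1. Qed.

Lemma block_polydisc t k : (k < M * q)%N ->
  closed_polydisc x (r - m) (eval (P (k %/ q)) (expi t ^+ (M * q))).
Proof. by move=> kM; rewrite -expi_natmul; apply: Px; rewrite ltn_divLR. Qed.

Lemma eta_ge0 : 0 <= eta.
Proof.
apply: le_trans (sum_far (normc_expi 0)); apply: sumr_ge0 => k _.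
exact: weight_ge0.
Qed.

Lemma eta_offset i B : B <= 2 * `|r| + 2 * rho * normc (b 0 i) -> eta * B <= m / 4.
Proof. by move=> h; apply: le_trans (eta_m i); rewrite ler_wpM2l// eta_ge0. Qed.

(** The point a will be the centre of the ambient polydisc or a point of one of
    the discs. *)
Lemma glued_close t i (a : R[i]) (A : R) :
  (forall k, (k < M * q)%N ->
    normc (eval (P (k %/ q)) (expi t ^+ (M * q)) 0 i - a) <= A + 2 * `|r|) ->
  (forall k, (k < M * q)%N -> ~~ far (expi t) k ->
    normc (eval (P (k %/ q)) (expi t ^+ (M * q)) 0 i - a) <= A) ->
  normc (eval F (expi t) 0 i - a) <= A + m / 2.
Proof.
move=> hfar hnear; have t1 := normc_expi t.
have rb : 0 <= 2 * rho * normc (b 0 i).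
  by rewrite mulr_ge0 ?normc_ge0// mulr_ge0// ltW.
have r0 := normr_ge0 r.
rewrite FE//; apply: (@le_trans _ _ (A + m / 4 +
    eta * (2 * `|r| + 2 * rho * normc (b 0 i)))); last first.
  have := eta_offset (lexx (2 * `|r| + 2 * rho * normc (b 0 i))); lra.
have [M_ [N_ w_]] := (q0, (NK, sum_far t1)).
apply: (weighted_average_close (w := fun k => weight (M * q) N k (expi t))
  (v := fun k => eval (P (k %/ q)) (expi t ^+ (M * q)) 0 i +
       rho%:C * (expi t - expi (tt (k %/ q))) * b 0 i) _ _ w_).
- by move=> k; exact: weight_ge0.
- exact: sum_weight.
- by apply: addr_ge0 => //; lra.
- move=> k kM nf; have := hnear _ kM nf; have := near_offset i kM t1 nf.
  set v := eval _ _ 0 i; set o := _ * b 0 i => ho hv.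
  exact: normc_shift hv ho.
- move=> k kM _; have := hfar _ kM; have := far_offset i kM t1.
  set v := eval _ _ 0 i; set o := _ * b 0 i => ho hv.
  apply: le_trans (normc_shift hv ho) _.
  by rewrite addrA lerD2r lerD2r lerDl ltW// divr_gt0.
Qed.

Lemma glued_in_polydisc t : closed_polydisc x (r - m / 2) (eval F (expi t)).
Proof.
move=> i; have -> : r - m / 2 = r - m + m / 2 by lra.
apply: glued_close => k kM; last by move=> _; exact: block_polydisc.
by apply: le_trans (block_polydisc _ kM i) _; have := normr_ge0 r; lra.
Qed.

(** The cell is at least d steps away from both ends of the block j, and a near
    grid point is less than d steps away from the cell. *)
Lemma same_block (j p k : nat) t : (j < M)%N -> (d <= p)%N -> (p + d < q)%N ->
  (k < M * q)%N -> cell (M * q) (j * q + p) t -> ~~ far (expi t) k -> (k %/ q)%N = j.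
Proof.
move=> jM dp pq kM tc; apply: contraNeq => kj.
apply: (grid_far _ tc); first by rewrite muln_gt0 M0.
have jq : (j.+1 * q <= M * q)%N by rewrite leq_mul2r jM orbT.
rewrite mulSn in jq.
have e1 := divn_eq k q; have e2 := ltn_pmod k q0.
move: kj; rewrite neq_ltn => /orP[kj|jk].
  have : ((k %/ q).+1 * q <= j * q)%N by rewrite leq_mul2r kj orbT.
  by rewrite mulSn => ?; left; lia.
have : (j.+1 * q <= (k %/ q) * q)%N by rewrite leq_mul2r jk orbT.
by rewrite mulSn => ?; right; lia.
Qed.

Lemma glued_robust (j p : nat) t : (j < M)%N -> (d <= p)%N -> (p + d < q)%N ->
  cell (M * q) (j * q + p) t -> robust_args U m (P j) ((M * q)%:R * t) ->
  robust_args U (m / 2) F t.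
Proof.
move=> jM dp pq tc rob y yF; apply: rob => i.
rewrite expi_natmul.
suff : normc (eval F (expi t) 0 i - eval (P j) (expi t ^+ (M * q)) 0 i) <= 0 + m / 2.
  have := yF i; have := normc_distD (eval F (expi t) 0 i) (y 0 i)
    (eval (P j) (expi t ^+ (M * q)) 0 i); lra.
have jP : closed_polydisc x (r - m) (eval (P j) (expi t ^+ (M * q))).
  by rewrite -expi_natmul; exact: Px.
apply: glued_close => k kM; last first.
  by move=> nf; rewrite (same_block jM dp pq kM tc nf) subrr normc0.
have := block_polydisc t kM i; have := jP i; have := ler_norm r.
have := normc_distD (x 0 i) (eval (P (k %/ q)) (expi t ^+ (M * q)) 0 i)
  (eval (P j) (expi t ^+ (M * q)) 0 i).
rewrite [normc (x 0 i - _)]normc_distC add0r => h rr h1 h2.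
have rm : r - m <= `|r| by apply: le_trans rr; rewrite gerBl ltW.
by apply: le_trans h _; rewrite mulrDl mul1r lerD// (le_trans _ rm).
Qed.

Let K := (M * q)%N.
Let share k : \bar R := mu (cell K k `&` robust_args U (m / 2) F).

Lemma K_gt0 : (0 < K)%N. Proof. by rewrite muln_gt0 M0. Qed.

Lemma measurable_share k : measurable (cell K k `&` robust_args U (m / 2) F).
Proof.
apply: measurableI; [exact: measurable_cell|exact: measurable_robust_args].
Qed.

Lemma share_fin k : share k \is a fin_num.
Proof.
rewrite ge0_fin_numE ?measure_ge0//.
apply: (@le_lt_trans _ _ (mu (cell K k))).
  apply: le_measure; rewrite ?inE; [exact: measurable_share|exact: measurable_cell|].
  exact: subIsetl.
by rewrite measure_cell ?K_gt0// ltry.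
Qed.

Lemma share_ge0 k : 0 <= fine (share k).
Proof. by rewrite fine_ge0// measure_ge0. Qed.

Lemma good_share (j p : nat) : (j < M)%N -> (d <= p)%N -> (p + d < q)%N ->
  K%:R^-1 * fine (score U m (P j)) <= fine (share (j * q + p)).
Proof.
move=> jM dp pq.
rewrite -lee_fin EFinM (fineK (score_fin _ _ _)) (fineK (share_fin _)).
have mB := measurable_robust_args U m (P j).
rewrite -(measure_cell_wrap (j * q + p) K_gt0 mB); last first.
  exact: robust_args_periodic.
apply: le_measure; rewrite ?inE; last 2 first.
- exact: measurable_share.
- by move=> t [tc rob]; split => //; exact: (glued_robust jM dp pq tc rob).
apply: measurableI; first exact: measurable_cell.
have mK : measurable_fun setT (fun t : R => K%:R * t).
  apply: continuous_measurable_fun.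
  by move=> t; apply: cvgM; [exact: cvg_cst|exact: cvg_id].
by rewrite -[X in measurable X]setTI; exact: (mK measurableT _ mB).
Qed.

(** On a cell at least d steps away from both ends of the block j the glued disc
    follows P_j(z^K), which goes once around the circle, so the cell contributes
    1 / K of the score of P_j.  In each block at most 2 d of the q cells are
    lost. *)
Lemma glued_score :
  \sum_(j < M) M%:R^-1 * fine (score U m (P j)) <=
  fine (score U (m / 2) F) + 4 * pi * (d%:R / q%:R).
Proof.
have KR : 0 < K%:R :> R by rewrite ltr0n K_gt0.
have [MR qR] : 0 < M%:R :> R /\ 0 < q%:R :> R by rewrite !ltr0n.
have mRA := measurable_robust_args U (m / 2) F.
have -> : fine (score U (m / 2) F) = \sum_(k < K) fine (share k).
  rewrite /score (turn_cells K_gt0 mRA) sum_fine// => k _.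
  exact: share_fin.
rewrite (sum_blocks M q (fun k => fine (share k))).
pose bad (p : nat) := ((p < d) + (q - d <= p))%N.
have step j : (j < M)%N -> M%:R^-1 * fine (score U m (P j)) <=
    \sum_(p < q) (fine (share (j * q + p)) + K%:R^-1 * (2 * pi) * (bad p)%:R).
  move=> jM; have -> : M%:R^-1 * fine (score U m (P j)) =
      \sum_(p < q) K%:R^-1 * fine (score U m (P j)).
    rewrite sumr_const card_ord -mulr_natr /K natrM; field.
    by rewrite !gt_eqF.
  apply: ler_sum => p _.
  have [h|h] := boolP ((d <= p)%N && (p + d < q)%N).
    have /andP[dp pq] := h.
    apply: le_trans (good_share jM dp pq) _; rewrite lerDl.
    by rewrite !mulr_ge0// ?invr_ge0 ?ler0n// pi_ge0.
  have b1 : (1 <= bad p)%N.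
    by move: h; rewrite /bad; case: (ltnP p d); case: (leqP (q - d) p); lia.
  apply: (@le_trans _ _ (K%:R^-1 * (2 * pi) * (bad p)%:R)).
    rewrite -mulrA ler_wpM2l ?invr_ge0 ?ler0n//.
    apply: (@le_trans _ _ (2 * pi)).
      by rewrite -lee_fin fineK ?score_fin// score_le.
    by rewrite ler_peMr ?ler1n// ltW// (@pi2_gt0 R).
  by rewrite lerDr share_ge0.
apply: (@le_trans _ _ (\sum_(j < M) \sum_(p < q)
    (fine (share (j * q + p)) + K%:R^-1 * (2 * pi) * (bad p)%:R))).
  by apply: ler_sum => j _; exact: step.
under eq_bigr do rewrite big_split /=.
rewrite big_split /= lerD2l sumr_const card_ord -mulr_sumr -natr_sum.
have badq : (\sum_(p < q) bad p <= d + d)%N.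
  by rewrite big_split /= leq_add// ?count_ord_lt ?count_ord_ge.
rewrite -[leLHS]mulr_natr; apply: (@le_trans _ _ (K%:R^-1 * (2 * pi) * (d + d)%:R * M%:R)).
  rewrite ler_wpM2r ?ler0n// ler_wpM2l ?ler_nat//.
  by rewrite mulr_ge0 ?invr_ge0 ?ler0n// ltW// (@pi2_gt0 R).
rewrite le_eqVlt; apply/orP; left; apply/eqP.
by rewrite /K natrM natrD; field; rewrite !gt_eqF.
Qed.

End GluedDisc.

Section Glue.
Variables (R : realType) (n : nat).

(** The glued disc follows one of the P_j(z^K) except near the ends of the
    blocks, where it mixes two of them and nothing is known about U; the ends
    are made short. *)
Lemma glue_discs (c b x : 'rV[R[i]]_n) (rho r m e : R) (U : set 'rV[R[i]]_n)
    (M : nat) (tt : nat -> R) (P : nat -> 'rV[{poly R[i]}]_n) :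
  0 < rho -> 0 < m -> 0 < e -> (0 < M)%N ->
  (forall j, (j < M)%N -> cell M j (tt j)) ->
  (forall j, (j < M)%N -> admissible x r m (c + (rho%:C * expi (tt j)) *: b) (P j)) ->
  (forall i, rho * normc (b 0 i) * (2 * (2 * pi / M%:R)) <= m / 4) ->
  exists2 F, admissible x r (m / 2) c F &
    \sum_(j < M) M%:R^-1 * fine (score U m (P j)) <= fine (score U (m / 2) F) + e.
Proof.
move=> rho0 m0 e0 M0 ttM Padm bM.
have P0 j : (j < M)%N -> eval (P j) 0 = c + (rho%:C * expi (tt j)) *: b.
  by move=> jM; have [] := Padm j jM.
have Px j t : (j < M)%N -> closed_polydisc x (r - m) (eval (P j) (expi t)).
  by move=> jM; have [_] := Padm j jM; apply.
have [D0 D0P] := large_denominator (4 * pi) e0.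
(* D makes the loss at the ends of the blocks small and fixes the angular
   width of the kernel; then N makes the far weights small.  As q = D d, the
   width does not depend on d, and d > N ensures that M q > N. *)
pose D := D0.+3.
have DP : 4 * pi / D%:R <= e by apply: D0P => //; rewrite /D; lia.
have DR : 0 < D%:R :> R by rewrite ltr0n.
have MR : 0 < M%:R :> R by rewrite ltr0n.
have p0 := @pi_gt0 R.
pose delta : R := 2 * pi / (M * D)%:R.
pose width := normc (expi delta - 1).
have delta0 : 0 < delta by rewrite divr_gt0 ?(@pi2_gt0 R)// ltr0n muln_gt0 M0.
have deltapi : delta < pi.
  rewrite /delta ltr_pdivrMr ?ltr0n ?muln_gt0 ?M0// mulrC ltr_pM2l//.
  by rewrite (ltr_nat _ 2) (leq_trans _ (leq_pmull _ M0)).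
have width0 : 0 < width.
  rewrite lt_def normc_ge0 andbT /width normc_eq0 subr_eq0; apply/eqP => d1.
  have := congr1 (@complex.Im R) d1; rewrite /= => sin0.
  by have := @sin_gt0_pi R delta; rewrite sin0 ltxx delta0 deltapi => /(_ isT).
have width2 : width <= 2.
  by rewrite /width -expi0 (le_trans (normcD _ _))// normc_opp !normc_expi.
pose B := \sum_i normc (b 0 i).
have bB i : normc (b 0 i) <= B.
  by rewrite /B (bigD1 i)//= lerDl sumr_ge0// => k _; exact: normc_ge0.
have B0 : 0 <= B by rewrite sumr_ge0// => k _; exact: normc_ge0.
pose S := 2 * `|r| + 2 * rho * B + 1.
have S0 : 0 < S.
  have h1 := normr_ge0 r; have h2 : 0 <= rho * B by rewrite mulr_ge0// ltW.
  by rewrite /S -mulrA; lra.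
pose eta := m / (4 * S).
have eta0 : 0 < eta by rewrite divr_gt0// mulr_gt0.
have eta_m i : eta * (2 * `|r| + 2 * rho * normc (b 0 i)) <= m / 4.
  have -> : m / 4 = eta * S by rewrite /eta; field; rewrite gt_eqF.
  rewrite ler_wpM2l ?(ltW eta0)// /S -addrA lerD2l -!mulrA ler_wpDr//.
  by rewrite !ler_pM2l.
have [|N NP] := @polynomial_geometric_small R (1 - width ^+ 2 / 4) eta _ eta0.
  have w2 : 0 < width ^+ 2 by rewrite exprn_gt0.
  have w4 : width ^+ 2 <= 2 ^+ 2 by rewrite lerXn2r// nnegrE ?(ltW width0).
  by apply/andP; split; lra.
pose d := N.+1; pose q := (D * d)%N.
have q0 : (0 < q)%N by rewrite muln_gt0.
have dq : (d <= q)%N by rewrite leq_pmull.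
have NK : (N < M * q)%N by rewrite (leq_trans dq)// leq_pmull.
have deltaE : d%:R * (2 * pi / (M * q)%:R) = delta :> R.
  by rewrite /delta /q !natrM; field; rewrite !gt_eqF// ltr0n.
have [F F0 FE] := glued_disc P0 q0 NK.
have etaN : (N + N).+1%:R *
    (1 - normc (expi (d%:R * (2 * pi / (M * q)%:R)) - 1) ^+ 2 / 4) ^+ N <= eta.
  by rewrite deltaE.
exists F.
  split => // t.
  exact: (glued_in_polydisc rho0 m0 M0 ttM Px bM q0 dq NK FE etaN eta_m).
have := glued_score U rho0 m0 M0 ttM Px bM q0 dq NK FE etaN eta_m.
move=> /le_trans; apply; rewrite lerD2l (le_trans _ DP)//.
rewrite le_eqVlt; apply/orP; left; apply/eqP.
by rewrite /q natrM; field; rewrite !gt_eqF// ltr0n.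
Qed.

End Glue.

(** * The envelope of discs is plurisubharmonic *)

Lemma aligned_direction (R : realType) (v w : R[i]) :
  exists2 z : R[i], normc z = 1 & normc (v + z * w) = normc v + normc w.
Proof.
have [->|v0] := eqVneq v 0.
  by exists 1; [exact: normc1|rewrite normc0 add0r mul1r add0r].
have [->|w0] := eqVneq w 0.
  by exists 1; [exact: normc1|rewrite normc0 mulr0 !addr0].
have nv : normc v != 0 by rewrite normc_eq0.
have nw : normc w != 0 by rewrite normc_eq0.
have rv : 0 < normc v by rewrite lt_def nv normc_ge0.
have rw : 0 < normc w by rewrite lt_def nw normc_ge0.
exists ((normc w / normc v)%:C * v / w).
  by rewrite !normcM normcV normc_real ger0_norm ?divr_ge0 ?normc_ge0//; field; rewrite nv nw.
rewrite divfK// -[X in normc (X + _)]mul1r -mulrDl -[1]/(1%:C) -rmorphD /=.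
rewrite normcM normc_real ger0_norm ?addr_ge0 ?divr_ge0 ?normc_ge0//.
by field.
Qed.

Lemma line_close (R : realType) (n : nat) (b : 'rV[R[i]]_n) (k : R) : 0 < k -> exists2 d : R, 0 < d &
  forall l : R[i], normc l <= d -> forall i, normc (l * b 0 i) <= k.
Proof.
move=> k0; have [|d d0 dP] := @uniform_radius R n (fun i d => d * normc (b 0 i) <= k).
  move=> i; have B1 : 0 < normc (b 0 i) + 1 by rewrite ltr_wpDl ?normc_ge0.
  exists (k / (normc (b 0 i) + 1)); first exact: divr_gt0.
  move=> e /andP[e0]; rewrite ler_pdivlMr//; apply: le_trans.
  by rewrite ler_wpM2l ?(ltW e0)// lerDl.
exists d => // l ld i; rewrite normcM.
apply: le_trans (dP i d _); last by rewrite d0 lexx.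
by rewrite ler_wpM2r ?normc_ge0.
Qed.

Section Envelope.
Variables (R : realType) (n : nat).
Notation mu := (@lebesgue_measure R).
Variables (x : 'rV[R[i]]_n) (r : R) (U : set 'rV[R[i]]_n).

(** The supremum of Poletsky's disc functional for the indicator of U, over
    discs with a margin larger than s. *)
Definition envelope (s : R) (z : 'rV[R[i]]_n) : \bar R :=
  ereal_sup [set a | exists m P, [/\ s < m, admissible x r m z P & a = score U m P]].

Lemma envelope_ge s m z P : s < m -> admissible x r m z P ->
  (score U m P <= envelope s z)%E.
Proof. by move=> sm Pz; apply: ereal_sup_ubound; exists m, P. Qed.

Lemma envelope_gt s z a : (a < envelope s z)%E ->
  exists m P, [/\ s < m, admissible x r m z P & (a < score U m P)%E].
Proof. by move=> /ereal_sup_gt[_ [m [P [sm Pz ->]]] aP]; exists m, P. Qed.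

Lemma envelope_le s z : (envelope s z <= (2 * pi)%:E)%E.
Proof. by apply: ge_ereal_sup => _ [m [P [_ _ ->]]]; exact: score_le. Qed.

Lemma envelope_ge0 s m z : s < m -> closed_polydisc x (r - m) z -> (0 <= envelope s z)%E.
Proof.
by move=> sm /admissible_const/(envelope_ge sm); apply: le_trans; exact: score_ge0.
Qed.

Lemma envelope_mono s s' z : s <= s' -> (envelope s' z <= envelope s z)%E.
Proof.
move=> ss; apply: ge_ereal_sup => _ [m [P [sm Pz ->]]].
by apply: envelope_ge Pz; exact: le_lt_trans sm.
Qed.

(** Translating a disc moves its centre and costs only room in the margin. *)
Lemma envelope_lsc s z a : (a < envelope s z)%E -> exists2 k : R, 0 < k &
  forall z', closed_polydisc z k z' -> (a < envelope s z')%E.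
Proof.
move=> /envelope_gt[m [P [sm Pz aP]]]; exists ((m - s) / 2).
  by rewrite divr_gt0// subr_gt0.
move=> z' zz'; pose v := z' - z.
have vk i : normc (v 0 i) <= (m - s) / 2 by rewrite !mxE; exact: zz'.
have Pv := admissible_translate vk Pz; rewrite (addrC z) subrK in Pv.
apply: lt_le_trans aP _; apply: le_trans (score_translate U m P vk) _.
apply: envelope_ge Pv; lra.
Qed.

Section Circle.
Variables (c b : 'rV[R[i]]_n) (rho s0 : R).
Hypotheses (rho0 : 0 < rho) (s0_gt0 : 0 < s0).
Let h (t : R) := c + (rho%:C * expi t) *: b.
Hypothesis hm : forall i, normc (c 0 i - x 0 i) + rho * normc (b 0 i) <= r - s0.

Lemma circle_in_polydisc t : closed_polydisc x (r - s0) (h t).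
Proof.
move=> i; apply: le_trans (hm i); rewrite !mxE addrAC.
apply: le_trans (normcD _ _) _.
by rewrite lerD2l !normcM normc_real gtr0_norm// normc_expi mulr1.
Qed.

Lemma centre_in_polydisc : closed_polydisc x (r - s0) c.
Proof.
move=> i; apply: le_trans (hm i).
by rewrite lerDl mulr_ge0 ?normc_ge0// ltW.
Qed.

Lemma envelope_circle_ge0 s t : s < s0 -> (0 <= envelope s (h t))%E.
Proof. by move=> ss0; exact: envelope_ge0 ss0 (circle_in_polydisc t). Qed.

Lemma measurable_envelope_circle s : measurable_fun setT (fun t : R => envelope s (h t)).
Proof.
apply: lower_semicontinuous_measurable => t a.
move=> /envelope_lsc[k k0 kP].
have [d d0 dP] := line_close b k0.
exists (ball t (d / rho)); first by apply: nbhsx_ballx; exact: divr_gt0.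
move=> t'; rewrite -ball_normE /= => tt'; apply: kP => i.
rewrite !mxE opprD addrACA subrr add0r -mulrBl -mulrBr.
apply: dP; rewrite normcM normc_real gtr0_norm// mulrC -ler_pdivlMr//.
by apply: le_trans (expi_lipschitz _ _) _; rewrite distrC ltW.
Qed.

(** Otherwise the envelope would stay below its own average over the cell. *)
Lemma cell_choice L k s e : (0 < L)%N -> (k < L)%N -> 0 < e -> s < s0 ->
  exists t P, [/\ cell L k t, admissible x r s (h t) P &
   (\int[mu]_(u in cell L k) envelope s (h u) <=
     ((2 * pi / L%:R) * (fine (score U s P) + e))%:E)%E].
Proof.
move=> L0 kL e0 ss0; set I := (integral _ _ _).
have w0 : 0 < 2 * pi / L%:R :> R by rewrite divr_gt0 ?pi2_gt0 ?ltr0n.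
apply/not_existsP => no.
have bound a : (forall t, cell L k t -> (envelope s (h t) <= a%:E)%E) ->
    (I <= ((2 * pi / L%:R) * a)%:E)%E.
  move=> ha; apply: le_trans (le_integral_any mu ha) _.
  have mk := @measurable_cell R L k.
  have -> : (\int[mu]_(_ in cell L k) a%:E = a%:E * mu (cell L k))%E.
    exact: integral_cst.
  by rewrite measure_cell// -EFinM [(a * _)%R]mulrC.
have I0 : (0 <= I)%E by apply: integral_ge0 => t _; exact: envelope_circle_ge0.
have Ifin : I \is a fin_num.
  rewrite ge0_fin_numE// (le_lt_trans (bound (2 * pi) _)) ?ltry// => t _.
  exact: envelope_le.
have : (I <= ((2 * pi / L%:R) * (fine I / (2 * pi / L%:R) - e))%:E)%E.
  apply: bound => t tk; apply: ge_ereal_sup => _ [m [P [sm Pt ->]]].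
  have Ps := admissible_mono (ltW sm) Pt.
  apply: le_trans (score_mono U P (ltW sm)) _.
  rewrite -(fineK (score_fin U s P)) lee_fin lerBrDr ler_pdivlMr//.
  rewrite leNgt; apply/negP => lt; apply: (no t); exists P; split => //.
  by rewrite -(fineK Ifin) lee_fin mulrC ltW.
rewrite -(fineK Ifin) lee_fin mulrBr mulrCA divff ?gt_eqF// mulr1.
by rewrite lerBrDr gerDl leNgt mulr_gt0.
Qed.

(** Discs chosen in M cells of the circle are glued.  How large M has to be
    depends on their common margin, so s is fixed before M and is positive. *)
Lemma integral_envelope_margin s : 0 < s -> s < s0 ->
  (\int[mu]_(t in @turn R) envelope s (h t) <= (2 * pi)%:E * envelope 0 c)%E.
Proof.
move=> s_gt0 ss0; have p0 := @pi2_gt0 R.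
have c0 : (0 <= envelope 0 c)%E := envelope_ge0 s0_gt0 centre_in_polydisc.
have cfin : envelope 0 c \is a fin_num.
  by rewrite ge0_fin_numE// (le_lt_trans (envelope_le _ _))// ltry.
rewrite -(fineK cfin) -EFinM; apply/lee_addgt0Pr => e e0.
(* one share for the choice in the cells, one for the gluing *)
pose e1 := e / (2 * (2 * pi)).
have e1_gt0 : 0 < e1 by rewrite divr_gt0// mulr_gt0.
pose B := \sum_i normc (b 0 i).
have bB i : normc (b 0 i) <= B.
  by rewrite /B (bigD1 i)//= lerDl sumr_ge0// => k _; exact: normc_ge0.
have s4 : 0 < s / 4 by rewrite divr_gt0.
have [M0 M0P] := large_denominator (rho * B * (4 * pi)) s4.
pose M := M0.+1.
have M_gt0 : (0 < M)%N by [].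
have MR : 0 < M%:R :> R by rewrite ltr0n.
have bM i : rho * normc (b 0 i) * (2 * (2 * pi / M%:R)) <= s / 4.
  apply: le_trans (M0P M (leqnSn _) M_gt0).
  have -> : rho * normc (b 0 i) * (2 * (2 * pi / M%:R)) =
    rho * normc (b 0 i) * (4 * pi) / M%:R by ring.
  rewrite ler_wpM2r ?invr_ge0 ?(ltW MR)// ler_wpM2r ?mulr_ge0 ?pi_ge0//.
  by rewrite ler_wpM2l// ltW.
have /choice[tP tPP] : forall j : 'I_M, exists tP : R * 'rV[{poly R[i]}]_n,
   [/\ cell M j tP.1, admissible x r s (h tP.1) tP.2 &
   (\int[mu]_(u in cell M j) envelope s (h u) <=
     ((2 * pi / M%:R) * (fine (score U s tP.2) + e1))%:E)%E].
  move=> j; have [t [P tP]] := cell_choice M_gt0 (ltn_ord j) e1_gt0 ss0.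
  by exists (t, P).
pose tt j := (tP (inord j)).1; pose P j := (tP (inord j)).2.
have ttP j : (j < M)%N -> [/\ cell M j (tt j), admissible x r s (h (tt j)) (P j) &
   (\int[mu]_(u in cell M j) envelope s (h u) <=
     ((2 * pi / M%:R) * (fine (score U s (P j)) + e1))%:E)%E].
  by move=> jM; have := tPP (inord j); rewrite inordK.
have [||F [F0 Fx] FP] := @glue_discs R n c b x rho r s e1 U M tt P rho0 s_gt0 e1_gt0 M_gt0 _ _ bM.
- by move=> j /ttP[].
- by move=> j /ttP[].
rewrite (integral_turn_cells M_gt0 (measurable_envelope_circle s)); last first.
  by move=> t; exact: envelope_circle_ge0.
apply: (@le_trans _ _ (\sum_(j < M)
    ((2 * pi / M%:R) * (fine (score U s (P j)) + e1))%:E)%E).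
  by apply: lee_sum => j _; have [] := ttP j (ltn_ord j).
rewrite sumEFin -EFinD lee_fin.
have -> : \sum_(j < M) (2 * pi / M%:R * (fine (score U s (P j)) + e1)) =
    2 * pi * (\sum_(j < M) M%:R^-1 * fine (score U s (P j))) + 2 * pi * e1.
  under eq_bigr do rewrite mulrDr.
  rewrite big_split /= sumr_const card_ord mulr_sumr; congr (_ + _).
    by apply: eq_bigr => j _; rewrite mulrA.
  by rewrite -mulr_natr; field; rewrite gt_eqF.
have FE : fine (score U (s / 2) F) <= fine (envelope 0 c).
  apply: fine_le => //; first exact: score_fin.
  by apply: (envelope_ge (m := s / 2)) => //; exact: divr_gt0.
have := ler_wpM2l (ltW p0) (le_trans FP (lerD FE (lexx e1))).
have eE : 2 * pi * e1 + 2 * pi * e1 = e.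
  have piN0 : pi != 0 :> R by rewrite gt_eqF ?pi_gt0.
  by rewrite /e1; move: (pi) piN0 => p pN0; field.
by rewrite (mulrDr (2 * pi) (fine _)) -(lerD2r (2 * pi * e1)) -[leRHS]addrA eE.
Qed.

Lemma envelope_sup_margin t : (envelope 0 (h t) <=
  limn (fun k => envelope (s0 / k.+2%:R) (h t)))%E.
Proof.
have nd : {homo (fun k => envelope (s0 / k.+2%:R) (h t)) : k l / (k <= l)%N >-> (k <= l)%E}.
  move=> k l kl; apply: envelope_mono; rewrite ler_wpM2l ?(ltW s0_gt0)//.
  by rewrite lef_pV2 ?posrE ?ltr0n// ler_nat ltnS ltnS.
rewrite (cvg_lim _ (ereal_nondecreasing_cvgn nd))//.
apply: ge_ereal_sup => _ [m [P [m0 Pt ->]]].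
have [k0 k0P] := @large_denominator R s0 (m / 2) (divr_gt0 m0 (ltr0n _ 2)).
apply: le_trans (ereal_sup_ubound _); last by exists k0.
apply: envelope_ge Pt; apply: le_lt_trans (k0P _ _ _) _; [lia|lia|].
by rewrite ltr_pdivrMr// ltr_pMr// ltr1n.
Qed.

(** Monotone convergence as the margin decreases to 0. *)
Lemma integral_envelope :
  (\int[mu]_(t in @turn R) envelope 0 (h t) <= (2 * pi)%:E * envelope 0 c)%E.
Proof.
have s_lt k : 0 < s0 / k.+2%:R /\ s0 / k.+2%:R < s0.
  by rewrite divr_gt0// ltr_pdivrMr ?ltr0n// ltr_pMr// ltr1n.
apply: le_trans (le_integral_any mu (fun t _ => envelope_sup_margin t)) _.
rewrite (@monotone_convergence _ _ _ mu (@turn R) (@measurable_turn R)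
  (fun k t => envelope (s0 / k.+2%:R) (h t))); last 3 first.
- by move=> k; apply: measurable_funTS; exact: measurable_envelope_circle.
- by move=> k t _; apply: envelope_circle_ge0; have [] := s_lt k.
- move=> t _ k l kl; apply: envelope_mono; rewrite ler_wpM2l ?(ltW s0_gt0)//.
  by rewrite lef_pV2 ?posrE ?ltr0n// ler_nat ltnS ltnS.
apply: lime_le.
  apply: ereal_nondecreasing_is_cvgn => k l kl; apply: le_integral_any => t _.
  apply: envelope_mono; rewrite ler_wpM2l ?(ltW s0_gt0)//.
  by rewrite lef_pV2 ?posrE ?ltr0n// ler_nat ltnS ltnS.
apply: nearW => k; have [h1 h2] := s_lt k; exact: integral_envelope_margin.
Qed.

End Circle.

(** In each coordinate, use the point of the disc at which the two summands
    have the same argument. *)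
Lemma disc_margin (c b : 'rV[R[i]]_n) (rho : R) : 0 < rho ->
  (forall l : R[i], normc l <= rho -> polydisc x r (c + l *: b)) ->
  exists2 s : R, 0 < s &
    forall i, normc (c 0 i - x 0 i) + rho * normc (b 0 i) <= r - s.
Proof.
move=> rho0 cb.
have [|s s0 sP] := @uniform_radius R n (fun i s =>
    normc (c 0 i - x 0 i) + rho * normc (b 0 i) <= r - s); last first.
  by exists s => // i; apply: sP; rewrite s0 lexx.
move=> i; have [z z1 zE] := aligned_direction (c 0 i - x 0 i) (b 0 i).
have [z' z'1 z'E] := aligned_direction (c 0 i - x 0 i) (rho%:C * b 0 i).
exists (r - (normc (c 0 i - x 0 i) + rho * normc (b 0 i))).
  rewrite subr_gt0 -[rho in X in X < _]gtr0_norm// -normc_real -normcM -z'E.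
  have := cb (z' * rho%:C); rewrite normcM z'1 mul1r normc_real gtr0_norm// lexx.
  by move=> /(_ isT i); rewrite !mxE addrAC mulrA.
by move=> t /andP[_]; lra.
Qed.

(** Poletsky's theorem for the indicator of an open set. *)
Lemma envelope_plurisubharmonic :
  plurisubharmonic (polydisc x r) (fun z => (- envelope 0 z)%E).
Proof.
have env0 z : polydisc x r z -> (0 <= envelope 0 z)%E.
  move=> xz; have [|s s0 sP] := @uniform_radius R n (fun i s =>
    normc (z 0 i - x 0 i) <= r - s).
    move=> i; exists (r - normc (z 0 i - x 0 i)); first by rewrite subr_gt0.
    by move=> t /andP[_]; lra.
  by apply: (envelope_ge0 s0) => i; apply: sP; rewrite s0 lexx.
have usc z : polydisc x r z -> ((- envelope 0 z)%E < +oo)%E /\ forall a : R,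
    (- envelope 0 z < a%:E)%E -> exists2 k : R, 0 < k &
    forall z', closed_polydisc z k z' -> (- envelope 0 z' < a%:E)%E.
  move=> xz; split.
    by apply: (@le_lt_trans _ _ 0%E); rewrite ?ltry// oppe_le0 env0.
  move=> a; rewrite lteNl -EFinN => /envelope_lsc[k k0 kP].
  by exists k => // z' zz'; rewrite lteNl -EFinN; exact: kP.
split.
  move=> z /usc[zoo zk]; split => // a /zk[k k0 kP].
  apply: (@filterS _ (nbhs z) _ (polydisc z k)); last first.
    by apply/nbhs_polydiscP; exists k.
  by move=> z' zz' _; apply: kP => i; exact: ltW.
move=> a b; split.
  move=> l /usc[zoo zk]; split => // e /zk[k k0 kP].
  have [d d0 dP] := line_close b k0.
  apply: (@filterS _ (nbhs l) _ [set l' | normc (l' - l) < d]); last first.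
    by apply/nbhs_complexP; exists d.
  move=> l' /= ll' _; apply: kP => i.
  by rewrite !mxE opprD addrACA subrr add0r -mulrBl; apply: dP; exact: ltW.
move=> l rho rho0 lD.
pose c := a + l *: b.
have lineE (w : R[i]) : a + (l + w) *: b = c + w *: b by rewrite scalerDl addrA.
have [|s s0 sm] := @disc_margin c b rho rho0.
  move=> w wr; rewrite -lineE; apply: lD; apply/closed_discE.
  by rewrite addrC addKr.
have I0 := integral_envelope rho0 s0 sm.
rewrite /circle_mean; under eq_integral do rewrite lineE.
rewrite integral_ge0N; last first.
  by move=> t _; apply: (envelope_circle_ge0 (s0 := s)).
rewrite muleN leeN2 -[leRHS]mul1e.
have p0 := @pi2_gt0 R.
rewrite -[1%E](_ : ((2 * pi)^-1)%:E * (2 * pi)%:E = 1)%E; last first.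
  by rewrite -EFinM mulVf ?gt_eqF.
by rewrite -muleA lee_wpmul2l// lee_fin invr_ge0 ltW.
Qed.

End Envelope.

(** * From non-thinness to discs *)

Section NonThin.
Variables (R : realType) (n : nat).
Notation mu := (@lebesgue_measure R).

(** At the points of Y other than x the envelope is 2 pi, as constant discs
    there lie in U.  Non-thinness transports this value to x, where it means
    that discs with a score close to 2 pi exist. *)
Lemma discs_of_non_thin (Y : set 'rV[R[i]]_n) (x : 'rV[R[i]]_n) : non_thin Y x ->
  forall (e : R) (V U : set 'rV[R[i]]_n), 0 < e -> nbhs x V -> open U ->
    Y `\ x `<=` U ->
    exists f : R[i] -> 'rV[R[i]]_n, [/\ holomorphic_disc V f, f 0 = x &
      ((1 - e)%:E < arc_measure (@unit_circle R `&` f @^-1` (V `&` U)))%E].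
Proof.
move=> [_ thin] e V U e0 /nbhs_polydiscP[r r0 rV] oU YU.
have p0 := @pi2_gt0 R.
have full : (limsup_along (fun z => (- envelope x r U 0 z)%E) (polydisc x r `&` (Y `\ x)) x
   <= (- (2 * pi))%:E)%E.
  apply: ge_ereal_inf; eexists; first by exists 1 => //=; exact: ltr01.
  apply: ge_ereal_sup => _ [z [_ [xz Yz]] <-].
  rewrite EFinN leeN2.
  have [m1 m10 m1P] := (open_polydiscP U).1 oU _ (YU _ Yz).
  have [|m m0 mP] := @uniform_radius R n (fun i m =>
     normc (z 0 i - x 0 i) <= r - m /\ m <= m1).
    move=> i; exists (Num.min m1 (r - normc (z 0 i - x 0 i))).
      by rewrite lt_min m10 subr_gt0 xz.
    by move=> t /andP[_]; rewrite le_min => /andP[? ?]; split => //; lra.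
  have adm : admissible x r m z (const_disc z).
    by apply: admissible_const => i; have [] := mP i m; rewrite ?m0 ?lexx.
  apply: le_trans (envelope_ge U m0 adm).
  rewrite -(@measure_turn R); apply: le_measure; rewrite ?inE.
  - exact: measurable_turn.
  - by apply: measurableI; [exact: measurable_turn|exact: measurable_robust_args].
  - move=> t tt; split => // y; rewrite eval_const => ym; apply: m1P => i.
    by have [//|_] := mP i m; rewrite ?m0 ?lexx//; apply: lt_le_trans (ym i).
have := thin _ _ (@open_polydisc R n x r) (polydisc_center x r0)
  (envelope_plurisubharmonic x r U).
move=> limE; rewrite limE leeNl -EFinN opprK in full.
have : ((2 * pi * (1 - e))%:E < envelope x r U 0 x)%E.
  apply: lt_le_trans full; rewrite lte_fin gtr_pMr//; lra.
move=> /envelope_gt[m [P [m0 [P0 Px] eP]]].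
have inV w : normc w <= 1 -> V (eval P w).
  move=> w1; apply: rV => i; apply: le_lt_trans (eval_maximum_principle Px w1 i) _.
  by rewrite ltrBlDr ltrDl.
exists (eval P); split => //; first exact: holomorphic_disc_eval.
set A := (X in arc_measure X).
have AE (t : R) : A (expi t) <-> U (eval P (expi t)).
  split=> [[_ [_]]//|Ut]; split; first by rewrite /unit_circle /= normrc normc_expi.
  by split => //; apply: inV; rewrite normc_expi.
have mA : measurable [set t : R | A (expi t)].
  apply: open_measurable; rewrite openE => t /AE Ut.
  have [d d0 dU] := (open_polydiscP U).1 oU _ Ut.
  have [k k0 kP] := eval_continuous P (expi t) d0.
  apply/nbhs_ballP; exists k => // t'; rewrite -ball_normE /= => tt'.
  apply/AE/dU/kP; apply: le_lt_trans (expi_lipschitz _ _) _.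
  by rewrite distrC.
have le : (score U m P <= mu (@turn R `&` [set t | A (expi t)]))%E.
  apply: le_measure; rewrite ?inE.
  - by apply: measurableI; [exact: measurable_turn|exact: measurable_robust_args].
  - by apply: measurableI => //; exact: measurable_turn.
  - by move=> t [tt rob]; split => //; apply/AE; apply: rob; exact: polydisc_center.
have {eP le} lt := lt_le_trans eP le.
rewrite /arc_measure -[ltLHS](_ : ((2 * pi)^-1)%:E * (2 * pi * (1 - e))%:E = (1 - e)%:E)%E.
  by rewrite lte_pmul2l// lte_fin invr_gt0.
by rewrite -EFinM mulrA mulVf ?mul1r// gt_eqF.
Qed.

End NonThin.

Theorem corollary6 (R : realType) (n : nat) (Y : set 'rV[R[i]]_n)
    (x : 'rV[R[i]]_n) :
  non_thin Y x <->
  (forall (e : R) (V U : set 'rV[R[i]]_n),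
     0 < e -> nbhs x V -> open U -> Y `\ x `<=` U ->
     exists f : R[i] -> 'rV[R[i]]_n,
       [/\ holomorphic_disc V f,
           f 0 = x &
           ((1 - e)%:E <
              arc_measure (@unit_circle R `&` f @^-1` (V `&` U)))%E]).
Proof.
by split; [exact: discs_of_non_thin|exact: non_thin_of_discs].
Qed.
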